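(* Let $\Delta\subset\mathbb{R}^n$ be a full-dimensional lattice polytope with facet description $\Delta=\{x\in\mathbb{R}^n\mid \mathcal{A}x\ge -b\}$, where $\mathcal{A}\in\mathbb{Z}^{r\times n}$ has as rows the primitive inward-pointing facet normals and $b\in\mathbb{Z}^r$. Suppose that the lattice affinely spanned by $\Delta\cap\mathbb{Z}^n$ has odd index in $\mathbb{Z}^n$, and that the sublattice $\Lambda_{\mathcal{A}}\subset\mathbb{Z}^r$ spanned by the columns of $\mathcal{A}$ has odd index in its saturation $(\Lambda_{\mathcal{A}}\otimes_{\mathbb{Z}}\mathbb{Q})\cap\mathbb{Z}^r$. If there is a vector $v$ in the integer column span of the $r\times(n+1)$ matrix $[\mathcal{A}:b]$ all of whose components are odd, then the standard orientation of $\mathbb{R}^r$ induces an orientation on the smooth part of $Y^+_\Delta$ via the map $\psi_\Delta\colon\mathbb{R}^r-B_\Delta\to Y^+_\Delta$.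
   Context: Notation. $X_\Delta\subset\mathbb{P}^\Delta$ is the Zariski closure of the image of $(\mathbb{C}^\times)^n\to\mathbb{P}^\Delta$, $t\mapsto[t^m\mid m\in\Delta\cap\mathbb{Z}^n]$, where $\mathbb{P}^\Delta=\mathbb{P}^{\ell-1}$ is the complex projective space with coordinates $x_m$ indexed by $\Delta\cap\mathbb{Z}^n$, and $\ell=\#(\Delta\cap\mathbb{Z}^n)$. $Y_\Delta$ is the set of real points of $X_\Delta$. $Y^+_\Delta\subset S^{\ell-1}\subset\mathbb{R}^\ell$ is the subset of the unit sphere cut out by the same homogeneous equations as $Y_\Delta$; it is a double cover of $Y_\Delta$. A point of $Y^+_\Delta$ is smooth if its image is a smooth point of $X_\Delta$. Let $a_1,\dots,a_r$ be the rows of $\mathcal{A}$. For $z\in\mathbb{R}^r$ and $m\in\Delta\cap\mathbb{Z}^n$ put $z(m)=\prod_{i=1}^r z_i^{a_i\cdot m+b_i}$. $B_\Delta$ is the common zero locus of all the $z(m)$. The map $\psi_\Delta\colon\mathbb{R}^r-B_\Delta\to Y_\Delta^+$ sends $z$ to $g(z)/\|g(z)\|$, where $g(z)=(z(m))_{m\in\Delta\cap\mathbb{Z}^n}$. Meaning of ''induces''. Let $K=\{\mu\in(\mathbb{R}^\times)^r\mid \prod_i\mu_i^{a_{ij}}=1\text{ for }j=1,\dots,n,\ \prod_i\mu_i^{b_i}>0\}$, an abelian Lie group of dimension $r-n$ acting on $\mathbb{R}^r$ by coordinatewise multiplication; $\psi_\Delta$ is $K$-invariant. Fix an orientation of the Lie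 algebra of $K$. At a point $z$ such that $\psi_\Delta(z)$ is a smooth point of $Y_\Delta^+$, $\psi_\Delta$ is a submersion at $z$ onto the smooth part, and $\ker d\psi_\Delta(z)=T_z(Kz)$, the standard orientation of $\mathbb{R}^r$ and the orientation of $T_z(Kz)\cong\mathrm{Lie}(K)$ determine an orientation of $T_{\psi_\Delta(z)}Y_\Delta^+\cong T_z\mathbb{R}^r/T_z(Kz)$. The assertion is that there is an orientation of the manifold of smooth points of $Y_\Delta^+$ agreeing with these at all such $z$. (If the image of $\psi_\Delta$ lies in only one of two antipodal pieces whose union is $Y_\Delta^+$, the other piece is oriented in the same way using $-\psi_\Delta$.) In particular the smooth part of $Y_\Delta^+$ is orientable. *)

(* Defs.v *)
From HB Require Import structures.
From mathcomp Require Import all_boot all_order all_algebra.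
From mathcomp Require Import all_classical all_reals all_analysis.
From mathcomp Require Import complex.
(* The notations of mpoly clash with those of the analysis library. *)
From mathcomp Require mpoly.
Import (canonicals, coercions) mpoly.

Set Implicit Arguments.
Unset Strict Implicit.
Unset Printing Implicit Defensive.

Import Order.TTheory GRing.Theory Num.Theory.
Import numFieldNormedType.Exports.

Local Open Scope classical_set_scope.
Local Open Scope ring_scope.

(** * Lattices *)

Section Lattices.

(* [M : L] = k, for subgroups L of M: k representatives of the cosets. *)
Definition has_index (V : zmodType) (L M : set V) (k : nat) : Prop :=
  exists u : 'I_k -> V,
    (forall i, M (u i)) /\ (forall w, M w -> exists! i, L (w - u i)).

Definition odd_index (V : zmodType) (L M : set V) : Prop :=
  exists k : nat, has_index L M k /\ odd k.

Definition col_span (m n : nat) (A : 'M[int]_(m, n)) : set 'cV[int]_m :=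
  [set A *m c | c in [set: 'cV[int]_n]].

(* (L (x) Q) /\ Z^m, where L is the column span of A. *)
Definition saturation (m n : nat) (A : 'M[int]_(m, n)) : set 'cV[int]_m :=
  [set w | exists q : 'cV[rat]_n,
     map_mx (intr : int -> rat) w = map_mx (intr : int -> rat) A *m q].

(* The direction lattice of the affine lattice spanned by the points pts k;
   the index of an affine lattice is that of its direction lattice. *)
Definition affine_lattice_dir (n ell : nat) (pts : 'I_ell -> 'cV[int]_n) :
    set 'cV[int]_n :=
  [set w | exists c : 'I_ell -> int,
     \sum_k c k = 0 /\ w = \sum_k c k *: pts k].

End Lattices.

(** * Polytopes *)

Section Polytopes.
Variables (R : realType) (n : nat).
Implicit Types (S Delta : set 'cV[R]_n).

Definition toR (m k : nat) (M : 'M[int]_(m, k)) : 'M[R]_(m, k) :=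
  map_mx (intr : int -> R) M.

Definition lattice_polytope Delta : Prop :=
  exists (k : nat) (v : 'I_k.+1 -> 'cV[int]_n),
    Delta = [set x | exists w : 'I_k.+1 -> R,
      [/\ forall i, 0 <= w i, \sum_i w i = 1
        & x = \sum_i w i *: toR (v i)]].

(* S is nonempty and its affine hull has dimension d. *)
Definition has_affine_dim S (d : nat) : Prop :=
  exists (x0 : 'cV[R]_n) (M : 'M[R]_(n, d)),
    [/\ S x0, \rank M = d, forall j, S (x0 + col j M)
      & forall x, S x -> exists c : 'cV[R]_d, x = x0 + M *m c].

Definition full_dimensional Delta : Prop := has_affine_dim Delta n.

Definition primitive (a : 'rV[int]_n) : Prop :=
  forall d : int, (forall j, (d %| a ord0 j)%Z) -> (d %| 1)%Z.

(* a is the primitive inward-pointing normal of a facet of Delta, and this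
   facet lies on the hyperplane a.x = -c. *)
Definition primitive_facet_normal Delta (a : 'rV[int]_n) (c : int) : Prop :=
  [/\ primitive a,
      forall x, Delta x -> - c%:~R <= (toR a *m x) 0 0
    & exists2 d : nat, d.+1 = n
        & has_affine_dim
            [set x | Delta x /\ (toR a *m x) 0 0 = - c%:~R] d].

Definition facet_description (r : nat) Delta
    (A : 'M[int]_(r, n)) (b : 'cV[int]_r) : Prop :=
  [/\ Delta = [set x | forall i, - (b i 0)%:~R <= (toR A *m x) i 0],
      forall i, primitive_facet_normal Delta (row i A) (b i 0),
      injective (fun i => row i A)
    & forall a c, primitive_facet_normal Delta a c -> exists i, row i A = a].

(* pts enumerates the lattice points of Delta, without repetition. *)
Definition enum_lattice_points (ell : nat) Delta
    (pts : 'I_ell -> 'cV[int]_n) : Prop :=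
  injective pts /\ (forall m, Delta (toR m) <-> exists k, pts k = m).

End Polytopes.

(** * Frames and orientations of vector spaces *)

Section Frames.
Variables (F : fieldType) (N d : nat).

(* The rows of M form a basis of V. *)
Definition is_frame (V : set 'rV[F]_N) (M : 'M[F]_(d, N)) : Prop :=
  row_free M /\ (forall v, V v <-> (v <= M)%MS).

End Frames.

Definition has_dim (F : fieldType) (N : nat) (V : set 'rV[F]_N) (d : nat) :
    Prop := exists M : 'M[F]_(d, N), is_frame V M.

(* An orientation of V (a space of dimension d) tells which frames are
   positively oriented. Using a sign, rather than an equivalence class of
   frames, gives two orientations also when d = 0. *)
Definition is_orientation (R : realType) (N d : nat) (V : set 'rV[R]_N)
    (o : 'M[R]_(d, N) -> bool) : Prop :=
  forall (M : 'M[R]_(d, N)) (g : 'M[R]_d),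
    is_frame V M -> g \in unitmx -> o (g *m M) = (o M == (0 < \det g)).

(* An orientation of a d-dimensional submanifold S of R^N, with tangent spaces
   T p: a pointwise orientation that has constant sign along a continuous
   local frame around each point. *)
Definition is_manifold_orientation (R : realType) (N d : nat)
    (S : set 'rV[R]_N) (T : 'rV[R]_N -> set 'rV[R]_N)
    (o : 'rV[R]_N -> 'M[R]_(d, N) -> bool) : Prop :=
  (forall p, S p -> is_orientation (T p) (o p)) /\
  (forall p, S p -> exists (U : set 'rV[R]_N) (E : 'rV[R]_N -> 'M[R]_(d, N)),
     [/\ nbhs p U, {within U `&` S, continuous E}
       & forall q, (U `&` S) q -> is_frame (T q) (E q) /\ o q (E q) = o p (E p)]).

(** * Complex projective varieties
   Points of projective space are given by homogeneous coordinates, that is,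
   by nonzero row vectors. *)

Section Projective.
Variables (C : fieldType) (ell : nat).
Implicit Types (S : set 'rV[C]_ell) (x : 'rV[C]_ell).

Let pol : Type := mpoly.mpoly ell C.

Definition peval (f : pol) x : C := mpoly.meval (x 0) f.

Definition homogeneous (f : pol) : Prop :=
  exists d : nat, f \is mpoly.ishomog1 d mpoly.mdeg.

(* The homogeneous equations of S. *)
Definition equations S : set pol :=
  [set f | homogeneous f /\ forall x, S x -> peval f x = 0].

Definition zariski_closure S : set 'rV[C]_ell :=
  [set x | x != 0 /\ forall f, equations S f -> peval f x = 0].

(* The coordinates x_k, k in J, are algebraically independent in the
   homogeneous coordinate ring of X. *)
Definition alg_indep X (J : {set 'I_ell}) : Prop :=
  forall f : pol, equations X f ->
    (forall mon, mon \in mpoly.msupp f -> forall k, k \notin J -> mon k = 0%N) ->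
    f = 0.

(* dim X = d, for X irreducible: the homogeneous coordinate ring of X, which is
   generated by the coordinates, has transcendence degree d + 1. *)
Definition proj_dim X (d : nat) : Prop :=
  (exists2 J : {set 'I_ell}, #|J| = d.+1 & alg_indep X J) /\
  (forall J : {set 'I_ell}, alg_indep X J -> (#|J| <= d.+1)%N).

(* The Zariski tangent space at x of the affine cone over X. *)
Definition cone_tangent X x : set 'rV[C]_ell :=
  [set v | forall f, equations X f ->
     \sum_k peval (mpoly.mderiv k f) x * v 0 k = 0].

Definition smooth_point X x : Prop :=
  X x /\ exists2 d, proj_dim X d & has_dim (cone_tangent X x) d.+1.

End Projective.

(** * The toric variety of Delta, and its real points *)

Section Toric.
Variables (R : realType) (n ell : nat) (pts : 'I_ell -> 'cV[int]_n).

Let C : fieldType := complex R.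

Definition monomial_map (t : 'rV[C]_n) : 'rV[C]_ell :=
  \row_k \prod_i t 0 i ^ (pts k i 0).

Definition X_Delta : set 'rV[C]_ell :=
  zariski_closure [set monomial_map t | t in [set t : 'rV[C]_n | forall i, t 0 i != 0]].

Definition toC (x : 'rV[R]_ell) : 'rV[C]_ell := map_mx (real_complex R) x.

Definition Y_Delta : set 'rV[R]_ell := [set x | X_Delta (toC x)].

Definition enorm (x : 'rV[R]_ell) : R := Num.sqrt (\sum_k x 0 k ^+ 2).

Definition Yplus : set 'rV[R]_ell := [set x | Y_Delta x /\ enorm x = 1].

Definition Yplus_smooth : set 'rV[R]_ell :=
  [set x | Yplus x /\ smooth_point X_Delta (toC x)].

(* The common kernel of the differentials of the equations defining Yplus. *)
Definition Yplus_tangent (p : 'rV[R]_ell) : set 'rV[R]_ell :=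
  [set v | cone_tangent X_Delta (toC p) (toC v) /\ \sum_k p 0 k * v 0 k = 0].

End Toric.

(** * The map psi and the orientation it induces *)

Section Psi.
Variables (R : realType) (n r ell : nat).
Variables (A : 'M[int]_(r, n)) (b : 'cV[int]_r) (pts : 'I_ell -> 'cV[int]_n).

Definition gmap (z : 'rV[R]_r) : 'rV[R]_ell :=
  \row_k \prod_i z 0 i ^ ((A *m pts k + b) i 0).

Definition B_Delta : set 'rV[R]_r := [set z | forall k, gmap z 0 k = 0].

Definition psi (z : 'rV[R]_r) : 'rV[R]_ell := (enorm (gmap z))^-1 *: gmap z.

Definition K : set 'rV[R]_r :=
  [set mu | [/\ forall i, mu 0 i != 0,
                forall j, \prod_i mu 0 i ^ (A i j) = 1
              & 0 < \prod_i mu 0 i ^ (b i 0)]].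

(* The Lie algebra of K: the generators of its one-parameter subgroups. *)
Definition LieK : set 'rV[R]_r :=
  [set l | forall t : R, K (\row_i expR (t * l 0 i))].

(* The value at z of the vector field generated by l, d/dt exp(t l) z. *)
Definition inf_action (z l : 'rV[R]_r) : 'rV[R]_r := \row_i (l 0 i * z 0 i).

Definition orbit_tangent (z : 'rV[R]_r) : set 'rV[R]_r :=
  [set inf_action z l | l in LieK].

(* phi, which will be psi or - psi, is a submersion at z onto the smooth part
   of Yplus, with kernel the tangent space of the orbit. *)
Definition orienting_point (phi : 'rV[R]_r -> 'rV[R]_ell) (z : 'rV[R]_r) :
    Prop :=
  [/\ ~ B_Delta z, Yplus_smooth pts (phi z),
      [set 'd phi z w | w in [set: 'rV[R]_r]] = Yplus_tangent pts (phi z)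
    & [set w | 'd phi z w = 0] = orbit_tangent z].

(* o is the orientation of the tangent space at phi z obtained by giving
   T_z (K z) the orientation oK of Lie(K), and R^r the standard one. If L is a
   frame of Lie(K) and the rows of W lift those of a frame E at phi z, then the
   matrix below has rows the frame L z of T_z (K z), followed by W.
   As n <= r for a polytope, (r - n) + n = r and conform_mx is a mere cast. *)
Definition induced_orientation (phi : 'rV[R]_r -> 'rV[R]_ell) (z : 'rV[R]_r)
    (oK : 'M[R]_(r - n, r) -> bool) (o : 'M[R]_(n, ell) -> bool) : Prop :=
  forall (L : 'M[R]_(r - n, r)) (W : 'M[R]_(n, r)) (E : 'M[R]_(n, ell)),
    is_frame LieK L -> is_frame (Yplus_tangent pts (phi z)) E ->
    (forall i, 'd phi z (row i W) = row i E) ->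
    let Lz := \matrix_(i < r - n) inf_action z (row i L) in
    o E = (oK L == (0 < \det (conform_mx (0 : 'M[R]_r) (col_mx Lz W)))).

(* psi induces an orientation on the smooth part of Yplus, for the orientation
   oK of Lie(K). The last clause is for the case where the image of psi lies in
   only one of two antipodal pieces P and - P of Yplus. *)
Definition psi_induces_orientation (oK : 'M[R]_(r - n, r) -> bool) : Prop :=
  exists o : 'rV[R]_ell -> 'M[R]_(n, ell) -> bool,
    [/\ is_manifold_orientation (Yplus_smooth pts) (Yplus_tangent pts) o,
        forall z, orienting_point psi z -> induced_orientation psi z oK (o (psi z))
      & forall P : set 'rV[R]_ell,
          let N := [set - p | p in P] in
          let im := [set psi z | z in ~` B_Delta] in
          Yplus pts = P `|` N -> im `<=` P -> ~ (im `<=` N) ->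
          let phi z := - psi z in
          forall z, orienting_point phi z ->
            induced_orientation phi z oK (o (phi z))].

End Psi.

(* Main.v *)
(* Put hat m = (1, m), and let H be the matrix with columns hat m. The cone over
   X_Delta is cut out by the binomials x^a - x^b with H a = H b. As the index of
   the lattice is odd, H Q = N for an integer matrix Q and an odd N. By the parity
   hypothesis [b : A] ct has only odd entries, for an integer vector ct.

   Where no coordinate of q vanishes, tangent vectors are of the form
   l H diag(q), and the sign of
     tau(q, M) = q^(Q ct) det([q; M] diag(q)^-1 Q)
   orients the sphere. If q = g(z), and M is the image of W under dg(z), then up to
   a positive factor tau(q, M) is (prod_i z_i^(v_i))^N det(W diag(z)^-1 A), with
   v = [b : A] ct. Since N and all v_i are odd, its sign is that of
   (prod_i z_i) det(W diag(z)^-1 A), hence that of det [L z; W] times a constant: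
   tau is the orientation induced by psi.

   This extends over the smooth points p with vanishing coordinates. Some n + 1
   coordinates form a chart at p, and those of them that vanish at p correspond to
   facet normals of Delta, so they occur in q^(Q ct) with odd exponent, up to
   factors that do not vanish at p. Therefore the sign of tau, relative to the
   chart, is constant near p.

   For - psi, either b is in the column span of A modulo 2, and ct can be chosen
   so that q^(Q ct) is even in q, or some change of signs of the coordinates of z
   turns psi z into - psi z, so that the image of psi is symmetric. *)

Require Import Defs.
From mathcomp Require Import all_boot all_order all_algebra.
From mathcomp Require Import all_classical all_reals all_analysis.
From mathcomp Require Import complex.
From mathcomp Require mpoly.
Import (canonicals, coercions) mpoly.
From mathcomp Require Import ring lra zify.

Set Implicit Arguments.
Unset Strict Implicit.
Unset Printing Implicit Defensive.

Import Order.TTheory GRing.Theory Num.Theory.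
Import numFieldNormedType.Exports.

Local Open Scope classical_set_scope.
Local Open Scope ring_scope.

(** * Cones defined by binomials *)

(** The chart at p comes from the combinatorics of the weights [H c]. Modulo the lattice of the
    weights supported on the nonzero coordinates of p, the weights of monomials form a semigroup
    without nontrivial units. Each irreducible class gives a tangent vector transversal to the torus
    orbit, and the orbit gives as many directions as the supported weights have rank. These vectors
    are independent and the corresponding weights span everything, so at a smooth point there are
    exactly n + 1 of them: the quotient is free on the vanishing chart coordinates. Their coordinate
    functionals are nonnegative on all lattice points, hence proportional to rows of [b : A].
    X_Delta need not be normal: such a functional is integral on weights [H c], but perhaps not on
    all of Z^(1+n). Therefore ct is multiplied by N before it is read in the chart, and N has to be
    odd for parity to survive. No implicit function theorem is used. Torus points are dense near p
    because of explicit arcs s -> (s^nu_k P_k), and any two charts are compared through the sign of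
    tau at torus points. *)

Section Weights.
Variables (N ell : nat) (H : 'M[int]_(N, ell)).
Implicit Types (a b : 'I_ell -> nat) (c : 'cV[int]_ell).

Definition natcol a : 'cV[int]_ell := \col_k (a k : int).
Definition same_weight a b : Prop := H *m natcol a = H *m natcol b.
Definition dcol (k : 'I_ell) : 'cV[int]_ell := delta_mx k 0.

Lemma dcolE k i : dcol k i 0 = (i == k)%:R.
Proof. by rewrite !mxE eqxx andbT. Qed.

Lemma natcolE a k : natcol a k 0 = a k.
Proof. by rewrite mxE. Qed.

Lemma natcolD a b : natcol (fun k => a k + b k)%N = natcol a + natcol b.
Proof. by apply/colP => k; rewrite !mxE PoszD. Qed.

Lemma natcol_delta k : natcol (fun i => (i == k) : nat) = dcol k.
Proof. by apply/colP => i; rewrite natcolE dcolE; case: eqP. Qed.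

(** The positive and negative parts of c. Both vanish where c does, so they inherit its support. *)
Lemma natcol_split c : exists a b, c = natcol a - natcol b /\
  forall k, (0 <= c k 0 -> b k = 0%N) /\ (c k 0 <= 0 -> a k = 0%N).
Proof.
exists (fun k => absz (Num.max 0 (c k 0))), (fun k => absz (Num.max 0 (- c k 0))).
split; first by apply/colP => k; rewrite !mxE; lia.
by move=> k; split => h; lia.
Qed.

Section Points.
Variable F : fieldType.
Implicit Types q v : 'rV[F]_ell.

Definition mon q a : F := \prod_k q 0 k ^+ a k.
(** The derivative of x^a at q in the direction v. Truncated subtraction is harmless, since the term
    with [a k = 0] has coefficient 0. *)
Definition dmon q v a : F :=
  \sum_k (a k)%:R * v 0 k * \prod_i q 0 i ^+ (a i - (i == k)).
Definition zmon q c : F := \prod_k q 0 k ^ c k 0.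

Definition binomial_locus q : Prop :=
  q != 0 /\ forall a b, same_weight a b -> mon q a = mon q b.
Definition tangent_cone q v : Prop :=
  forall a b, same_weight a b -> dmon q v a = dmon q v b.

(** Under this condition [zmon q c] is a genuine Laurent monomial at q, nonzero and multiplicative
    in c; otherwise the convention that 0 has inverse 0 would interfere. *)
Definition supported q c : Prop := forall k, q 0 k = 0 -> c k 0 = 0.

Lemma supportedD q c d : supported q c -> supported q d -> supported q (c + d).
Proof. by move=> hc hd k qk; rewrite mxE hc ?hd ?addr0. Qed.

Lemma supportedN q c : supported q c -> supported q (- c).
Proof. by move=> hc k qk; rewrite mxE hc ?oppr0. Qed.

Lemma supportedB q c d : supported q c -> supported q d -> supported q (c - d).
Proof. by move=> hc hd; apply: supportedD => //; apply: supportedN. Qed.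

Lemma supported0 q : supported q 0.
Proof. by move=> k _; rewrite mxE. Qed.

Lemma supported_dcol q k : q 0 k != 0 -> supported q (dcol k).
Proof.
move=> qk i qi; rewrite dcolE; case: eqP => // ik.
by rewrite -ik qi eqxx in qk.
Qed.

Lemma zmonD q c d : supported q c -> supported q d ->
  zmon q (c + d) = zmon q c * zmon q d.
Proof.
move=> hc hd; rewrite -big_split; apply: eq_bigr => k _ /=.
rewrite mxE; case: (eqVneq (q 0 k) 0) => [qk|qk]; last by rewrite expfzDr.
by rewrite hc // hd // addr0 expr0z mulr1.
Qed.

Lemma zmon0 q : zmon q 0 = 1.
Proof. by apply: big1 => k _; rewrite mxE expr0z. Qed.

Lemma zmon_neq0 q c : supported q c -> zmon q c != 0.
Proof.
move=> hc; apply/prodf_neq0 => k _.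
case: (eqVneq (q 0 k) 0) => [qk|qk]; first by rewrite hc // expr0z oner_neq0.
by rewrite expfz_neq0.
Qed.

Lemma zmonN q c : supported q c -> zmon q (- c) = (zmon q c)^-1.
Proof.
move=> hc; apply: (mulIf (zmon_neq0 hc)).
by rewrite -zmonD ?addNr ?zmon0 ?mulVf ?zmon_neq0 //; apply: supportedN.
Qed.

Lemma zmonB q c d : supported q c -> supported q d ->
  zmon q (c - d) = zmon q c / zmon q d.
Proof. by move=> hc hd; rewrite zmonD ?zmonN //; apply: supportedN. Qed.

Lemma zmon_natcol q a : zmon q (natcol a) = mon q a.
Proof. by apply: eq_bigr => k _; rewrite natcolE. Qed.

Lemma zmon_dcol q k : zmon q (dcol k) = q 0 k.
Proof.
rewrite /zmon (bigD1 k) //= big1 ?mulr1 => [|i ik]; last first.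
  by rewrite dcolE (negbTE ik) expr0z.
by rewrite dcolE eqxx expr1z.
Qed.

Lemma mon_neq0 q a : (mon q a != 0) <-> supported q (natcol a).
Proof.
split=> [h k qk|h]; last by rewrite -zmon_natcol zmon_neq0.
rewrite natcolE; case: (posnP (a k)) => [-> //|ak].
by move: h; rewrite /mon (bigD1 k) //= qk expr0n gtn_eqF //= mul0r eqxx.
Qed.

(** The nonzero coordinates of q form a face: for c = a - b the monomial x^b does not vanish at q,
    so neither does x^a, which takes the same value. *)
Lemma locus_face q c : binomial_locus q -> H *m c = 0 ->
  (forall k, q 0 k = 0 -> 0 <= c k 0) -> supported q c.
Proof.
move=> [_ hq] Hc cpos; have [a [b [cE ab]]] := natcol_split c.
have sw : same_weight a b.
  by apply/eqP; rewrite -subr_eq0 -mulmxBr -cE Hc.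
have hb : supported q (natcol b).
  by move=> k qk; rewrite natcolE (proj1 (ab k)) // cpos.
rewrite cE; apply: supportedB => //.
by apply/mon_neq0; rewrite (hq _ _ sw); apply/mon_neq0.
Qed.

Lemma zmon_ker q c : binomial_locus q -> H *m c = 0 -> supported q c ->
  zmon q c = 1.
Proof.
move=> [_ hq] Hc hc; have [a [b [cE ab]]] := natcol_split c.
have sw : same_weight a b.
  by apply/eqP; rewrite -subr_eq0 -mulmxBr -cE Hc.
have hb : supported q (natcol b).
  move=> k qk; rewrite natcolE (proj1 (ab k)) // (hc k qk).
  by [].
have ha : supported q (natcol a).
  by move=> k qk; rewrite natcolE (proj2 (ab k)) // (hc k qk).
by rewrite cE zmonB // !zmon_natcol (hq _ _ sw) divff //; apply/mon_neq0.
Qed.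

Lemma dmon_supported q v a : supported q (natcol a) ->
  dmon q v a = mon q a * \sum_k (a k)%:R * (v 0 k / q 0 k).
Proof.
move=> ha; rewrite mulr_sumr; apply: eq_bigr => k _.
case: (posnP (a k)) => [->|ak]; first by rewrite !mul0r mulr0.
have qk : q 0 k != 0.
  by apply/eqP => qk; have := ha k qk; rewrite natcolE; lia.
rewrite /mon (bigD1 k) //= [in RHS](bigD1 k) //= eqxx.
have -> : \prod_(i | i != k) q 0 i ^+ (a i - (i == k)) =
          \prod_(i | i != k) q 0 i ^+ a i.
  by apply: eq_bigr => i /negbTE ->; rewrite subn0.
rewrite -[in RHS](subnK ak) exprD expr1.
move: (q 0 k ^+ _) (\prod_(i | _) _) => x y.
by rewrite subnK //; field.
Qed.

(** Here x_m is the only vanishing factor of x^a at q, and it occurs once, so only the derivative in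
    x_m survives. *)
Lemma dmon_order1 q v a m : q 0 m = 0 -> supported q (natcol a - dcol m) ->
  dmon q v a = v 0 m * zmon q (natcol a - dcol m).
Proof.
move=> qm ha.
have aE k : q 0 k = 0 -> a k = (k == m) :> nat.
  by move=> qk; have := ha k qk; rewrite !mxE eqxx andbT; case: eqP => /=; lia.
rewrite /dmon (bigD1 m) //= [X in _ + X]big1 ?addr0; last first.
  move=> k km; case: (posnP (a k)) => [->|ak]; first by rewrite !mul0r.
  rewrite [X in _ * X](bigD1 m) //= (eq_sym m) (negbTE km) subn0 qm (aE m) // eqxx.
  by rewrite expr0n mul0r mulr0.
rewrite (aE m) // eqxx mul1r; congr (_ * _); apply: eq_bigr => k _.
rewrite !mxE eqxx andbT; case: (eqVneq k m) => [->|km] /=.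
  by rewrite (aE m) // eqxx.
by rewrite subn0 subr0.
Qed.

Lemma dmon_order2 q v a m : q 0 m = 0 -> (0 < a m)%N ->
  ~ supported q (natcol a - dcol m) -> dmon q v a = 0.
Proof.
move=> qm am ha.
have [k qk [km|ak]] : exists2 k, q 0 k = 0 &
    (k = m /\ 1 < a m)%N \/ (k != m /\ 0 < a k)%N.
- apply: contrapT => hk; apply: ha => k qk; rewrite !mxE eqxx andbT.
  case: (eqVneq k m) => [km|km] /=.
    suff : ~ (1 < a m)%N by subst k; lia.
    by move=> am1; apply: hk; exists k => //; left.
  suff : ~ (0 < a k)%N by lia.
  by move=> ak; apply: hk; exists k => //; right.
- rewrite /dmon big1 // => i _.
  rewrite [X in _ * X](bigD1 m) //= qm expr0n.
  case: eqP; last by rewrite mul0r mulr0.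
  by case: km => _; case: (m == i); lia.
rewrite /dmon big1 // => i _.
case: (eqVneq m i) => [mi|mi].
  rewrite [X in _ * X](bigD1 k) //= qk expr0n -mi (negbTE (proj1 ak)).
  by case: eqP; rewrite ?mul0r ?mulr0 //; lia.
rewrite [X in _ * X](bigD1 m) //= qm expr0n (negbTE mi).
by case: eqP; rewrite ?mul0r ?mulr0 //; lia.
Qed.

(** The monomial x^a vanishes at q to order 0, 1, or at least 2. *)
Lemma order_cases q a :
  [\/ supported q (natcol a),
      exists2 m, q 0 m = 0 & supported q (natcol a - dcol m)
    | exists m, [/\ q 0 m = 0, (0 < a m)%N & ~ supported q (natcol a - dcol m)]].
Proof.
case: (pselect (supported q (natcol a))) => [h|h]; first by constructor 1.
have [m qm am] : exists2 m, q 0 m = 0 & (0 < a m)%N.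
  apply: contrapT => hm; apply: h => k qk; rewrite natcolE.
  suff : ~ (0 < a k)%N by lia.
  by move=> ak; apply: hm; exists k.
case: (pselect (supported q (natcol a - dcol m))) => [h'|h'].
  by constructor 2; exists m.
by constructor 3; exists m.
Qed.

End Points.
End Weights.

(** * The semigroup of weights at a point, and the tangent vectors that it gives *)

Section Generators.
Variables (N ell : nat) (H : 'M[int]_(N, ell)).
Variables (F : fieldType) (q : 'rV[F]_ell).
Hypothesis hq : binomial_locus H q.
Implicit Types (a b : 'I_ell -> nat) (c : 'cV[int]_ell).

Local Notation wt c := (H *m c).

(** Equality modulo the lattice of the weights of Laurent monomials that are units at q. *)
Definition congruent (u w : 'cV[int]_N) : Prop :=
  exists2 c, supported q c & u = w + wt c.

Lemma congruent_refl u : congruent u u.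
Proof. by exists 0; [exact: supported0 | rewrite mulmx0 addr0]. Qed.

Lemma congruent_sym u w : congruent u w -> congruent w u.
Proof.
move=> [c hc ->]; exists (- c); first exact: supportedN.
by rewrite mulmxN addrK.
Qed.

Lemma congruent_trans u w x : congruent u w -> congruent w x -> congruent u x.
Proof.
move=> [c hc ->] [d hd ->]; exists (d + c); first exact: supportedD.
by rewrite mulmxDr addrA.
Qed.

Lemma congruentD u w u' w' :
  congruent u w -> congruent u' w' -> congruent (u + u') (w + w').
Proof.
move=> [c hc ->] [d hd ->]; exists (c + d); first exact: supportedD.
by rewrite mulmxDr addrACA.
Qed.

(** The semigroup of monomials modulo units has no further units. If [c] is the supported difference
    of weights, then b + c - a has weight 0 and is nonnegative where q vanishes, so [locus_face]
    applies. *)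
Lemma congruent_natcol a b : congruent (wt (natcol a)) (wt (natcol b)) ->
  supported q (natcol a) -> supported q (natcol b).
Proof.
move=> [c hc e] ha.
suff : supported q (natcol b + c - natcol a).
  move=> h k qk; have := h k qk; have := hc k qk; have := ha k qk.
  by rewrite !mxE => -> ->; rewrite addr0 subr0.
apply: locus_face hq _ _; first by rewrite mulmxBr mulmxDr -e subrr.
move=> k qk; have := hc k qk; have := ha k qk.
by rewrite !mxE => -> ->; rewrite addr0 subr0.
Qed.

(** Up to units, x_m has the weight of a monomial that vanishes at q to order at least 2, so x_m
    lies in the square of the maximal ideal at q. *)
Definition reducible (m : 'I_ell) : Prop := exists b m',
  [/\ congruent (wt (dcol m)) (wt (natcol b)), q 0 m' = 0, (0 < b m')%N
    & ~ supported q (natcol b - dcol m')].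

Definition irreducible m : Prop := q 0 m = 0 /\ ~ reducible m.

(** Strict divisibility modulo units: x_m is x_k times a monomial vanishing at q. By
    [congruent_natcol] this is irreflexive, hence well founded on the finitely many coordinates. *)
Definition below (k m : 'I_ell) : Prop := exists b,
  congruent (wt (dcol m)) (wt (dcol k) + wt (natcol b)) /\
  ~ supported q (natcol b).

Lemma below_irrefl m : ~ below m m.
Proof.
move=> [b [[c hc e] hb]]; apply: hb.
have z : supported q (natcol (fun=> 0%N)) by move=> k _; rewrite natcolE.
apply: congruent_natcol z; apply: congruent_sym.
exists (- c); first exact: supportedN.
have -> : natcol (fun _ : 'I_ell => 0%N) = 0 by apply/colP => k; rewrite !mxE.
rewrite mulmx0 add0r mulmxN; apply/eqP; rewrite -addr_eq0.
by apply/eqP/(addrI (wt (dcol m))); rewrite addr0 addrA -e.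
Qed.

Lemma below_trans k m l : below k m -> below m l -> below k l.
Proof.
move=> [b [e hb]] [b' [e' hb']].
exists (fun i => b i + b' i)%N; split.
  rewrite natcolD mulmxDr addrA; apply: congruent_trans e' _.
  by apply: congruentD => //; apply: congruent_refl.
move=> h; apply: hb => i qi; have := h i qi.
by rewrite !mxE; lia.
Qed.

Lemma below_ind (P : 'I_ell -> Prop) :
  (forall m, (forall k, below k m -> P k) -> P m) -> forall m, P m.
Proof.
move=> ih m.
have [s] := ubnP #|[pred k | `[< below k m >]]|; elim: s m => // s IH m hs.
apply: ih => k km; apply: IH; rewrite ltnS in hs; apply: (leq_trans _ hs).
apply: proper_card; apply/properP; split.
  apply/fintype.subsetP => l; rewrite !inE => lk.
  exact: below_trans lk km.
exists k; rewrite !inE //.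
by apply/asboolPn; apply: below_irrefl.
Qed.

Lemma reducible_below m b m' k : congruent (wt (dcol m)) (wt (natcol b)) ->
  q 0 m' = 0 -> (0 < b m')%N -> ~ supported q (natcol b - dcol m') ->
  (0 < b k)%N -> q 0 k = 0 -> below k m.
Proof.
move=> e qm' bm' hb bk qk.
have bE : natcol b = dcol k + natcol (fun i => b i - (i == k))%N.
  apply/colP => i; rewrite !mxE eqxx andbT.
  by case: eqP => [->|_] /=; lia.
exists (fun i => b i - (i == k))%N; split; first by rewrite -mulmxDr -bE.
have -> : natcol (fun i => b i - (i == k))%N = natcol b - dcol k.
  by rewrite bE addrC addKr.
case: (eqVneq k m') => [->//|km'] h.
by have := h m' qm'; rewrite !mxE eqxx andbT eq_sym (negbTE km') /=; lia.
Qed.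

(* One irreducible generator in each class modulo the weights supported at q *)
Definition primitive_gen (j : 'I_ell) : Prop :=
  irreducible j /\ forall k, irreducible k ->
    congruent (wt (dcol j)) (wt (dcol k)) -> (j <= k)%N.

Lemma primitive_gen_inj j k : primitive_gen j -> primitive_gen k ->
  congruent (wt (dcol j)) (wt (dcol k)) -> j = k.
Proof.
move=> [ij hj] [ik hk] e; apply/val_inj/eqP.
by rewrite eqn_leq hj //= hk //; apply: congruent_sym.
Qed.

Lemma irreducible_gen m : irreducible m ->
  exists2 j, primitive_gen j & congruent (wt (dcol m)) (wt (dcol j)).
Proof.
move=> im; pose P k := `[< irreducible k /\ congruent (wt (dcol m)) (wt (dcol k)) >].
have Pm : P m by apply/asboolP; split => //; apply: congruent_refl.
case: (@arg_minnP _ m P (fun k : 'I_ell => k : nat) Pm) => j /asboolP[ij mj] hj.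
exists j => //; split => // k ik jk; apply: hj; apply/asboolP; split => //.
exact: congruent_trans mj jk.
Qed.

Definition generated (u : 'cV[int]_N) : Prop := exists2 b,
  congruent u (wt (natcol b)) & forall k, b k <> 0%N -> primitive_gen k.

Lemma generatedD u w : generated u -> generated w -> generated (u + w).
Proof.
move=> [b e hb] [b' e' hb']; exists (fun k => b k + b' k)%N.
  by rewrite natcolD mulmxDr; apply: congruentD.
move=> k bk; case: (posnP (b k)) => h; last by apply: hb; lia.
by apply: hb'; lia.
Qed.

Lemma generated_congruent u w : congruent u w -> generated w -> generated u.
Proof. by move=> e [b e' hb]; exists b => //; apply: congruent_trans e'. Qed.

Lemma generated0 : generated 0.
Proof.
exists (fun=> 0%N) => //.
have -> : natcol (fun _ : 'I_ell => 0%N) = 0 by apply/colP => k; rewrite !mxE.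
by rewrite mulmx0; apply: congruent_refl.
Qed.

Lemma generatedMn u s : generated u -> generated (u *+ s).
Proof.
move=> hu; elim: s => [|s IH]; first by rewrite mulr0n; apply: generated0.
by rewrite mulrS; apply: generatedD.
Qed.

Lemma natcol_sum b : natcol b = \sum_k dcol k *+ b k.
Proof.
apply/colP => i; rewrite natcolE summxE (bigD1 i) //= big1 ?addr0.
  by rewrite mulmxnE dcolE eqxx; lia.
by move=> k ki; rewrite mulmxnE dcolE eq_sym (negbTE ki) mul0rn.
Qed.

(** A reducible coordinate is, up to units, a product whose vanishing factors are strictly [below]
    it, and the induction treats each of them. *)
Lemma generated_dcol m : generated (wt (dcol m)).
Proof.
elim/below_ind: m => m IH.
case: (eqVneq (q 0 m) 0) => [qm|qm]; last first.
  apply: generated_congruent generated0.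
  by exists (dcol m); [exact: supported_dcol | rewrite add0r].
case: (pselect (reducible m)) => [[b [m' [e qm' bm' hb]]]|nr]; last first.
  have [j pj e] := irreducible_gen (conj qm nr).
  exists (fun i => (i == j) : nat); first by rewrite natcol_delta.
  by move=> k; case: eqP => // ->.
apply: (generated_congruent e); rewrite natcol_sum mulmx_sumr.
apply: (big_ind generated) => [||k _]; [exact: generated0|exact: generatedD|].
rewrite raddfMn /=.
case: (posnP (b k)) => [->|bk]; first by rewrite mulr0n; apply: generated0.
apply: generatedMn; case: (eqVneq (q 0 k) 0) => [qk|qk]; last first.
  apply: generated_congruent generated0.
  by exists (dcol k); [exact: supported_dcol | rewrite add0r].
exact: IH (reducible_below e qm' bm' hb bk qk).
Qed.

(* The tangent vectors of the cone transversal to the orbit of q. *)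
Definition transversal_coef (j : 'I_ell) (u : 'cV[int]_N) : F :=
  match pselect (congruent u (wt (dcol j))) with
  | left e => zmon q (s2val (cid2 e))
  | right _ => 0
  end.

(** The choice of [c] does not matter: two choices differ by a supported vector in the kernel of
    [H], whose monomial is 1 at q. *)
Lemma transversal_coefE j u c : supported q c -> u = wt (dcol j) + wt c ->
  transversal_coef j u = zmon q c.
Proof.
move=> hc e; rewrite /transversal_coef; case: pselect => [h|[]]; last by exists c.
case: (cid2 h) => c' hc' e' /=.
have e0 : wt (c' - c) = 0.
  by rewrite mulmxBr; apply/eqP; rewrite subr_eq0; apply/eqP/(addrI (wt (dcol j))); rewrite -e' -e.
have := zmon_ker hq e0 (supportedB hc' hc).
by rewrite zmonB // => h1; rewrite -[LHS](divfK (zmon_neq0 hc)) h1 mul1r.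
Qed.

Lemma transversal_coef0 j u : ~ congruent u (wt (dcol j)) ->
  transversal_coef j u = 0.
Proof. by rewrite /transversal_coef; case: pselect. Qed.

Definition transversal j : 'rV[F]_ell :=
  \row_m transversal_coef j (wt (dcol m)).

(** The derivative of x^a depends only on its weight, which makes the vector tangent. When x^a
    vanishes to order at least 2 the derivative is 0, and the weight of [a] cannot be congruent to
    that of [j] because [j] is irreducible. *)
Lemma dmon_transversal j a : irreducible j ->
  dmon q (transversal j) a = transversal_coef j (wt (natcol a)).
Proof.
move=> [qj nrj]; case: (order_cases q a) => [ha|[m qm ha]|[m [qm am ha]]].
- rewrite dmon_supported // big1 ?mulr0 => [|k _]; last first.
    case: (eqVneq (q 0 k) 0) => [qk|qk].
      by have := ha k qk; rewrite natcolE => -[->]; rewrite !mul0r.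
    rewrite mxE transversal_coef0 ?mul0r ?mulr0 // -!natcol_delta.
    move=> /congruent_natcol h.
    have hk : supported q (natcol (fun i => (i == k) : nat)).
      by rewrite natcol_delta; apply: supported_dcol.
    by have := h hk j qj; rewrite natcolE eqxx.
  rewrite transversal_coef0 // -natcol_delta => /congruent_natcol /(_ ha j qj).
  by rewrite natcolE eqxx.
- rewrite (dmon_order1 _ qm ha) mxE.
  have aE : wt (natcol a) = wt (dcol m) + wt (natcol a - dcol m).
    by rewrite -mulmxDr addrC subrK.
  case: (pselect (congruent (wt (dcol m)) (wt (dcol j)))) => [[c hc e]|h].
    have e2 : wt (natcol a) = wt (dcol j) + wt (c + (natcol a - dcol m)).
      by rewrite aE e -addrA; congr (_ + _); rewrite [RHS]mulmxDr.
    by rewrite (transversal_coefE hc e) (transversal_coefE (supportedD hc ha) e2) (zmonD hc ha).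
  rewrite !transversal_coef0 ?mul0r // => h'; apply: h.
  apply: congruent_trans h'; rewrite aE; apply: congruent_sym.
  by exists (natcol a - dcol m).
- rewrite (dmon_order2 _ qm am ha) transversal_coef0 // => e; apply: nrj.
  by exists a, m; split => //; apply: congruent_sym.
Qed.

Lemma transversal_tangent j : irreducible j ->
  tangent_cone H q (transversal j).
Proof. by move=> ij a b sw; rewrite !dmon_transversal // sw. Qed.

Lemma transversal_supported j k : irreducible j -> q 0 k != 0 ->
  transversal j 0 k = 0.
Proof.
move=> [qj _] qk; rewrite mxE transversal_coef0 // -!natcol_delta.
move=> /congruent_natcol h.
have hk : supported q (natcol (fun i => (i == k) : nat)).
  by rewrite natcol_delta; apply: supported_dcol.
by have := h hk j qj; rewrite natcolE eqxx.
Qed.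

Lemma transversal_primitive j k : primitive_gen j -> primitive_gen k ->
  transversal j 0 k = (k == j)%:R.
Proof.
move=> pj pk; rewrite mxE; case: eqVneq => [->|kj].
  rewrite (@transversal_coefE _ _ 0) ?zmon0 //; first exact: supported0.
  by rewrite mulmx0 addr0.
by rewrite transversal_coef0 // => /(primitive_gen_inj pk pj)/eqP; rewrite (negbTE kj).
Qed.

Definition orbital (x : 'rV[F]_N) : 'rV[F]_ell :=
  \row_k (q 0 k * (x *m map_mx intr H) 0 k).

(** The torus acts on x^a through its weight, so the derivative along the one-parameter subgroup [x]
    is the pairing of [x] with [H a], times q^a. *)
Lemma orbital_tangent x : tangent_cone H q
  (\row_k (if q 0 k == 0 then 0 else orbital x 0 k)).
Proof.
set w := \row_k _.
have aux a : dmon q w a = if `[< supported q (natcol a) >]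
    then mon q a * (x *m map_mx intr (H *m natcol a)) 0 0 else 0.
  case: (order_cases q a) => [ha|[m qm ha]|[m [qm am ha]]].
  - rewrite asboolT // dmon_supported // map_mxM mulmxA [in RHS]mxE.
    congr (_ * _); apply: eq_bigr => k _.
    case: (eqVneq (q 0 k) 0) => [qk|qk].
      have := ha k qk; rewrite natcolE => -[ak].
      by rewrite [map_mx _ _ k 0]mxE natcolE ak mul0r mulr0.
    rewrite [map_mx _ _ k 0]mxE natcolE [w 0 k]mxE (negbTE qk) [orbital x 0 k]mxE.
    by rewrite (mulrC (q 0 k)) mulfK // mulrC.
  - rewrite (dmon_order1 _ qm ha) mxE qm eqxx mul0r asboolF // => h.
    by have := h m qm; have := ha m qm; rewrite !mxE !eqxx /=; lia.
  - rewrite (dmon_order2 _ qm am ha) asboolF // => h.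
    by have := h m qm; rewrite natcolE; lia.
move=> a b sw; rewrite !aux sw (proj2 hq _ _ sw).
suff -> : `[< supported q (natcol a) >] = `[< supported q (natcol b) >] by [].
apply: asbool_equiv_eq; split; apply: congruent_natcol.
  by rewrite sw; apply: congruent_refl.
by rewrite sw; apply: congruent_refl.
Qed.

End Generators.

Lemma mulmx_col (R : nzRingType) (m n p : nat) (A : 'M[R]_(m, n))
    (B : 'M[R]_(n, p)) i k : (A *m col k B) i 0 = (A *m B) i k.
Proof. by rewrite !mxE; apply: eq_bigr => j _; rewrite mxE. Qed.

(** * Coordinate charts at a smooth point *)

Section LocalStructure.
Variables (N ell : nat) (H : 'M[int]_(N, ell)).
Variables (F : numFieldType) (q : 'rV[F]_ell).
Hypothesis hq : binomial_locus H q.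

Let HF : 'M[F]_(N, ell) := map_mx intr H.
(** The weights of the nonzero coordinates, as rows. The other rows are zero, so the basis [f] of
    the row space consists of nonzero coordinates only. *)
Let HS : 'M[F]_(ell, N) := \matrix_(k, i) (if q 0 k == 0 then 0 else HF i k).
Let f := maxrankfun HS.

Lemma colHF k : col k HF = map_mx intr (H *m dcol k).
Proof. by rewrite -colE map_col. Qed.

Lemma f_supp i : q 0 (f i) != 0.
Proof.
apply/negP => q0; have := maxrowsub_free HS.
rewrite -/f -kermx_eq0 => /eqP k0.
have : (delta_mx 0 i : 'rV_(\rank HS)) *m rowsub f HS = 0.
  rewrite -rowE; apply/rowP => j; rewrite !mxE; case: eqP => //.
  by move/eqP: q0.
move/sub_kermxP; rewrite k0 submx0 => /eqP/rowP/(_ i)/eqP.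
by rewrite !mxE !eqxx oner_eq0.
Qed.

(** The chart: coordinates along the orbit, whose weights form a basis of the span of the supported
    weights, and one vanishing coordinate for each irreducible class. *)
Let J (k : 'I_ell) : Prop := (exists i, f i = k) \/ primitive_gen H q k.

Lemma J_supp k : J k -> q 0 k != 0 -> exists i, f i = k.
Proof. by case=> // -[[-> _] _] /eqP. Qed.

Lemma J_out k : J k -> q 0 k = 0 -> primitive_gen H q k.
Proof. by case=> // -[i <-] fi; have := f_supp i; rewrite fi eqxx. Qed.

Lemma HS_sub (m : nat) (g : 'I_m -> 'I_ell) :
  (forall k, J k -> exists i, g i = k) -> (HS <= rowsub g HF^T)%MS.
Proof.
move=> hg; rewrite -(eq_maxrowsub HS); apply/row_subP => i.
have [i' gi'] : exists i', g i' = f i by apply: hg; left; exists i.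
suff -> : row i (rowsub (maxrankfun HS) HS) = row i' (rowsub g HF^T).
  exact: row_sub.
by apply/rowP => j; rewrite !mxE gi' (negbTE (f_supp i)).
Qed.

Lemma span_supported c : supported q c ->
  ((HF *m map_mx intr c)^T <= HS)%MS.
Proof.
move=> hc; suff -> : (HF *m map_mx intr c)^T = (map_mx intr c)^T *m HS.
  exact: submxMl.
rewrite trmx_mul; apply/rowP => i; rewrite !mxE; apply: eq_bigr => k _.
by rewrite !mxE; case: eqP => // qk; rewrite hc // !mul0r.
Qed.

Lemma span_J (m : nat) (g : 'I_m -> 'I_ell) :
  (forall k, J k -> exists i, g i = k) -> (HF^T <= rowsub g HF^T)%MS.
Proof.
move=> hg; apply/row_subP => k; rewrite -tr_col colHF.
have [b [c hc ->] hb] := generated_dcol hq k.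
rewrite map_mxD map_mxM linearD /= addmx_sub //; last first.
  by rewrite map_mxM (submx_trans (span_supported hc)) // HS_sub.
rewrite natcol_sum raddf_sum mulmx_sumr raddf_sum.
apply: summx_sub => j _ /=.
rewrite raddfMn /= linearMn /= raddfMn /=.
case: (posnP (b j)) => [->|bj]; first by rewrite mulr0n sub0mx.
rewrite -scaler_nat scalemx_sub //.
have [i gi] : exists i, g i = j by apply: hg; right; apply: hb; lia.
suff -> : (HF *m map_mx intr (dcol j))^T = row i (rowsub g HF^T).
  exact: row_sub.
by rewrite -map_mxM -colHF; apply/rowP => l; rewrite !mxE gi.
Qed.

(** A vanishing coordinate is detected by its transversal vector, a nonzero one by the orbit
    direction dual to it with respect to the basis [f]. *)
Lemma dual_tangent k : J k -> exists w,
  [/\ tangent_cone H q w, w 0 k != 0 & forall l, J l -> l != k -> w 0 l = 0].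
Proof.
move=> Jk; case: (eqVneq (q 0 k) 0) => qk.
  have pk := J_out Jk qk.
  exists (transversal H q k); split.
  - exact: transversal_tangent pk.1.
  - by rewrite transversal_primitive // eqxx oner_eq0.
  - move=> l Jl lk; case: (eqVneq (q 0 l) 0) => ql.
      by rewrite transversal_primitive ?(negbTE lk) //; apply: J_out.
    exact: transversal_supported pk.1 _.
have [i fi] := J_supp Jk qk.
pose x := (col i (pinvmx (rowsub f HS)))^T.
have xE i' : (x *m HF) 0 (f i') = (i' == i)%:R.
  have /matrixP/(_ i' i) := mulmxVp (maxrowsub_free HS).
  rewrite [X in _ = X]mxE => <-; rewrite !mxE; apply: eq_bigr => l _.
  by rewrite !mxE (negbTE (f_supp i')) mulrC.
exists (\row_l (if q 0 l == 0 then 0 else orbital H q x 0 l)); split.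
- exact: orbital_tangent.
- have xk : (x *m HF) 0 k = 1 by rewrite -fi xE eqxx.
  by rewrite mxE (negbTE qk) mxE -/HF xk mulr1.
- move=> l Jl lk; rewrite mxE; case: eqVneq => // ql.
  have [i' fi'] := J_supp Jl ql.
  rewrite mxE -fi' xE; case: eqVneq => [ii|]; last by rewrite mulr0.
  by rewrite -fi' -fi ii eqxx in lk.
Qed.

Lemma tangent_family (m : nat) (g : 'I_m -> 'I_ell) : injective g ->
  (forall i, J (g i)) -> exists2 W : 'M[F]_(m, ell),
    forall i, tangent_cone H q (row i W) & colsub g W \in unitmx.
Proof.
move=> ginj Jg; have [w hw] := choice (fun i => dual_tangent (Jg i)).
exists (\matrix_i w i); first by move=> i; rewrite rowK; case: (hw i).
have -> : colsub g (\matrix_i w i) = diag_mx (\row_i w i 0 (g i)).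
  apply/matrixP => i j; rewrite !mxE; case: eqVneq => [->|ij].
    by rewrite mulr1n.
  by rewrite mulr0n; case: (hw i) => _ _ -> //; rewrite inj_eq // eq_sym.
rewrite unitmxE det_diag unitfE; apply/prodf_neq0 => i _.
by rewrite mxE; case: (hw i).
Qed.

Variable M : 'M[F]_(N, ell).
Hypothesis Hfull : \rank HF = N.
Hypothesis Mfree : row_free M.
Hypothesis HM : forall v, tangent_cone H q v <-> (v <= M)%MS.

Lemma colsub_unit_free (m : nat) (g : 'I_m -> 'I_ell) (W : 'M[F]_(m, ell)) :
  colsub g W \in unitmx -> row_free W.
Proof.
move=> hu; rewrite /row_free eqn_leq rank_leq_row /= -{1}(mxrank_unit hu).
have -> : colsub g W = W *m \matrix_(l, i) (l == g i)%:R.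
  apply/matrixP => i j; rewrite !mxE (bigD1 (g j)) //= big1 ?addr0.
    by rewrite mxE eqxx mulr1.
  by move=> l lj; rewrite mxE (negbTE lj) mulr0.
exact: mxrankM_maxl.
Qed.

(** The dual tangent vectors are independent in a tangent cone of dimension N, so J has at most N
    elements; the weights of J span a space of dimension N, so it has at least N. Smoothness enters
    here. *)
Lemma J_card : exists2 g : 'I_N -> 'I_ell,
  injective g & forall k, J k <-> exists i, g i = k.
Proof.
pose JJ := [set k | `[< J k >]]%SET.
have JE k : (k \in JJ) = `[< J k >] by rewrite /JJ inE.
pose g := @enum_val _ (mem JJ).
have gJ i : J (g i) by apply/asboolP; rewrite -JE; apply: enum_valP.
have Jg k : J k -> exists i, g i = k.
  move=> Jk; have kJ : k \in JJ by rewrite JE; apply/asboolP.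
  by exists (enum_rank_in kJ k); rewrite /g enum_rankK_in.
have e : #|JJ| = N.
  apply/eqP; rewrite eqn_leq; apply/andP; split.
    have [W hW Wu] := tangent_family enum_val_inj gJ.
    have WM : (W <= M)%MS by apply/row_subP => i; apply/HM.
    have := mxrankS WM; rewrite (eqP Mfree).
    by rewrite (eqP (colsub_unit_free Wu)).
  have := mxrankS (span_J Jg); rewrite mxrank_tr Hfull => h.
  exact: leq_trans h (rank_leq_row _).
exists (fun i => g (cast_ord (esym e) i)).
  by move=> i j /enum_val_inj/cast_ord_inj.
move=> k; split=> [/Jg[i <-]|[i <-]] //.
by exists (cast_ord e i); rewrite cast_ordK.
Qed.

(** The functionals [phi j] are dual to the weights of the chart. The third clause says that, modulo
    supported weights, every weight is an integral combination of those of the vanishing chart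
    coordinates; the fourth, that the weights of all coordinates have nonnegative coefficients
    there. *)
Theorem local_structure : exists g : 'I_N -> 'I_ell,
  let phi j u : F := (invmx (colsub g HF) *m map_mx intr u) j 0 in
  [/\ injective g /\ colsub g HF \in unitmx,
      forall v, tangent_cone H q v -> (forall i, v 0 (g i) = 0) -> v = 0,
      forall c, exists2 d, H *m d = H *m c & forall k, q 0 k = 0 ->
        (forall j, g j = k -> phi j (H *m c) = (d k 0)%:~R) /\
        ((forall j, g j != k) -> d k 0 = 0)
    & forall j, q 0 (g j) = 0 -> forall k,
        (q 0 k != 0 -> phi j (H *m dcol k) = 0) /\ 0 <= phi j (H *m dcol k)].
Proof.
have [g ginj gJ] := J_card; exists g => phi.
have Jg i : J (g i) by apply/gJ; exists i.
have gu : colsub g HF \in unitmx.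
  have := mxrankS (span_J (fun k => proj1 (gJ k))); rewrite mxrank_tr Hfull.
  rewrite -unitmx_tr -row_full_unit /row_full eqn_leq rank_leq_col /=.
  by have -> : (colsub g HF)^T = rowsub g HF^T by apply/matrixP => i j; rewrite !mxE.
have phi_delta j i : phi j (H *m dcol (g i)) = (j == i)%:R.
  rewrite /phi -colHF; have -> : col (g i) HF = col i (colsub g HF).
    by apply/colP => l; rewrite !mxE.
  by rewrite mulmx_col mulVmx // !mxE.
have phiE j c : phi j (H *m c) = \sum_k phi j (H *m dcol k) * (c k 0)%:~R.
  rewrite /phi map_mxM mulmxA mxE; apply: eq_bigr => k _; congr (_ * _).
    by rewrite -colHF mulmx_col.
  by rewrite mxE.
(* The weight of a nonzero coordinate is a combination of those of the nonzero coordinates in the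
   chart, on which [phi j] vanishes by duality. *)
have phi_supp j k : q 0 (g j) = 0 -> q 0 k != 0 -> phi j (H *m dcol k) = 0.
  move=> qj qk; rewrite /phi -colHF.
  have /submxP[D hD] : (row k HS <= rowsub f HS)%MS.
    by rewrite (submx_trans (row_sub k _)) // eq_maxrowsub.
  have -> : col k HF = (row k HS)^T.
    by apply/colP => l; rewrite !mxE (negbTE qk).
  rewrite hD trmx_mul mulmxA mxE big1 // => i _.
  suff -> : (invmx (colsub g HF) *m (rowsub f HS)^T) j i = 0 by rewrite mul0r.
  have [i' gi'] : exists i', g i' = f i by apply/gJ; left; exists i.
  have : phi j (H *m dcol (g i')) = 0.
    rewrite phi_delta; case: eqVneq => // ji.
    by have := f_supp i; rewrite -gi' -ji qj eqxx.
  rewrite /phi -colHF gi' => <-; rewrite !mxE; apply: eq_bigr => l _.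
  by rewrite !mxE (negbTE (f_supp i)).
have phi_d j (d : 'cV[int]_ell) : (forall k, q 0 k = 0 -> (forall i, g i != k) -> d k 0 = 0) ->
    q 0 (g j) = 0 -> phi j (H *m d) = (d (g j) 0)%:~R.
  move=> hd qj; rewrite phiE (bigD1 (g j)) //= big1 ?addr0 => [|k kj].
    by rewrite phi_delta eqxx mul1r.
  case: (eqVneq (q 0 k) 0) => qk; last by rewrite phi_supp ?mul0r.
  case: (pselect (exists i, g i = k)) => [[i ik]|nk].
    rewrite -ik phi_delta; case: eqVneq => [ji|]; last by rewrite mul0r.
    by rewrite -ik ji eqxx in kj.
  rewrite hd ?mulr0 // => i; apply/eqP => ik; apply: nk; by exists i.
have gen m : exists b : ('I_ell -> nat) * 'cV[int]_ell,
    [/\ H *m dcol m = H *m (natcol b.1 + b.2), supported q b.2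
      & forall k, b.1 k <> 0%N -> primitive_gen H q k].
  have [b [c hc e] hb] := generated_dcol hq m.
  by exists (b, c); split => //; rewrite mulmxDr.
have [B hB] := choice gen.
split=> //.
- move=> v Tv v0; have [W hW Wu] := tangent_family ginj Jg.
  have WM : (W <= M)%MS by apply/row_subP => i; apply/HM.
  have MW : (M <= W)%MS.
    have := mxrank_leqif_sup WM; rewrite (eqP Mfree) (eqP (colsub_unit_free Wu)).
    by move=> /leqifP; case: ifP => // _; rewrite ltnn.
  have /submxP[x vE] := submx_trans (proj1 (HM v) Tv) MW.
  suff x0 : x = 0.
    by rewrite vE x0 mul0mx.
  have : x *m colsub g W = 0.
    rewrite -[W](mul1mx) -mulmx_colsub mul1mx mulmx_colsub -vE.
    by apply/rowP => i; rewrite !mxE v0.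
  by move/(congr1 (mulmxr (invmx (colsub g W)))); rewrite /= mulmxK // mul0mx.
(* Each coordinate is replaced by a product of primitive generators and a supported Laurent monomial
   of the same total weight. *)
- move=> c; pose d := \sum_m c m 0 *: (natcol (B m).1 + (B m).2).
  have Hd : H *m d = H *m c.
    have cE : c = \sum_m c m 0 *: dcol m.
      apply/colP => k; rewrite summxE (bigD1 k) //= big1 ?addr0.
        by rewrite mxE dcolE eqxx mulr1.
      by move=> l lk; rewrite mxE dcolE eq_sym (negbTE lk) mulr0.
    rewrite [in RHS]cE /d !mulmx_sumr; apply: eq_bigr => m _.
    by rewrite -!scalemxAr; case: (hB m) => ->.
  have d0 k : q 0 k = 0 -> (forall j, g j != k) -> d k 0 = 0.
    move=> qk nk; rewrite summxE big1 // => m _.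
    case: (hB m) => _ hs hb; rewrite !mxE (hs _ qk) addr0.
    case: (posnP ((B m).1 k)) => [->|bk]; first by rewrite mulr0.
    have [i gi] : exists i, g i = k by apply/gJ; right; apply: hb; lia.
    by have := nk i; rewrite gi eqxx.
  exists d => // k qk; split; last exact: d0.
  by move=> j jk; rewrite -Hd phi_d ?jk.
- move=> j qj k; split; first exact: phi_supp.
  case: (hB k) => -> hs hb; rewrite phi_d //.
    rewrite mxE (hs _ qj) addr0 natcolE; exact: ler0n.
  move=> l ql nl; rewrite mxE (hs _ ql) addr0 natcolE.
  case: (posnP ((B k).1 l)) => [->//|bl].
  have [i gi] : exists i, g i = l by apply/gJ; right; apply: hb; lia.
  by have := nl i; rewrite gi eqxx.
Qed.

End LocalStructure.

(** * The equations of the toric variety *)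

Lemma poly_nat_nonroot (p : {poly int}) : p != 0 ->
  exists B : nat, ~~ root p B%:Z.
Proof.
move=> p0; apply: contrapT => hB.
pose rs := [seq Posz i | i <- iota 0 (size p)].
have : (size rs < size p)%N.
  apply: max_poly_roots p0 _ _.
    apply/allP => x /mapP[i _ ->]; apply: contrapT => hi; apply: hB.
    by exists i; apply/negP.
  by rewrite map_inj_uniq ?iota_uniq // => i j [].
by rewrite size_map size_iota ltnn.
Qed.

(** Read [u] as the polynomial with coefficients u_i. The product of the nonzero ones has finitely
    many roots, and [B] is chosen off them. *)
Lemma nat_powers_separate (n : nat) (s : seq 'cV[int]_n) :
  exists B : nat, forall u, u \in s ->
    \sum_i u i 0 * (B ^ i)%N%:Z = 0 -> u = 0.
Proof.
pose P (u : 'cV[int]_n) : {poly int} := \sum_i (u i 0)%:P * 'X^i.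
have P0 u : P u = 0 -> u = 0.
  move=> pu; apply/colP => i; rewrite mxE; have := congr1 (fun p : {poly int} => p`_i) pu.
  rewrite coef0 coef_sum (bigD1 i) //= coefCM coefXn eqxx mulr1 big1 ?addr0 //.
  by move=> j ji; rewrite coefCM coefXn eq_sym (inj_eq val_inj) (negbTE ji) mulr0.
have [|B hB] := @poly_nat_nonroot (\prod_(u <- s | u != 0) P u).
  rewrite prodf_seq_neq0; apply/allP => u _; apply/implyP => u0.
  by apply: contra u0 => /eqP/P0/eqP.
exists B => u us hu; apply/eqP; apply: contraNT hB => u0.
rewrite rootE horner_prod prodf_seq_eq0; apply/hasP; exists u => //=.
rewrite u0 /=; apply/eqP; rewrite horner_sum -[RHS]hu; apply: eq_bigr => i _.
by rewrite hornerCM hornerXn -!natrXE rmorphXn.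
Qed.

Lemma exprz2_inj (C : numFieldType) : injective (exprz (2 : C)).
Proof.
have two0 : (2 : C) != 0 by rewrite pnatr_eq0.
have pow1 k : (2 : C) ^+ k = 1 -> k = 0%N.
  case: k => // k; rewrite -natrX => /eqP; rewrite (eqr_nat C _ 1) expnS.
  by move: (2 ^ k)%N => x; lia.
move=> x y e; apply/eqP; rewrite -subr_eq0; apply/eqP.
have : (2 : C) ^ (x - y) = 1 by rewrite expfzDr // -invr_expz e divff // expfz_neq0.
case: (x - y) => k; first by rewrite -exprnP => /pow1 ->.
by rewrite NegzE -invr_expz => /(congr1 GRing.inv); rewrite invrK invr1 -exprnP => /pow1.
Qed.

(** For t_i = 2^(B^i) a character takes the value 2^e, where e is the polynomial of the character
    evaluated at [B]. *)
Lemma characters_separate (C : numFieldType) (n : nat) (s : seq 'cV[int]_n) :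
  exists2 t : 'rV[C]_n, forall i, t 0 i != 0 &
    forall u w, u \in s -> w \in s ->
      \prod_i t 0 i ^ u i 0 = \prod_i t 0 i ^ w i 0 -> u = w.
Proof.
have [B hB] := nat_powers_separate [seq u - w | u <- s, w <- s].
have two0 : (2 : C) != 0 by rewrite pnatr_eq0.
have prodE (u : 'cV[int]_n) : \prod_(i < n) (2 ^+ (B ^ i)%N) ^ u i 0 =
    (2 : C) ^ (\sum_(i < n) u i 0 * (B ^ i)%N%:Z).
  rewrite (big_morph (fun z : int => (2 : C) ^ z) (fun x y => expfzDr x y two0) (expr0z _)).
  by apply: eq_bigr => i _; rewrite mulrC -exprz_exp -exprnP.
exists (\row_(i < n) 2 ^+ (B ^ i)%N) => [i|u w us ws].
  by rewrite mxE expf_neq0.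
under eq_bigr do rewrite mxE; under [in RHS]eq_bigr do rewrite mxE.
rewrite !prodE => /exprz2_inj e; apply/eqP; rewrite -subr_eq0; apply/eqP/hB.
  by apply: allpairs_f.
under eq_bigr do rewrite !mxE mulrBl.
by rewrite sumrB e subrr.
Qed.

Lemma interpolation (C : fieldType) (xs : seq C) (h : C -> C) :
  uniq xs -> exists P : {poly C}, forall x, x \in xs -> P.[x] = h x.
Proof.
elim: xs => [|x xs IH] /=; first by exists 0.
move=> /andP[xxs /IH[P hP]].
pose Q := \prod_(y <- xs) ('X - y%:P).
have Qx : Q.[x] != 0 by rewrite -rootE root_prod_XsubC.
exists (P + ((h x - P.[x]) / Q.[x]) *: Q) => y; rewrite inE => /orP[/eqP->|yxs].
  by rewrite hornerD hornerZ divfK // addrC subrK.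
have Qy : Q.[y] = 0 by apply/eqP; rewrite -rootE root_prod_XsubC.
by rewrite hornerD hornerZ hP // Qy mulr0 addr0.
Qed.

Section HatMatrix.
Variables (n ell : nat) (pts : 'I_ell -> 'cV[int]_n).

Definition hat_mx : 'M[int]_(1 + n, ell) :=
  col_mx (const_mx 1) (\matrix_(i, k) pts k i 0).

Lemma hat_mx_mul (c : 'cV[int]_ell) : hat_mx *m c =
  col_mx (const_mx (\sum_k c k 0)) (\sum_k c k 0 *: pts k).
Proof.
rewrite mul_col_mx; congr col_mx.
  by apply/colP => i; rewrite !mxE; apply: eq_bigr => k _; rewrite !mxE mul1r.
apply/colP => i; rewrite !mxE summxE; apply: eq_bigr => k _.
by rewrite !mxE mulrC.
Qed.

Lemma same_weight_hat (a b : 'I_ell -> nat) : same_weight hat_mx a b <->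
  (\sum_k a k = \sum_k b k)%N /\
  \sum_k (a k)%:Z *: pts k = \sum_k (b k)%:Z *: pts k.
Proof.
have s1 c : \sum_k natcol c k 0 = Posz (\sum_k c k).
  rewrite (big_morph Posz PoszD (erefl (0 : int))).
  by apply: eq_bigr => k _; rewrite natcolE.
have s2 c : \sum_k natcol c k 0 *: pts k = \sum_k (c k)%:Z *: pts k.
  by apply: eq_bigr => k _; rewrite natcolE.
rewrite /same_weight !hat_mx_mul !s1 !s2.
split=> [/eq_col_mx[/matrixP/(_ 0 0)]|[-> -> //]].
by rewrite !mxE => -[e1] e2.
Qed.

End HatMatrix.

Section ToricVariety.
Variables (C : numFieldType) (n ell : nat) (pts : 'I_ell -> 'cV[int]_n).
Local Notation H := (hat_mx pts).
Local Notation pol := (mpoly.mpoly ell C).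

Definition torus_point (t : 'rV[C]_n) : 'rV[C]_ell :=
  \row_k \prod_i t 0 i ^ pts k i 0.
Definition torus_image : set 'rV[C]_ell :=
  [set torus_point t | t in [set t : 'rV[C]_n | forall i, t 0 i != 0]]%classic.

Lemma peval_monomial (f : pol) x : peval f x =
  \sum_(m <- mpoly.msupp f) mpoly.mcoeff m f * mon x m.
Proof. exact: mpoly.mevalE. Qed.

Lemma mon_torus_point (t : 'rV[C]_n) (m : 'I_ell -> nat) : (forall i, t 0 i != 0) ->
  mon (torus_point t) m = \prod_i t 0 i ^ (\sum_k (m k)%:Z *: pts k) i 0.
Proof.
move=> t0; rewrite /mon.
transitivity (\prod_k \prod_i t 0 i ^ ((m k)%:Z * pts k i 0)).
  apply: eq_bigr => k _; rewrite mxE -prodrXl; apply: eq_bigr => i _.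
  by rewrite mulrC -exprz_exp -exprnP.
rewrite exchange_big; apply: eq_bigr => i _ /=.
rewrite summxE (big_morph (fun z : int => t 0 i ^ z) (fun x y => expfzDr x y (t0 i)) (expr0z _)).
by apply: eq_bigr => k _; rewrite mxE.
Qed.

(* By the linear independence of distinct characters of the torus. *)
Lemma equation_weight (f : pol) (g : ('I_ell -> nat) -> C) :
  equations torus_image f ->
  (forall a b, same_weight H a b -> g a = g b) ->
  \sum_(m <- mpoly.msupp f) mpoly.mcoeff m f * g m = 0.
Proof.
move=> [[d fd] f0] hg.
set S := mpoly.msupp f.
pose w (m : mpoly.multinom ell) := \sum_k (m k)%:Z *: pts k.
have [t t0 tinj] := characters_separate C [seq w m | m <- S].
pose s m := \prod_i t 0 i ^ w m i 0.
(* Homogeneity of [f] supplies the equality of degrees, the first entry of the weight. *)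
have wg m m' : m \in S -> m' \in S -> w m = w m' -> g m = g m'.
  move=> mS mS' e; apply: hg; apply/same_weight_hat; split => //.
  by rewrite -!mpoly.mdegE !(mpoly.dhomog_mf fd).
pose h z := g (nth (mpoly.mnm0) S (find (fun m => s m == z) S)).
have hE m : m \in S -> h (s m) = g m.
  move=> mS; have hs : has (fun m' => s m' == s m) S by apply/hasP; exists m.
  have /eqP e := nth_find mpoly.mnm0 hs.
  apply: wg => //; first by rewrite mem_nth // -has_find.
  by apply: tinj; rewrite ?map_f // mem_nth // -has_find.
have [P hP] := interpolation h (undup_uniq [seq s m | m <- S]).
(* The powers of the separating point [t] are torus points too. Hence f vanishes at them, and the
   coefficients of f are orthogonal to every power of the distinct values [s m], hence to every
   polynomial in them. *)
have P0 : \sum_(m <- S) mpoly.mcoeff m f * P.[s m] = 0.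
  under eq_bigr do rewrite horner_coef mulr_sumr.
  rewrite exchange_big big1 // => j _ /=.
  under eq_bigr do rewrite mulrCA.
  rewrite -mulr_sumr.
  pose tj : 'rV[C]_n := \row_i t 0 i ^+ j.
  have tj0 i : tj 0 i != 0 by rewrite mxE expf_neq0.
  have := f0 _ (ex_intro2 _ _ tj tj0 erefl).
  rewrite peval_monomial => e; apply/eqP; rewrite mulf_eq0; apply/orP; right; apply/eqP; rewrite -[RHS]e.
  apply: eq_bigr => m _; rewrite mon_torus_point //; congr (_ * _).
  rewrite /s -prodrXl; apply: eq_bigr => i _; rewrite mxE.
  by rewrite !exprnP !exprz_exp mulrC.
rewrite -[RHS]P0; apply: eq_big_seq => m mS; congr (_ * _).
by rewrite hP ?mem_undup ?map_f // hE.
Qed.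

Hypothesis ell_gt0 : (0 < ell)%N.

Definition toric_variety : set 'rV[C]_ell := zariski_closure torus_image.

Lemma torus_image_sub x : torus_image x -> toric_variety x.
Proof.
move=> [t t0 <-]; split; last by move=> f [_]; apply; exists t.
apply/eqP => /rowP/(_ (Ordinal ell_gt0))/eqP; rewrite !mxE; apply/negP.
by apply/prodf_neq0 => i _; rewrite expfz_neq0.
Qed.

Lemma toric_equations f : equations toric_variety f <-> equations torus_image f.
Proof.
split=> [[hf f0]|[hf f0]]; split => // x hx; first by apply/f0/torus_image_sub.
by case: hx => _; apply.
Qed.

Definition mnm (a : 'I_ell -> nat) : mpoly.multinom ell :=
  mpoly.Multinom [tuple a i | i < ell].

Lemma mnmE a i : mnm a i = a i.
Proof. by rewrite /mnm mpoly.multinomE tnth_mktuple. Qed.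

Definition binomial (a b : 'I_ell -> nat) : pol :=
  mpoly.mpolyX C (mnm a) - mpoly.mpolyX C (mnm b).

Lemma mon_mnm (x : 'rV[C]_ell) a : mon x (mnm a) = mon x a.
Proof. by apply: eq_bigr => i _; rewrite mnmE. Qed.

Lemma peval_binomial a b x : peval (binomial a b) x = mon x a - mon x b.
Proof. by rewrite /peval mpoly.mevalB !mpoly.mevalX -[mon x a]mon_mnm -[mon x b]mon_mnm. Qed.

Lemma binomial_equation a b : same_weight H a b ->
  equations torus_image (binomial a b).
Proof.
move=> sw; have [e1 e2] := proj1 (same_weight_hat pts a b) sw; split.
  exists (\sum_k a k)%N; apply: rpredB; rewrite mpoly.dhomogX /= mpoly.mdegE.
    by apply/eqP/eq_bigr => k _; rewrite mnmE.
  by rewrite e1; apply/eqP/eq_bigr => k _; rewrite mnmE.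
move=> _ [t t0 <-]; rewrite peval_binomial !mon_torus_point //.
by rewrite e2 subrr.
Qed.

(** Where the binomials vanish, the value of a monomial depends only on its weight, so
    [equation_weight] makes every other equation vanish as well. *)
Lemma toric_varietyE x : toric_variety x <-> binomial_locus H x.
Proof.
split=> -[x0 hx]; split => //; last first.
  by move=> f hf; rewrite peval_monomial equation_weight.
move=> a b sw; apply/eqP; rewrite -subr_eq0 -peval_binomial; apply/eqP/hx.
exact: binomial_equation.
Qed.

Lemma mderiv_monomial k (m : mpoly.multinom ell) x :
  peval (mpoly.mderiv k (mpoly.mpolyX C m)) x =
  (m k)%:R * \prod_i x 0 i ^+ (m i - (i == k)).
Proof.
rewrite /peval mpoly.mderivX mpoly.mevalZ mpoly.mevalX; congr (_ * _).
apply: eq_bigr => i _; rewrite mpoly.mnmBE mpoly.mnm1E eq_sym.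
by [].
Qed.

Lemma dmon_deriv (f : pol) (x v : 'rV[C]_ell) :
  \sum_k peval (mpoly.mderiv k f) x * v 0 k =
  \sum_(m <- mpoly.msupp f) mpoly.mcoeff m f * dmon x v m.
Proof.
under eq_bigr => k _.
  rewrite [f in mpoly.mderiv k f]mpoly.mpolyE raddf_sum /peval raddf_sum mulr_suml.
  over.
rewrite exchange_big; apply: eq_bigr => m _ /=.
rewrite mulr_sumr; apply: eq_bigr => k _.
rewrite mpoly.mderivZ mpoly.mevalZ -[mpoly.meval _ _]/(peval _ x) mderiv_monomial.
by rewrite -!mulrA (mulrC (\prod_i _)).
Qed.

(** As for points, with [dmon x v] as the function of the weight. Thus the binomials determine the
    tangent spaces without a proof that they generate the ideal. *)
Lemma cone_tangentE (x v : 'rV[C]_ell) :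
  cone_tangent toric_variety x v <-> tangent_cone H x v.
Proof.
split=> [h a b sw|h f /toric_equations hf].
  have := h (binomial a b); rewrite toric_equations.
  move=> /(_ (binomial_equation sw)).
  have -> : \sum_k peval (mpoly.mderiv k (binomial a b)) x * v 0 k =
      dmon x v a - dmon x v b.
    rewrite -sumrB; apply: eq_bigr => k _.
    rewrite mpoly.mderivB /peval mpoly.mevalB -![mpoly.meval _ _]/(peval _ x).
    rewrite !mderiv_monomial !mnmE mulrBl.
    congr (_ - _); rewrite mulrAC; congr (_ * _); apply: eq_bigr => i _.
      by rewrite mnmE.
    by rewrite mnmE.
  by move/eqP; rewrite subr_eq0 => /eqP.
by rewrite dmon_deriv equation_weight.
Qed.

End ToricVariety.

Lemma big_inj_support (V : nmodType) (m l : nat) (f : 'I_m -> 'I_l)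
    (G : 'I_l -> V) : injective f ->
  (forall k, (forall i, f i != k) -> G k = 0) -> \sum_k G k = \sum_i G (f i).
Proof.
move=> finj hG; rewrite (bigID (fun k => k \in codom f)) /=.
rewrite [X in _ + X]big1 ?addr0; last first.
  by move=> k kf; apply: hG => i; apply: contraNneq kf => <-; apply: codom_f.
have u : uniq (codom f) by rewrite map_inj_uniq ?enum_uniq.
by rewrite -(big_uniq _ u) big_image.
Qed.

Lemma rat_row_integral m (x : 'rV[rat]_m) :
  exists2 d : int, d != 0 & exists c : 'cV[int]_m, map_mx intr c = d%:~R *: x^T.
Proof.
exists (\prod_i denq (x 0 i)); first by apply/prodf_neq0 => i _; rewrite denq_eq0.
exists (\col_i (numq (x 0 i) * \prod_(j | j != i) denq (x 0 j))).
apply/colP => i; rewrite !mxE.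
have -> : \prod_j denq (x 0 j) = denq (x 0 i) * \prod_(j | j != i) denq (x 0 j).
  by rewrite (bigD1 i).
by rewrite !intrM numqE; ring.
Qed.

(** * The dimension of the toric variety *)

Section Dimension.
Variables (C : numFieldType) (n ell : nat) (pts : 'I_ell -> 'cV[int]_n).
Hypothesis ell_gt0 : (0 < ell)%N.
Local Notation H := (hat_mx pts).
Let HQ : 'M[rat]_(1 + n, ell) := map_mx intr H.
Hypothesis HQ_full : \rank HQ = (1 + n)%N.
Let X : set 'rV[C]_ell := toric_variety pts.

(** Take coordinates whose weights form a basis. Distinct monomials in them have distinct weights,
    and the indicator function of one weight extracts a single coefficient of an equation, which is
    therefore 0. *)
Lemma alg_indep_max : exists2 J : {set 'I_ell}, #|J| = n.+1 & alg_indep X J.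
Proof.
pose f := maxrankfun HQ^T; exists [set f i | i in [set: 'I_(\rank HQ^T)]]%SET.
  by rewrite card_imset ?cardsT ?card_ord ?mxrank_tr ?HQ_full //; exact: maxrankfun_inj.
move=> p /(toric_equations _ ell_gt0) hp psupp.
have indep (c : 'cV[int]_ell) : H *m c = 0 ->
    (forall k, (forall i, f i != k) -> c k 0 = 0) -> c = 0.
  move=> Hc hc; pose x : 'rV[rat]_(\rank HQ^T) := \row_i (c (f i) 0)%:~R.
  have : x *m rowsub f HQ^T = 0.
    have := congr1 (fun M : 'cV[int]_(1 + n) => (map_mx intr M : 'cV[rat]_(1 + n))^T) Hc.
    rewrite map_mxM trmx_mul raddf0 trmx0 => <-; apply/rowP => i; rewrite !mxE.
    rewrite (big_inj_support (f := f)); last first.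
    - by move=> k hk; rewrite !mxE hc ?mul0r.
    - exact: maxrankfun_inj.
    by apply: eq_bigr => j _; rewrite !mxE.
  move/sub_kermxP; have := maxrowsub_free HQ^T; rewrite -kermx_eq0 => /eqP ->.
  rewrite submx0 => /eqP x0; apply/colP => k; rewrite mxE.
  case: (pselect (exists i, f i = k)) => [[i <-]|nk].
    have /rowP/(_ i)/eqP := x0; rewrite !mxE intr_eq0.
    by move/eqP.
  by apply: hc => i; apply/eqP => fi; apply: nk; exists i.
apply: contrapT => /eqP; rewrite -mpoly.msupp_eq0 => pn0.
have [m0 m0S] : exists m, m \in mpoly.msupp p.
  by case: (mpoly.msupp p) pn0 => // m s _; exists m; rewrite inE eqxx.
pose g (a : 'I_ell -> nat) : C := (`[< same_weight H a m0 >])%:R.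
have gw a b : same_weight H a b -> g a = g b.
  move=> sw; rewrite /g; congr (nat_of_bool _)%:R.
  by apply: asbool_equiv_eq; rewrite /same_weight sw.
have := equation_weight hp gw.
rewrite (bigD1_seq m0) ?mpoly.msupp_uniq //= big1_seq ?addr0.
  rewrite /g asboolT // mulr1 => /eqP.
  by rewrite mpoly.mcoeff_eq0 m0S.
move=> m /andP[mm0 mS]; rewrite /g asboolF ?mulr0 // => sw.
move/negP: mm0; apply; apply/eqP/mpoly.mnmP => k.
suff : natcol m - natcol m0 = 0.
  by move/colP/(_ k); rewrite !mxE => /eqP; rewrite subr_eq0 => /eqP [].
apply: indep; first by rewrite mulmxBr sw subrr.
move=> l hl; rewrite !mxE !psupp ?subrr //; apply/imsetP => -[i _ li].
  by have := hl i; rewrite li eqxx.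
by have := hl i; rewrite li eqxx.
Qed.

(** More than n + 1 weights satisfy an integral linear relation, which gives a nonzero binomial
    equation among the coordinates in [J]. *)
Lemma alg_indep_bound (J : {set 'I_ell}) : alg_indep X J -> (#|J| <= n.+1)%N.
Proof.
move=> hJ; rewrite leqNgt; apply/negP => big.
pose g := @enum_val _ (mem J).
have : kermx (rowsub g HQ^T) != 0.
  rewrite kermx_eq0 /row_free; apply/eqP => e.
  by have := rank_leq_col (rowsub g HQ^T); rewrite e leqNgt big.
case/rowV0Pn => x /sub_kermxP xH x0.
have [d d0 [c cE]] := rat_row_integral x.
pose c' : 'cV[int]_ell := \col_k \sum_(i | g i == k) c i 0.
have c'g i : c' (g i) 0 = c i 0.
  by rewrite mxE; under eq_bigl do rewrite (inj_eq enum_val_inj); rewrite big_pred1_eq.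
have c'0 k : k \notin J -> c' k 0 = 0.
  move=> kJ; rewrite mxE big_pred0 // => i; apply/eqP => gi.
  by move: kJ; rewrite -gi (enum_valP i).
have Hc' : H *m c' = 0.
  have inj : injective (map_mx intr : 'cV[int]_(1 + n) -> 'cV[rat]_(1 + n)).
    by move=> u v /colP e; apply/colP => i; have := e i; rewrite !mxE => /intr_inj.
  apply: inj; rewrite raddf0 map_mxM -/HQ.
  have -> : HQ *m map_mx intr c' = (d%:~R *: (x *m rowsub g HQ^T))^T.
    rewrite scalemxAl trmx_mul linearZ /= -cE; apply/colP => i; rewrite !mxE.
    rewrite (big_inj_support (f := g)); last first.
    - move=> k hk; rewrite [map_mx intr c' k 0]mxE c'0 ?mulr0 //.
      apply/negP => kJ; have := hk (enum_rank_in kJ k).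
      by rewrite /g enum_rankK_in ?eqxx.
    - exact: enum_val_inj.
    by apply: eq_bigr => j _; rewrite [map_mx intr c' _ 0]mxE c'g !mxE mulrC.
  by rewrite xH scaler0 trmx0.
have [a [b [ab hab]]] := natcol_split c'.
have sw : same_weight H a b by apply/eqP; rewrite -subr_eq0 -mulmxBr -ab Hc'.
have ab0 k : k \notin J -> a k = 0%N /\ b k = 0%N.
  by move=> kJ; case: (hab k); rewrite c'0 // => h1 h2; split; [apply: h2|apply: h1].
have e : binomial C a b = 0.
  apply: hJ; first by apply/toric_equations => //; apply: binomial_equation.
  move=> m mS k kJ; have [ak bk] := ab0 k kJ.
  have := mpoly.msuppB_le mS; rewrite mem_cat !mpoly.msuppX !inE.
  by case/orP => /eqP ->; rewrite mnmE.
have mab : mnm a = mnm b.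
  have := congr1 (mpoly.mcoeff (mnm a)) e.
  rewrite mpoly.mcoeffB !mpoly.mcoeffX mpoly.mcoeff0 eqxx.
  by case: eqP => // _ /eqP; rewrite subr0 oner_eq0.
have c'00 : c' = 0.
  rewrite ab; apply/colP => k; rewrite !mxE.
  by rewrite -(mnmE a k) mab mnmE subrr.
move/negP: x0; apply; apply/eqP/rowP => i; rewrite mxE.
have /colP/(_ i) := cE; rewrite !mxE -c'g c'00 mxE => /esym/eqP.
by rewrite mulf_eq0 intr_eq0 (negbTE d0) => /eqP.
Qed.

Lemma toric_dim d : proj_dim X d <-> d = n.
Proof.
split=> [[[J cJ aJ] hmax]|->]; last by split; [exact: alg_indep_max|exact: alg_indep_bound].
have [K cK aK] := alg_indep_max.
apply/eqP; rewrite eqn_leq; have := hmax _ aK; rewrite cK ltnS => ->.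
by have := alg_indep_bound aJ; rewrite cJ ltnS => ->.
Qed.

End Dimension.

Lemma max_free_rows (F : fieldType) (N : nat) (S : 'rV[F]_N -> Prop) :
  exists r (M : 'M[F]_(r, N)), [/\ row_free M, forall i, S (row i M)
    & forall s, S s -> (s <= M)%MS].
Proof.
pose P (k : nat) := `[< exists m (M : 'M[F]_(m, N)),
  (forall i, S (row i M)) /\ \rank M = k >].
have P0 : exists k, P k.
  exists 0%N; apply/asboolP; exists 0%N, 0; split; first by case.
  by rewrite mxrank0.
have Pmax k : P k -> (k <= N)%N by move/asboolP => [m [M [_ <-]]]; apply: rank_leq_col.
case: (ex_maxnP P0 Pmax) => k /asboolP[m [M [MS rM]]] kmax.
exists (\rank M), (rowsub (maxrankfun M) M); split; first exact: maxrowsub_free.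
  by move=> i; rewrite row_rowsub.
move=> s Ss; rewrite eq_maxrowsub.
have : (\rank (col_mx M s) <= k)%N.
  apply: kmax; apply/asboolP; exists (m + 1)%N, (col_mx M s); split => //.
  move=> i; rewrite -(fintype.splitK i); case: (fintype.split i) => j /=.
    by rewrite rowKu.
  by rewrite rowKd (_ : row j s = s) //; apply/rowP => l; rewrite !mxE (ord1 j).
rewrite -rM -addsmxE => h.
have := mxrank_leqif_sup (addsmxSl M s).
by move=> /leqifP; rewrite addsmx_sub submx_refl /=; case: ifP => // _; rewrite ltnNge h.
Qed.

Lemma row_comb (F : fieldType) (m N : nat) (M : 'M[F]_(m, N))
    (V : 'rV[F]_N -> Prop) :
  V 0 -> (forall a u v, V u -> V v -> V (a *: u + v)) ->
  (forall i, V (row i M)) -> forall v, (v <= M)%MS -> V v.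
Proof.
move=> V0 Vl hM v /submxP[x ->]; rewrite mulmx_sum_row.
elim/big_rec: _ => // i u _ Vu; exact: Vl.
Qed.

Lemma subspace_has_dim (F : fieldType) (N : nat) (V : 'rV[F]_N -> Prop) :
  V 0 -> (forall a u v, V u -> V v -> V (a *: u + v)) -> exists d, has_dim V d.
Proof.
move=> V0 Vl; have [r [M [Mf MV hM]]] := max_free_rows V.
exists r, M; split => // v; split; first exact: hM.
exact: row_comb.
Qed.

Lemma has_dim_uniq (F : fieldType) (N d e : nat) (V : set 'rV[F]_N) :
  has_dim V d -> has_dim V e -> d = e.
Proof.
move=> [M [Mf MV]] [M' [Mf' MV']]; rewrite -(eqP Mf) -(eqP Mf').
apply/eqmx_rank/andP; split; apply/row_subP => i.
  by apply/MV'/MV/row_sub.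
by apply/MV/MV'/row_sub.
Qed.

Lemma dmon_linear ell (F : fieldType)
    (q : 'rV[F]_ell) a (c : F) u v :
  dmon q (c *: u + v) a = c * dmon q u a + dmon q v a.
Proof.
rewrite /dmon mulr_sumr -big_split; apply: eq_bigr => k _ /=.
by rewrite !mxE; ring.
Qed.

Lemma tangent_cone0 N ell (H : 'M[int]_(N, ell)) (F : fieldType)
    (q : 'rV[F]_ell) : tangent_cone H q 0.
Proof.
move=> a b _; have d0 c : dmon q 0 c = 0.
  by rewrite /dmon big1 // => k _; rewrite mxE mulr0 mul0r.
by rewrite !d0.
Qed.

Lemma tangent_cone_linear N ell (H : 'M[int]_(N, ell)) (F : fieldType)
    (q : 'rV[F]_ell) c u v : tangent_cone H q u -> tangent_cone H q v ->
  tangent_cone H q (c *: u + v).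
Proof. by move=> hu hv a b sw; rewrite !dmon_linear (hu _ _ sw) (hv _ _ sw). Qed.

(** * Comparison of real and complex points and tangent spaces *)

Section RealPoints.
Variables (R : realType) (n ell : nat) (pts : 'I_ell -> 'cV[int]_n).
Hypothesis ell_gt0 : (0 < ell)%N.
Local Notation H := (hat_mx pts).
Hypothesis H_full : \rank (map_mx intr H : 'M[rat]_(1 + n, ell)) = (1 + n)%N.
Local Notation C := (complex R).
Implicit Types p v : 'rV[R]_ell.

Lemma mon_toC p a : mon (toC p) a = real_complex R (mon p a).
Proof.
rewrite /mon rmorph_prod; apply: eq_bigr => k _.
by rewrite rmorphXn mxE.
Qed.

Lemma binomial_locus_toC p : binomial_locus H (toC p) <-> binomial_locus H p.
Proof.
rewrite /binomial_locus map_mx_eq0; split=> -[p0 h]; split => // a b sw.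
  by apply: complexI; rewrite -!mon_toC (h _ _ sw).
by rewrite !mon_toC (h _ _ sw).
Qed.

Lemma Y_DeltaE p : Y_Delta pts p <-> binomial_locus H p.
Proof.
rewrite -binomial_locus_toC.
exact: (@toric_varietyE C n ell pts (toC p)).
Qed.

Definition re_row (v : 'rV[C]_ell) : 'rV[R]_ell := map_mx (@complex.Re R) v.
Definition im_row (v : 'rV[C]_ell) : 'rV[R]_ell := map_mx (@complex.Im R) v.

Lemma complex_row (v : 'rV[C]_ell) :
  v = 'i%C *: toC (im_row v) + toC (re_row v).
Proof.
by apply/rowP => k; rewrite !mxE [LHS]complexE addrC.
Qed.

Lemma dmon_toC p v a : dmon (toC p) (toC v) a = real_complex R (dmon p v a).
Proof.
rewrite /dmon raddf_sum; apply: eq_bigr => k _.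
rewrite /= rmorphM rmorphM rmorph_prod rmorph_nat /= mxE; congr (_ * _).
by apply: eq_bigr => i _; rewrite mxE rmorphXn.
Qed.

Lemma tangent_cone_toC p (v : 'rV[C]_ell) : tangent_cone H (toC p) v <->
  tangent_cone H p (re_row v) /\ tangent_cone H p (im_row v).
Proof.
have dE a : dmon (toC p) v a = Complex (dmon p (re_row v) a) (dmon p (im_row v) a).
  rewrite {1}(complex_row v) dmon_linear !dmon_toC [RHS]complexE addrC /=.
  by [].
split=> [h|[h1 h2]]; last by move=> a b sw; rewrite !dE (h1 _ _ sw) (h2 _ _ sw).
by split=> a b sw; have := h _ _ sw; rewrite !dE => -[].
Qed.

Lemma re_row_toC v : re_row (toC v) = v.
Proof. by apply/rowP => k; rewrite !mxE. Qed.

Lemma im_row_toC v : im_row (toC v) = 0.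
Proof. by apply/rowP => k; rewrite !mxE. Qed.

Lemma tangent_cone_real p v :
  tangent_cone H (toC p) (toC v) <-> tangent_cone H p v.
Proof.
rewrite tangent_cone_toC re_row_toC im_row_toC; split=> [[]//|h]; split=> //.
exact: tangent_cone0.
Qed.

(** A real frame is also a complex one, since the binomials have real coefficients. Conversely the
    real space has some dimension, and uniqueness of the complex dimension identifies it. *)
Lemma has_dim_toC p d : has_dim (tangent_cone H (toC p) : set 'rV[C]_ell) d <->
  has_dim (tangent_cone H p) d.
Proof.
have up e : has_dim (tangent_cone H p) e ->
    has_dim (tangent_cone H (toC p) : set 'rV[C]_ell) e.
  move=> [M [Mf MT]]; exists (map_mx (real_complex R) M); split.
    by rewrite /row_free mxrank_map.
  move=> v; rewrite tangent_cone_toC !MT; split=> [[h1 h2]|].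
    rewrite (complex_row v) addmx_sub ?scalemx_sub //.
      by rewrite /toC map_submx.
    by rewrite /toC map_submx.
  move=> /submxP[x ->]; pose xr := map_mx (@complex.Re R) x; pose xi := map_mx (@complex.Im R) x.
  have -> : x = 'i%C *: map_mx (real_complex R) xi + map_mx (real_complex R) xr.
    by apply/rowP => k; rewrite !mxE [LHS]complexE addrC.
  rewrite mulmxDl -scalemxAl -!map_mxM.
  have -> : re_row ('i%C *: map_mx (real_complex R) (xi *m M) +
      map_mx (real_complex R) (xr *m M)) = xr *m M.
    by apply/rowP => k; rewrite !mxE /=; simpc; rewrite /=; ring.
  have -> : im_row ('i%C *: map_mx (real_complex R) (xi *m M) +
      map_mx (real_complex R) (xr *m M)) = xi *m M.
    by apply/rowP => k; rewrite !mxE /=; simpc; rewrite /=; ring.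
  by split; apply: submxMl.
split; last exact: up.
move=> hC; have [e he] : exists e, has_dim (tangent_cone H p) e.
  by apply: subspace_has_dim; [exact: tangent_cone0|exact: tangent_cone_linear].
by rewrite (has_dim_uniq hC (up _ he)).
Qed.

Definition smooth_pt p : Prop := [/\ binomial_locus H p, enorm p = 1
  & has_dim (tangent_cone H p) n.+1].

Lemma cone_tangent_X p : cone_tangent (@X_Delta R n ell pts) (toC p) =
  (tangent_cone H (toC p) : set 'rV[C]_ell).
Proof.
apply/seteqP; split=> v; first by move/(@cone_tangentE C n ell pts ell_gt0).
by move=> h; apply/(@cone_tangentE C n ell pts ell_gt0).
Qed.

Lemma Yplus_smoothE p : Yplus_smooth pts p <-> smooth_pt p.
Proof.
have dimE d : proj_dim (@X_Delta R n ell pts) d <-> d = n.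
  exact: (@toric_dim C n ell pts ell_gt0 H_full).
split=> [[[/Y_DeltaE hp p1] [_ [d /dimE -> ]]]|[hp p1 hd]].
  by rewrite cone_tangent_X has_dim_toC.
split; first by split=> //; apply/Y_DeltaE.
split; first by apply/(@toric_varietyE C n ell pts (toC p))/binomial_locus_toC.
by exists n; [apply/dimE | rewrite cone_tangent_X has_dim_toC].
Qed.

Lemma Yplus_tangentE p v : Yplus_tangent pts p v <->
  tangent_cone H p v /\ \sum_k p 0 k * v 0 k = 0.
Proof. by rewrite /Yplus_tangent /= cone_tangent_X tangent_cone_real. Qed.

End RealPoints.

(** * The index of the lattice *)

Section Index.
Variables (V : zmodType) (L : set V).
Hypothesis L0 : L 0.
Hypothesis LD : forall x y, L x -> L y -> L (x + y).
Hypothesis LN : forall x, L x -> L (- x).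

(* Translation by w permutes the k cosets of L, so k w is in L. *)
Lemma index_mul k : has_index L [set: V]%classic k -> forall w, L (w *+ k).
Proof.
move=> [u [_ hu]] w.
have [s hs] : exists s : 'I_k -> 'I_k, forall i, L (u i + w - u (s i)).
  have hs i : exists j, L (u i + w - u j).
    by have [j [hj _]] := hu (u i + w) I; exists j.
  by have [s ?] := choice hs; exists s.
have sinj : injective s.
  move=> i j sij; have [l [_ hl]] := hu (u i) I.
  transitivity l; first by symmetry; apply: hl; rewrite subrr.
  apply: hl; have := LD (hs i) (LN (hs j)); rewrite sij opprB addrA subrK.
  by rewrite opprD addrACA subrr addr0.
have : L (\sum_i (u i + w - u (s i))).
  by elim/big_rec: _ => // i x _; apply: LD.
rewrite sumrB big_split /= [X in _ + _ - X](_ : _ = \sum_i u i).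
  by rewrite addrAC subrr add0r sumr_const card_ord.
by rewrite [RHS](reindex_inj sinj).
Qed.
End Index.

Section OddIndex.
Variables (n ell : nat) (pts : 'I_ell -> 'cV[int]_n).
Hypothesis ell_gt0 : (0 < ell)%N.
Local Notation H := (hat_mx pts).

(** By [index_mul], N times a vector of Z^n lies in the direction lattice. Applied to the basis
    vectors of Z^(1+n), this yields the columns of [Q]. *)
Lemma odd_index_section : odd_index (affine_lattice_dir pts) [set: 'cV[int]_n]%classic ->
  exists2 N : nat, odd N & exists Q : 'M[int]_(ell, 1 + n), H *m Q = (N%:Z)%:M.
Proof.
move=> [N [hN oddN]]; exists N => //.
have L0 : affine_lattice_dir pts 0.
  exists (fun=> 0); split; first by rewrite big1.
  by rewrite big1 // => k _; rewrite scale0r.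
have LD x y : affine_lattice_dir pts x -> affine_lattice_dir pts y ->
    affine_lattice_dir pts (x + y).
  move=> [c [c0 ->]] [d [d0 ->]]; exists (fun k => c k + d k); split.
    by rewrite big_split /= c0 d0 addr0.
  by rewrite -big_split; apply: eq_bigr => k _; rewrite scalerDl.
have LN x : affine_lattice_dir pts x -> affine_lattice_dir pts (- x).
  move=> [c [c0 ->]]; exists (fun k => - c k); split.
    by rewrite sumrN c0 oppr0.
  by rewrite -sumrN; apply: eq_bigr => k _; rewrite scaleNr.
pose k0 := Ordinal ell_gt0.
have hit (u : 'cV[int]_(1 + n)) : exists c, H *m c = N%:Z *: u.
  have [c [c0 cE]] := index_mul L0 LD LN hN (dsubmx u - u (lshift n 0) 0 *: pts k0).
  (* The [c k] have sum 0, so the multiple of [dcol k0] supplies the first entry of N u. Its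
     contribution to the other entries was subtracted beforehand. *)
  exists (\col_k c k + (N%:Z * u (lshift n 0) 0) *: dcol k0).
  set z := _ + _; have zE k : z k 0 = c k + N%:Z * u (lshift n 0) 0 * (k == k0)%:R.
    by rewrite !mxE eqxx andbT.
  have s1 : \sum_k z k 0 = N%:Z * u (lshift n 0) 0.
    under eq_bigr do rewrite zE; rewrite big_split /= c0 add0r.
    rewrite (bigD1 k0) //= ?eqxx mulr1 big1 ?addr0 // => k /negbTE ->.
    by rewrite mulr0.
  have s2 : \sum_k z k 0 *: pts k = N%:Z *: dsubmx u.
    under eq_bigr do rewrite zE scalerDl; rewrite big_split /= -cE.
    rewrite [X in _ + X](bigD1 k0) //= ?eqxx mulr1 [X in _ + (_ + X)]big1 ?addr0.
      by rewrite -scaler_nat natz scalerBr scalerA subrK.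
    by move=> k /negbTE ->; rewrite mulr0 scale0r.
  rewrite hat_mx_mul s1 s2 -[in RHS](vsubmxK u) scale_col_mx; congr col_mx.
  by apply/colP => i; rewrite !mxE ord1; congr (_ * u _ _); apply: val_inj.
have [Q hQ] := choice (fun j => hit (delta_mx j 0)).
exists (\matrix_(i, j) Q j i 0); apply/matrixP => i j.
have := congr1 (fun M : 'cV[int]_(1 + n) => M i 0) (hQ j); rewrite !mxE eqxx andbT mulr_natr => <-.
by apply: eq_bigr => k _; rewrite mxE.
Qed.

End OddIndex.

Lemma gcd_primitive (n : nat) (u : 'rV[int]_n) : u != 0 ->
  exists2 d : int, 0 < d & exists2 a, primitive a & u = d *: a.
Proof.
move=> u0; pose P (k : nat) := `[< (0 < k)%N /\ forall j, (k%:Z %| u ord0 j)%Z >].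
have P1 : exists k, P k by exists 1%N; apply/asboolP; split=> // j; apply: dvd1z.
have [j uj] : exists j, u 0 j != 0.
  apply: contrapT => h; move/negP: u0; apply; apply/eqP/rowP => j; rewrite mxE.
  by apply: contrapT => uj; apply: h; exists j; apply/eqP.
have Pb k : P k -> (k <= `|u ord0 j|)%N.
  move=> /asboolP[_ /(_ j)]; rewrite dvdzE /= => /dvdn_leq; apply.
  by rewrite absz_gt0.
case: (ex_maxnP P1 Pb) => k /asboolP[k0 kd] kmax.
exists k%:Z => //; exists (\row_j (u ord0 j %/ k%:Z)%Z); last first.
  by apply/rowP => i; rewrite !mxE mulrC divzK.
move=> d hd; have d0 : (0 < `|d|)%N.
  rewrite absz_gt0; apply: contraNneq uj => dE; have := hd j.
  rewrite dE dvd0z mxE => /eqP e; have := divzK (kd j).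
  by rewrite e mul0r => <-.
have : (k * `|d| <= k)%N.
  apply: kmax; apply/asboolP; rewrite muln_gt0 k0 d0; split => // i.
  have := hd i; rewrite mxE dvdzE => hdi.
  by rewrite dvdzE -(divzK (kd i)) abszM !absz_nat mulnC dvdn_pmul2r.
rewrite -{2}[k]muln1 leq_pmul2l // => d1; rewrite dvdzE /=.
by have -> : `|d|%N = 1%N by lia.
Qed.

Section Hat.
Variables (R : realType) (n ell : nat) (pts : 'I_ell -> 'cV[int]_n).
Local Notation H := (hat_mx pts).
Local Notation HR := (map_mx intr H : 'M[R]_(1 + n, ell)).

Definition hatv (x : 'cV[R]_n) : 'cV[R]_(1 + n) := col_mx 1%:M x.

Lemma hat_col k : col k HR = hatv (toR R (pts k)).
Proof.
rewrite -map_col; apply/colP => i; rewrite !mxE.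
case: splitP => j _; rewrite !mxE ?rmorph1 //.
by rewrite (ord1 j) eqxx.
Qed.

End Hat.

(** * Facets of the polytope *)

Lemma hat_comb (R : realType) (n m : nat) (w : 'I_m -> R)
    (x : 'I_m -> 'cV[R]_n) :
  \sum_i w i *: hatv (x i) = col_mx (\sum_i w i)%:M (\sum_i w i *: x i).
Proof.
rewrite -[LHS]vsubmxK !linear_sum (raddf_sum (@scalar_mx R 1)); congr col_mx; apply: eq_bigr => i _.
  by rewrite linearZ /= col_mxKu scalemx1.
by rewrite linearZ /= col_mxKd.
Qed.

Section Facets.
Variables (R : realType) (n r ell : nat) (Delta : set 'cV[R]_n)
  (A : 'M[int]_(r, n)) (b : 'cV[int]_r) (pts : 'I_ell -> 'cV[int]_n).
Hypothesis hpoly : lattice_polytope Delta.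
Hypothesis hfacets : facet_description Delta A b.
Hypothesis hpts : enum_lattice_points Delta pts.
Local Notation H := (hat_mx pts).
Let HR : 'M[R]_(1 + n, ell) := map_mx intr H.

(** The vertices are lattice points, so Delta is the convex hull of the points [pts k]. *)
Lemma polytope_ind (P : 'cV[R]_n -> Prop) :
  (forall (m : nat) (w : 'I_m -> R) (f : 'I_m -> 'I_ell),
     (forall i, 0 <= w i) -> \sum_i w i = 1 ->
     P (\sum_i w i *: toR R (pts (f i)))) ->
  forall x, Delta x -> P x.
Proof.
move=> hP x Dx; have [k [v DE]] := hpoly.
have vD i : Delta (toR R (v i)).
  rewrite DE; exists (fun j => (j == i)%:R); split => [j||].
  - exact: ler0n.
  - by rewrite (bigD1 i) //= eqxx big1 ?addr0 // => j /negbTE ->.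
  - rewrite (bigD1 i) //= eqxx scale1r big1 ?addr0 // => j /negbTE ->.
    by rewrite scale0r.
have [f hf] := choice (fun i => proj1 (proj2 hpts (v i)) (vD i)).
move: Dx; rewrite {1}DE => -[w [w0 w1 ->]].
under eq_bigr do rewrite -hf.
exact: hP.
Qed.

Lemma pts_in k : Delta (toR R (pts k)).
Proof. by apply/(proj2 hpts); exists k. Qed.

Lemma polytope_ge0 (f : 'rV[R]_(1 + n)) :
  (forall k, 0 <= (f *m HR) 0 k) -> forall x, Delta x -> 0 <= (f *m hatv x) 0 0.
Proof.
move=> f0; apply: polytope_ind => m w g w0 w1.
rewrite /hatv -{1}w1 -hat_comb mulmx_sumr summxE; apply: sumr_ge0 => i _.
by rewrite -scalemxAr mxE mulr_ge0 // -hat_col mulmx_col.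
Qed.

Variable g : 'I_(1 + n) -> 'I_ell.
Let HJ : 'M[R]_(1 + n) := colsub g HR.
Hypothesis HJu : HJ \in unitmx.
Variable j : 'I_(1 + n).
Let phi : 'rV[R]_(1 + n) := row j (invmx HJ).
Hypothesis phi_ge0 : forall k, 0 <= (phi *m HR) 0 k.
Variable k0 : 'I_ell.
Hypothesis phi_k0 : (phi *m HR) 0 k0 = 0.

Lemma phi_g i : (phi *m HR) 0 (g i) = (j == i)%:R.
Proof.
have /rowP/(_ i) : phi *m HJ = row j 1%:M by rewrite -row_mul mulVmx.
by rewrite mxE [in RHS]mxE mxE => <-; rewrite mxE; apply: eq_bigr => l _; rewrite !mxE.
Qed.

Lemma phi_integral : exists2 D : R, 0 < D &
  exists psi : 'rV[int]_(1 + n), map_mx intr psi = D *: phi.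
Proof.
pose z := \det (colsub g H); have HJE : HJ = map_mx intr (colsub g H).
  by apply/matrixP => i l; rewrite !mxE.
have dE : \det HJ = z%:~R by rewrite HJE det_map_mx.
have z0 : z != 0.
  by have := HJu; rewrite unitmxE unitfE dE intr_eq0.
exists (`|z|%:~R); first by rewrite ltr0z normr_gt0.
exists (Num.sg z *: row j (\adj (colsub g H))).
rewrite map_mxZ map_row map_mx_adj -HJE /phi /invmx HJu dE.
apply/rowP => i; rewrite !mxE normrEsg intrM -mulrA mulVKf //.
by rewrite intr_eq0.
Qed.

(** The linear part of [phi] is not 0, because [phi] is 1 at [g j] and 0 at [k0]. Dividing it by its
    content gives [a], and the constant is then integral because [phi] vanishes at the lattice point
    [pts k0]. *)
Lemma facet_normal : exists a (c : int) (th : R),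
  [/\ 0 < th, primitive a & phi = th *: map_mx intr (row_mx c%:M a)].
Proof.
have [D D0 [psi psiE]] := phi_integral.
have psi0 : rsubmx psi != 0.
  apply/eqP => p0; have e k : (phi *m HR) 0 k = lsubmx phi 0 0.
    have rphi : rsubmx phi = 0.
      apply: (scalerI (lt0r_neq0 D0)); rewrite scaler0 -linearZ /= -psiE.
      by rewrite -map_rsubmx p0 raddf0.
    rewrite -mulmx_col hat_col -[phi in LHS]hsubmxK mul_row_col rphi mul0mx addr0.
    by rewrite mulmx1.
  have := phi_g j; rewrite e -(e k0) phi_k0 eqxx => /eqP.
  by rewrite eq_sym oner_eq0.
have [d d0 [a ha psia]] := gcd_primitive psi0.
have rphi : rsubmx phi = (d%:~R / D) *: map_mx intr a.
  apply: (scalerI (lt0r_neq0 D0)); rewrite scalerA mulrC divfK ?lt0r_neq0 //.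
  by rewrite -linearZ /= -psiE -map_rsubmx psia map_mxZ.
exists a, (- (a *m pts k0) 0 0), (d%:~R / D); split => //.
  by rewrite divr_gt0 // ltr0z.
rewrite -[LHS]hsubmxK rphi map_row_mx scale_row_mx; congr row_mx.
apply/matrixP => x y; rewrite !ord1.
have := phi_k0; rewrite -mulmx_col hat_col -[phi in LHS]hsubmxK mul_row_col rphi.
rewrite mulmx1 mxE -scalemxAl -map_mxM => /eqP; rewrite addr_eq0 => /eqP ->.
by rewrite !mxE intrN mulrN.
Qed.

Lemma phi_hat k : (phi *m hatv (toR R (pts k))) 0 0 = (phi *m HR) 0 k.
Proof. by rewrite -hat_col mulmx_col. Qed.

End Facets.

(** The points [pts (g i)] with i different from j are d + 1 affinely independent points of the
    face, as the columns of [HJ] are independent. *)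
Lemma face_affine_dim (R : realType) (d ell : nat) (Delta : set 'cV[R]_d.+1)
    (pts : 'I_ell -> 'cV[int]_d.+1) (g : 'I_(1 + d.+1) -> 'I_ell) j :
  (forall k, Delta (toR R (pts k))) ->
  let HJ := colsub g (map_mx intr (hat_mx pts)) : 'M[R]_(1 + d.+1) in
  HJ \in unitmx ->
  has_affine_dim [set x | Delta x /\ (row j (invmx HJ) *m hatv x) 0 0 = 0]%classic d.
Proof.
move=> ptsD HJ HJu; pose P i := toR R (pts (g i)).
have HJmul (y : 'cV[R]_(1 + d.+1)) :
    HJ *m y = \sum_i y i 0 *: hatv (P i).
  apply/colP => l; rewrite mxE summxE; apply: eq_bigr => i _.
  by rewrite /P -hat_col !mxE mulrC.
pose l0 := lift j ord0; pose l1 (k : 'I_d) := lift j (lift ord0 k).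
have sumE (V : nmodType) (F : 'I_(1 + d.+1) -> V) :
    \sum_i F i = F j + (F l0 + \sum_k F (l1 k)).
  by rewrite (bigD1_ord j) //= big_ord_recl.
pose x0 := P l0; pose M : 'M[R]_(d.+1, d) := \matrix_(i, k) (P (l1 k) - x0) i 0.
have colM k : col k M = P (l1 k) - x0 by apply/colP => i; rewrite !mxE.
have mulM (c : 'cV[R]_d) : M *m c = \sum_k c k 0 *: (P (l1 k) - x0).
  apply/colP => i; rewrite mxE summxE; apply: eq_bigr => k _.
  by rewrite !mxE mulrC.
(* Affine coordinates with total weight [s] and weight 0 at [j]: the weights [c] belong to the
   points [l1 k], and the base point [l0] receives the rest. *)
pose yv (s : R) (c : 'cV[R]_d) : 'cV[R]_(1 + d.+1) :=
  \col_i (if unlift j i is Some i' then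
            if unlift ord0 i' is Some k then c k 0 else s - \sum_k c k 0
          else 0).
have yvj s c : yv s c j 0 = 0 by rewrite mxE unlift_none.
have yv0 s c : yv s c l0 0 = s - \sum_k c k 0.
  by rewrite mxE /l0 liftK unlift_none.
have yv1 s c k : yv s c (l1 k) 0 = c k 0 by rewrite mxE /l1 !liftK.
have HJyv s c : HJ *m yv s c = col_mx s%:M (s *: x0 + M *m c).
  have s1 : \sum_i yv s c i 0 = s.
    by rewrite sumE yvj yv0 add0r (eq_bigr _ (fun k _ => yv1 s c k)) subrK.
  have s2 : \sum_i yv s c i 0 *: P i = s *: x0 + M *m c.
    rewrite sumE yvj yv0 scale0r add0r mulM.
    rewrite [X in _ + X = _](eq_bigr (fun k => c k 0 *: P (l1 k))) => [|k _].
      under [in RHS]eq_bigr do rewrite scalerBr.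
      by rewrite sumrB -scaler_suml scalerBl -addrA (addrC (- _)).
    by rewrite yv1.
  by rewrite HJmul hat_comb s1 s2.
have phiE (y : 'cV[R]_(1 + d.+1)) : (row j (invmx HJ) *m (HJ *m y)) 0 0 = y j 0.
  by rewrite -row_mul mulmxA mulVmx // mul1mx mxE.
have inj0 (c : 'cV[R]_d) : M *m c = 0 -> c = 0.
  move=> Mc; have : HJ *m yv 0 c = 0.
    by rewrite HJyv Mc scale0r addr0 raddf0 col_mx0.
  move/(congr1 (mulmx (invmx HJ))); rewrite mulmxA mulVmx // mul1mx mulmx0 => y0.
  by apply/colP => k; rewrite -(yv1 0) y0 !mxE.
exists x0, M; split.
- split; first exact: ptsD.
  have := phiE (yv 1 0); rewrite HJyv yvj mulmx0 addr0 scale1r.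
  by [].
- rewrite -mxrank_tr; apply/eqP; apply: inj_row_free => v hv.
  rewrite -[v]trmxK (inj0 v^T) ?trmx0 //.
  by rewrite -[M]trmxK -trmx_mul hv trmx0.
- move=> k; rewrite colM addrC subrK; split; first exact: ptsD.
  have := phiE (yv 1 (delta_mx k 0)); rewrite HJyv yvj scale1r -colE colM addrC subrK.
  by [].
- move=> x [_ hx]; pose y := invmx HJ *m hatv x.
  have yj : y j 0 = 0.
    by rewrite -hx -row_mul [RHS]mxE.
  have : HJ *m y = hatv x by rewrite mulmxA mulmxV // mul1mx.
  rewrite HJmul hat_comb => /eq_col_mx[e1 e2].
  have {}e1 : \sum_i y i 0 = 1.
    by move/matrixP/(_ 0 0): e1; rewrite !mxE.
  exists (\col_k y (l1 k) 0); rewrite -e2 mulM !sumE yj scale0r add0r.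
  move: e1; rewrite sumE yj add0r => /(canRL (addrK _)) ->.
  under [in RHS]eq_bigr do rewrite mxE scalerBr.
  by rewrite sumrB -scaler_suml scalerBl scale1r -addrA (addrC (- _)) addrA.
Qed.

(** A functional of the chart that is nonnegative on the lattice points supports a facet, so its
    primitive normal is a row of [A]. The integrality of [w] is what later transfers parity from
    [b : A] to the chart. *)
Theorem facet_functional (R : realType) (n r ell : nat) (Delta : set 'cV[R]_n)
  (A : 'M[int]_(r, n)) (b : 'cV[int]_r) (pts : 'I_ell -> 'cV[int]_n)
  (hpoly : lattice_polytope Delta) (hfacets : facet_description Delta A b)
  (hpts : enum_lattice_points Delta pts) (g : 'I_(1 + n) -> 'I_ell) j k0 :
  let HR := map_mx intr (hat_mx pts) : 'M[R]_(1 + n, ell) in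
  let HJ := colsub g HR in let phi := row j (invmx HJ) in
  HJ \in unitmx -> (forall k, 0 <= (phi *m HR) 0 k) -> (phi *m HR) 0 k0 = 0 ->
  exists i w, forall u : 'cV[int]_(1 + n),
    ((row_mx b A *m u) i 0)%:~R = w%:~R * (phi *m map_mx intr u) 0 0.
Proof.
move=> HR HJ phi HJu phi_ge0 phi_k0.
have [a [cc [th [th0 apr phiE']]]] := facet_normal HJu phi_k0.
have phiE : phi = th *: map_mx intr (row_mx cc%:M a) := phiE'.
have key x : (phi *m hatv x) 0 0 = th * ((toR R a *m x) 0 0 + cc%:~R).
  rewrite phiE -scalemxAl mxE map_row_mx mul_row_col mulmx1 mxE addrC.
  congr (_ * (_ + _)); by rewrite !mxE eqxx.
have [d dn face] : exists2 d, d.+1 = n &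
    has_affine_dim [set x | Delta x /\ (phi *m hatv x) 0 0 = 0]%classic d.
  (* In dimension 0 all points [pts k] coincide, whereas [phi] separates [g j] from [k0]. *)
  have n0 : (0 < n)%N.
    have [n0|//] := posnP n.
    have e k : hatv (toR R (pts k)) = hatv (toR R (pts k0)).
      by congr col_mx; apply/colP => -[i hi]; exfalso; move: hi; rewrite n0.
    have := phi_g HJu j j; rewrite -phi_hat e phi_hat phi_k0 eqxx => /eqP.
    by rewrite eq_sym oner_eq0.
  have ptsD := pts_in hpts.
  clear -n0 HJu ptsD.
  case: n n0 => // d _ in Delta pts HR g j HJ phi HJu ptsD *.
  by exists d => //; apply: face_affine_dim.
have facet : primitive_facet_normal Delta a cc.
  split => //.
    move=> x Dx; have := polytope_ge0 hpoly hpts phi_ge0 Dx.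
    by rewrite key pmulr_rge0 // => h; lra.
  exists d => //; have -> : [set x | Delta x /\ (toR R a *m x) 0 0 = - cc%:~R]%classic =
      [set x | Delta x /\ (phi *m hatv x) 0 0 = 0]%classic; last by [].
  apply/seteqP; split=> x /= [Dx h]; split => //.
    by rewrite key h addNr mulr0.
  by apply/eqP; rewrite -addr_eq0; move/eqP: h; rewrite key mulf_eq0 gt_eqF.
case: hfacets => _ hrow _ /(_ _ _ facet)[i rowi].
(* Both bounds on the same normal are attained on Delta, one at a point of the facet of row i and
   the other at [pts k0], so the constants agree. *)
have bi : b i 0 = cc.
  have [_ low [d' _ [y0 [_ [[Dy0 ey0] _ _ _]]]]] := hrow i.
  have := low _ (pts_in hpts k0).
  have : (toR R a *m toR R (pts k0)) 0 0 = - cc%:~R.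
    apply/eqP; rewrite -addr_eq0; have /eqP := phi_k0.
    by rewrite -phi_hat key mulf_eq0 gt_eqF.
  rewrite rowi => -> h1; have [_ low' _] := facet; have := low' _ Dy0.
  rewrite -rowi ey0 => h2; apply/eqP; rewrite -(eqr_int R) eq_le.
  by apply/andP; split; lra.
(* As [phi] is 1 at the weight of [g j], the factor is the value of the row there. *)
exists i, ((row_mx b A *m (hat_mx pts *m dcol (g j))) i 0).
have rowE : map_mx intr (row i (row_mx b A)) = th^-1 *: phi.
  rewrite phiE scalerA mulVf ?gt_eqF // scale1r; congr map_mx.
  rewrite row_row_mx rowi; congr row_mx.
  by apply/matrixP => x y; rewrite !ord1 !mxE bi eqxx.
have val (u : 'cV[int]_(1 + n)) : ((row_mx b A *m u) i 0)%:~R =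
    th^-1 * (phi *m map_mx intr u) 0 0.
  transitivity ((map_mx intr (row i (row_mx b A *m u)) : 'M[R]_(1, 1)) 0 0).
    by rewrite !mxE.
  by rewrite row_mul map_mxM rowE -scalemxAl mxE.
move=> u; rewrite val; congr (_ * _).
by rewrite val -colE map_col mulmx_col phi_g // eqxx mulr1.
Qed.

(** * Signs of monomials near a smooth point *)

Lemma torus_locus N ell (H : 'M[int]_(N, ell)) (F : fieldType) (q : 'rV[F]_ell) :
  (0 < ell)%N -> (forall k, q 0 k != 0) ->
  (forall c, H *m c = 0 -> zmon q c = 1) -> binomial_locus H q.
Proof.
move=> ell0 q0 hq; split.
  by apply: contraNneq (q0 (Ordinal ell0)) => ->; rewrite mxE.
move=> a b sw; have supp c : supported q c by move=> k qk; have := q0 k; rewrite qk eqxx.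
have : zmon q (natcol a - natcol b) = 1 by apply: hq; rewrite mulmxBr sw subrr.
by rewrite zmonB // !zmon_natcol => e; rewrite -[LHS](divfK (proj2 (mon_neq0 q b) (supp _))) e mul1r.
Qed.

Lemma zmonZ ell (F : fieldType) (p : 'rV[F]_ell) (z : int) c :
  zmon p (z *: c) = zmon p c ^ z.
Proof.
rewrite /zmon (big_morph (fun x : F => x ^ z) (fun x y => expfzMl x y z) (exp1rz _ z)).
by apply: eq_bigr => k _; rewrite mxE mulrC exprz_exp.
Qed.

Lemma zmon_sum ell (F : fieldType) (p q : 'rV[F]_ell) (S : 'I_ell -> 'cV[int]_ell) c :
  (forall k, supported p (S k)) -> (forall k, q 0 k = zmon p (S k)) ->
  zmon q c = zmon p (\sum_k c k 0 *: S k).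
Proof.
move=> hS qS.
have /(_ (index_enum 'I_ell))[_ <-] : forall s, supported p (\sum_(k <- s) c k 0 *: S k) /\
    \prod_(k <- s) q 0 k ^ c k 0 = zmon p (\sum_(k <- s) c k 0 *: S k); last by [].
elim=> [|k s [h1 h2]]; first by rewrite !big_nil zmon0; split => //; apply: supported0.
have hk : supported p (c k 0 *: S k) by move=> l pl; rewrite mxE hS ?mulr0.
rewrite !big_cons; split; first exact: supportedD.
by rewrite zmonD // h2 qS zmonZ.
Qed.

Lemma sum_dcol ell (c : 'cV[int]_ell) : c = \sum_k c k 0 *: dcol k.
Proof.
apply/colP => k; rewrite summxE (bigD1 k) //= big1 ?addr0.
  by rewrite mxE dcolE eqxx mulr1.
by move=> l lk; rewrite mxE dcolE eq_sym (negbTE lk) mulr0.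
Qed.

Section Chart.
Variables (R : realType) (n r ell : nat) (Delta : set 'cV[R]_n)
  (A : 'M[int]_(r, n)) (b : 'cV[int]_r) (pts : 'I_ell -> 'cV[int]_n).
Hypothesis hpoly : lattice_polytope Delta.
Hypothesis hfacets : facet_description Delta A b.
Hypothesis hpts : enum_lattice_points Delta pts.
Hypothesis ell_gt0 : (0 < ell)%N.
Local Notation H := (hat_mx pts).
Local Notation HR := (map_mx intr H : 'M[R]_(1 + n, ell)).
Variables (N : nat) (Q : 'M[int]_(ell, 1 + n)) (ct : 'cV[int]_(1 + n)).
Hypothesis oddN : odd N.
Hypothesis HQ : H *m Q = (N%:Z)%:M.
Hypothesis ct_odd : forall i, ~~ (2 %| (row_mx b A *m ct) i ord0)%Z.

Lemma HF_full (F : numFieldType) : \rank (map_mx intr H : 'M[F]_(1 + n, ell)) = (1 + n)%N.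
Proof.
apply/eqP; rewrite eqn_leq rank_leq_row /=.
have := mxrankM_maxl (map_mx intr H : 'M[F]_(1 + n, ell)) (map_mx intr Q).
rewrite -map_mxM HQ map_scalar_mx mxrank_unit // unitmxE det_scalar unitfE.
by rewrite expf_neq0 // intr_eq0; case: N oddN.
Qed.

Definition orient_exp : 'cV[int]_ell := Q *m ct.

Lemma H_orient_exp : H *m orient_exp = N%:Z *: ct.
Proof. by rewrite mulmxA HQ mul_scalar_mx. Qed.

(** The arc s -> (s^nu_k P_k) passes through [p] at s = 0 and has no zero coordinate for other s. *)
Definition degeneration (p P : 'rV[R]_ell) (nu : 'I_ell -> nat) : Prop :=
  forall k, [/\ P 0 k != 0, p 0 k = 0 -> (0 < nu k)%N
    & p 0 k != 0 -> nu k = 0%N /\ P 0 k = p 0 k].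

(** The third clause is the parity statement: multiplied by the product of the chart coordinates,
    q^(Q ct) has the weight of a monomial with even exponents at the coordinates that vanish at p.
    The last clause yields density of the torus. *)
Theorem toric_chart p : smooth_pt pts p ->
  exists g : 'I_(1 + n) -> 'I_ell,
  [/\ forall v, tangent_cone H p v -> (forall i, v 0 (g i) = 0) -> v = 0,
      colsub g HR \in unitmx,
      exists e, H *m e = H *m (orient_exp + \sum_i dcol (g i)) /\
        forall k, p 0 k = 0 -> (2 %| e k ord0)%Z
    & exists P nu, degeneration p P nu /\ forall s : R, s != 0 ->
        binomial_locus H (\row_k (s ^+ nu k * P 0 k))].
Proof.
move=> [hp p1 [M [Mfree HM]]].
have [g [[ginj gu] g0 gJ gF]] := local_structure hp (HF_full _) Mfree HM.
set HJ := colsub g _ in gu gJ gF.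
pose phi j (u : 'cV[int]_(1 + n)) : R := (invmx HJ *m map_mx intr u) j 0.
have phiD j u w : phi j (u + w) = phi j u + phi j w.
  by rewrite /phi map_mxD mulmxDr mxE.
have phiZ j (z : int) u : phi j (z *: u) = z%:~R * phi j u.
  by rewrite /phi map_mxZ -scalemxAr mxE.
have phi_sum m j (F : 'I_m -> 'cV[int]_(1 + n)) :
    phi j (\sum_i F i) = \sum_i phi j (F i).
  by rewrite /phi raddf_sum mulmx_sumr summxE.
have phi_g j i : phi j (H *m dcol (g i)) = (j == i)%:R.
  rewrite /phi -colE map_col; have -> : col (g i) HR = col i HJ.
    by apply/colP => l; rewrite !mxE.
  by rewrite mulmx_col mulVmx // !mxE.
have phi_row j u : phi j u = (row j (invmx HJ) *m map_mx intr u) 0 0.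
  by rewrite -row_mul mxE.
have phi_col j k : phi j (H *m dcol k) = (row j (invmx HJ) *m HR) 0 k.
  by rewrite phi_row -colE map_col mulmx_col.
have [k0 pk0] : exists k0, p 0 k0 != 0.
  apply: contrapT => h; case: hp => /negP + _; apply; apply/eqP/rowP => k.
  by rewrite mxE; apply: contrapT => pk; apply: h; exists k; apply/eqP.
exists g; split => //.
- have [e He hek] := gJ (orient_exp + \sum_i dcol (g i)).
  exists e; split => // k pk.
  case: (pselect (exists j, g j = k)) => [[j gj]|nk]; last first.
    rewrite (proj2 (hek k pk)) ?dvdz0 // => j; apply/eqP => gj; apply: nk.
    by exists j.
  have pj : p 0 (g j) = 0 by rewrite gj.
  have ek := proj1 (hek k pk) j gj.
  have [x _ hx] := gJ orient_exp; have xk := proj1 (hx k pk) j gj.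
  (* The product of the chart coordinates contains x_k exactly once. *)
  have ex : e k 0 = x k 0 + 1.
    apply: (@intr_inj R); rewrite intrD -ek -xk -![LHS]/(phi _ _) mulmxDr mulmx_sumr.
    rewrite -/(phi j (H *m orient_exp)) phiD phi_sum; congr (_ + _).
    under eq_bigr do rewrite phi_g.
    by rewrite (bigD1 j) //= eqxx big1 ?addr0 // => i /negbTE; rewrite eq_sym => ->.
  have [i [w hw]] : exists i w, forall u : 'cV[int]_(1 + n),
      ((row_mx b A *m u) i 0)%:~R = w%:~R * phi j u.
    have [||i [w hw]] := facet_functional hpoly hfacets hpts (j := j) (k0 := k0) gu.
    + by move=> k'; rewrite -phi_col; apply: (proj2 (gF j pj k')).
    + by rewrite -phi_col; apply: (proj1 (gF j pj k0)).
    by exists i, w => u; rewrite hw phi_row.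
  (* Row i of [b : A] is w times [phi j], and the weight of q^(Q ct) is N ct. As N and row i of
     [b : A] ct are odd, so is the exponent [x k 0]. *)
  have : w * x k 0 = N%:Z * (row_mx b A *m ct) i 0.
    apply: (@intr_inj R); rewrite !intrM hw -xk -[X in _ * X = _]/(phi j (H *m orient_exp)).
    by rewrite H_orient_exp phiZ mulrCA.
  have := ct_odd i; rewrite ex; move: ((row_mx b A *m ct) i 0) => v.
  move: (x k 0) => y vodd wy.
  have : ~~ (2 %| y)%Z.
    apply/negP => y2; have : (2 %| (w * y)%R)%Z by apply: dvdz_mull.
    rewrite wy dvdzE abszM Euclid_dvdM // -!(dvdzE 2) (negbTE vodd) orbF dvdzE /=.
    by rewrite dvdn2 oddN.
  by lia.
have [D hD] : exists D : 'I_ell -> 'cV[int]_ell, forall k, H *m D k = H *m dcol k /\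
    forall l, p 0 l = 0 -> (forall j, g j = l -> phi j (H *m dcol k) = (D k l 0)%:~R) /\
      ((forall j, g j != l) -> D k l 0 = 0).
  have hD k := gJ (dcol k).
  have hD' k : exists d, H *m d = H *m dcol k /\
    forall l, p 0 l = 0 -> (forall j, g j = l -> phi j (H *m dcol k) = (d l 0)%:~R) /\
      ((forall j, g j != l) -> d l 0 = 0).
    by have [d h1 h2] := gJ (dcol k); exists d.
  by have [D ?] := choice hD'; exists D.
(* The exponents [D k] with those of the vanishing coordinates erased; their monomials at p give the
   coordinates of a torus point P. *)
pose S k : 'cV[int]_ell := \col_l (if p 0 l == 0 then 0 else D k l 0).
have Ssupp k : supported p (S k) by move=> l pl; rewrite mxE pl eqxx.
pose P : 'rV[R]_ell := \row_k zmon p (S k).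
have gout l : (exists j, g j = l) \/ (forall j, g j != l).
  case: (pselect (exists j, g j = l)) => [|h]; first by left.
  by right=> j; apply/eqP => gj; apply: h; exists j.
have D_ge0 k j : p 0 (g j) = 0 -> 0 <= D k (g j) 0.
  move=> pj; rewrite -(ler0z R) -(proj1 (proj2 (hD k) _ pj) j erefl).
  exact: (proj2 (gF j pj k)).
(* The one-parameter subgroup of the arc is the sum of the functionals [phi j] of the vanishing
   chart coordinates. *)
pose nu (k : 'I_ell) := (\sum_(j | p ord0 (g j) == 0%R) absz (D k (g j) ord0))%N.
have nuE k : (nu k)%:R = \sum_(j | p 0 (g j) == 0) phi j (H *m dcol k).
  rewrite natr_sum; apply: eq_bigr => j /eqP pj.
  by rewrite (proj1 (proj2 (hD k) _ pj) j erefl) -[in RHS](gez0_abs (D_ge0 k j pj)).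
have PS k : P 0 k = zmon p (S k) by rewrite mxE.
have P0 k : P 0 k != 0 by rewrite PS zmon_neq0.
have phiE j c : phi j (H *m c) = \sum_k (c k 0)%:~R * phi j (H *m dcol k).
  rewrite {1}(sum_dcol c) mulmx_sumr phi_sum.
  by apply: eq_bigr => k _; rewrite -scalemxAr phiZ.
have Dker k : H *m (D k - dcol k) = 0 by rewrite mulmxBr (proj1 (hD k)) subrr.
exists P, nu; split.
  move=> k; split => // pk.
    (* The terms of [nu k] are nonnegative. If all were 0, then [D k] would be supported, and
       [locus_face] would force [dcol k] to be supported too, although p_k = 0. *)
    rewrite lt0n; apply/negP => /eqP nu0.
    have : supported p (D k).
      move=> l pl; case: (gout l) => [[j gj]|]; last exact: (proj2 (proj2 (hD k) l pl)).
      have pj : p 0 (g j) = 0 by rewrite gj.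
      apply/eqP; rewrite -(intr_eq0 R) -(proj1 (proj2 (hD k) l pl) j gj).
      have := congr1 (fun x : nat => x%:R : R) nu0; rewrite nuE => /eqP.
      rewrite psumr_eq0 => [/allP/(_ j)|i /eqP pi]; last exact: (proj2 (gF i pi k)).
      by rewrite mem_index_enum pj eqxx => /(_ isT).
    move=> Ds; have /(_ k pk) : supported p (D k - dcol k + D k - D k); last first.
      by rewrite addrK !mxE (Ds k pk) !eqxx sub0r => /eqP; rewrite oppr_eq0 oner_eq0.
    rewrite addrK -[D k - _]opprK; apply: supportedN.
    apply: locus_face hp _ _; first by rewrite mulmxN Dker oppr0.
    move=> l pl; rewrite !mxE (Ds l pl) sub0r opprK andbT; exact: ler0n.
  have Ds : supported p (D k).
    move=> l pl; case: (gout l) => [[j gj]|]; last exact: (proj2 (proj2 (hD k) l pl)).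
    have pj : p 0 (g j) = 0 by rewrite gj.
    apply/eqP; rewrite -(intr_eq0 R) -(proj1 (proj2 (hD k) l pl) j gj).
    by apply/eqP/(proj1 (gF j pj k)).
  split.
    apply/eqP; rewrite -(pnatr_eq0 R) nuE big1 // => j /eqP pj.
    exact: (proj1 (gF j pj k)).
  rewrite PS (_ : S k = D k - dcol k + dcol k); last first.
    by rewrite subrK; apply/colP => l; rewrite mxE; case: eqP => // /Ds ->.
  rewrite zmonD ?zmon_dcol; last exact: supported_dcol.
    by rewrite (zmon_ker hp (Dker k)) ?mul1r //; apply/supportedB/supported_dcol.
  by apply/supportedB/supported_dcol.
move=> s s0; apply: torus_locus => // [k|c Hc].
  by rewrite mxE mulf_neq0 // expf_neq0.
have -> : zmon (\row_k (s ^+ nu k * P 0 k)) c = s ^ (\sum_k (nu k)%:Z * c k 0) * zmon P c.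
  rewrite (big_morph (fun z : int => s ^ z) (fun x y => expfzDr x y s0) (expr0z _)).
  rewrite -big_split; apply: eq_bigr => k _; rewrite mxE expfzMl; congr (_ * _).
  by rewrite exprnP exprz_exp.
(* The sum is the sum of the values [phi j (H *m c)], and [c] is in the kernel of [H]. *)
have -> : \sum_k (nu k)%:Z * c k 0 = 0.
  apply/eqP; rewrite -(intr_eq0 R) rmorph_sum /=; apply/eqP.
  under eq_bigr do rewrite intrM -pmulrn nuE mulr_suml.
  rewrite exchange_big big1 // => j _ /=.
  rewrite -[RHS](_ : phi j (H *m c) = 0); last by rewrite Hc /phi raddf0 mulmx0 mxE.
  by rewrite phiE; apply: eq_bigr => k _; rewrite mulrC.
rewrite expr0z mul1r (zmon_sum c Ssupp PS).
(* [E] is [E'] with the entries at vanishing coordinates erased. Those of [E'] are already 0, being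
   values of [phi j] at [H *m c]. *)
set E := \sum_k _; pose E' := \sum_k c k 0 *: D k.
have HE' : H *m E' = 0.
  rewrite -[RHS]Hc [in RHS](sum_dcol c) !mulmx_sumr; apply: eq_bigr => k _.
  by rewrite -!scalemxAr (proj1 (hD k)).
have Es : supported p E'.
  move=> l pl; rewrite summxE; case: (gout l) => [[j gj]|nl]; last first.
    by rewrite big1 // => k _; rewrite mxE (proj2 (proj2 (hD k) l pl)) ?mulr0.
  apply/eqP; rewrite -(intr_eq0 R) rmorph_sum /=; apply/eqP.
  rewrite -[RHS](_ : phi j (H *m c) = 0); last by rewrite Hc /phi raddf0 mulmx0 mxE.
  rewrite phiE; apply: eq_bigr => k _.
  by rewrite mxE intrM -(proj1 (proj2 (hD k) l pl) j gj).
suff -> : E = E' by apply: zmon_ker hp _ _.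
apply/colP => l; case: (eqVneq (p 0 l) 0) => pl.
  rewrite Es // summxE big1 // => k _; by rewrite !mxE pl eqxx mulr0.
by rewrite !summxE; apply: eq_bigr => k _; rewrite !mxE (negbTE pl).
Qed.

End Chart.

(** * The orientation of the torus *)

Definition dinv (F : fieldType) m (q : 'rV[F]_m) : 'M[F]_m :=
  diag_mx (\row_k (q 0 k)^-1).

Lemma diag_dinv (F : fieldType) m (q : 'rV[F]_m) : (forall k, q 0 k != 0) ->
  diag_mx q *m dinv q = 1%:M.
Proof.
move=> q0; rewrite mulmx_diag; apply/matrixP => i j; rewrite !mxE.
by case: eqP => // ->; rewrite divff.
Qed.

Lemma dinv_diag (F : fieldType) m (q : 'rV[F]_m) : (forall k, q 0 k != 0) ->
  dinv q *m diag_mx q = 1%:M.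
Proof.
move=> q0; rewrite mulmx_diag; apply/matrixP => i j; rewrite !mxE.
by case: eqP => // ->; rewrite mulVf.
Qed.

Section Torus.
Variables (R : realType) (n ell : nat) (pts : 'I_ell -> 'cV[int]_n).
Hypothesis ell_gt0 : (0 < ell)%N.
Local Notation H := (hat_mx pts).
Local Notation HR := (map_mx intr H : 'M[R]_(1 + n, ell)).
Variables (N : nat) (Q : 'M[int]_(ell, 1 + n)) (ct : 'cV[int]_(1 + n)).
Hypothesis oddN : odd N.
Hypothesis HQ : H *m Q = (N%:Z)%:M.
Local Notation QR := (map_mx intr Q : 'M[R]_(ell, 1 + n)).
Implicit Types q v : 'rV[R]_ell.

Lemma N_gt0 : 0 < (N%:R : R).
Proof. by rewrite ltr0n; case: N oddN. Qed.

(** The logarithmic derivative of the relation q^c = 1. *)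
Lemma tangent_ker q v c : binomial_locus H q -> tangent_cone H q v ->
  H *m c = 0 -> supported q c -> \sum_k (c k 0)%:~R * (v 0 k / q 0 k) = 0.
Proof.
move=> [_ hq] hv Hc hc; have [a [b [cE ab]]] := natcol_split c.
have sw : same_weight H a b by apply/eqP; rewrite -subr_eq0 -mulmxBr -cE Hc.
have c0 k : q 0 k = 0 -> a k = 0%N /\ b k = 0%N.
  by move=> qk; have [h1 h2] := ab k; split; [apply: h2|apply: h1]; rewrite hc.
have ha : supported q (natcol a) by move=> k /c0[ak _]; rewrite natcolE ak.
have hb : supported q (natcol b) by move=> k /c0[_ bk]; rewrite natcolE bk.
have := hv _ _ sw; rewrite !dmon_supported // (hq _ _ sw).
move/(mulfI (proj2 (mon_neq0 q b) hb))/eqP; rewrite -subr_eq0 -sumrB => /eqP e.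
rewrite -[RHS]e; apply: eq_bigr => k _.
by rewrite cE !mxE intrB !pmulrn mulrBl.
Qed.

Lemma torus_tangent q v : binomial_locus H q -> (forall k, q 0 k != 0) ->
  tangent_cone H q v ->
  v = (N%:R^-1 *: (v *m dinv q *m QR)) *m HR *m diag_mx q.
Proof.
move=> hq q0 hv; set u := v *m dinv q.
have uE k : u 0 k = v 0 k / q 0 k.
  by rewrite /u mul_mx_diag !mxE.
have uN : u *m QR *m HR = N%:R *: u.
  apply/rowP => k; rewrite -mulmxA -map_mxM.
  (* N e_k - Q H e_k is in the kernel of [H], so [tangent_ker] gives u Q H = N u. This makes the
     coordinates of v with respect to the weights explicit. *)
  have Hc : H *m ((N%:Z) *: dcol k - Q *m (H *m dcol k)) = 0.
    by rewrite mulmxBr (mulmxA H Q) HQ mul_scalar_mx -scalemxAr subrr.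
  have hc : supported q (N%:Z *: dcol k - Q *m (H *m dcol k)).
    by move=> l ql; have := q0 l; rewrite ql eqxx.
  have := tangent_ker hq hv Hc hc.
  have subE (x y : 'cV[int]_ell) l : (x - y) l 0 = x l 0 - y l 0 by rewrite !mxE.
  under eq_bigr do rewrite subE intrB mulrBl -uE.
  rewrite sumrB => /eqP; rewrite subr_eq0 => /eqP e.
  transitivity (\sum_l ((Q *m (H *m dcol k)) l 0)%:~R * u 0 l).
    rewrite mxE; apply: eq_bigr => l _; rewrite mulrC mulmxA -colE.
    by congr (_ * _); rewrite !mxE.
  rewrite -e (bigD1 k) //= big1 ?addr0 => [|l lk].
    by rewrite [RHS]mxE [X in X%:~R]mxE dcolE eqxx mulr1.
  by rewrite mxE dcolE (negbTE lk) mulr0 mul0r.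
rewrite -!scalemxAl uN -scalemxAl scalerA mulVf ?scale1r ?gt_eqF ?N_gt0 //.
by rewrite /u -mulmxA dinv_diag ?mulmx1.
Qed.

Lemma torus_tangent_rows q m (M : 'M[R]_(m, ell)) : binomial_locus H q ->
  (forall k, q 0 k != 0) -> (forall i, tangent_cone H q (row i M)) ->
  M = (N%:R^-1 *: (M *m dinv q *m QR)) *m HR *m diag_mx q.
Proof.
move=> hq q0 hM; apply/row_matrixP => i.
by rewrite !row_mul linearZ /= !row_mul -torus_tangent.
Qed.

Lemma torus_tangent_mul q m (X : 'M[R]_(m, 1 + n)) i : binomial_locus H q ->
  (forall k, q 0 k != 0) -> tangent_cone H q (row i (X *m HR *m diag_mx q)).
Proof.
move=> hq q0; have := orbital_tangent hq (row i X).
congr tangent_cone; apply/rowP => k; rewrite [LHS]mxE (negbTE (q0 k)) mxE.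
by rewrite -!row_mul mul_mx_diag !mxE mulrC.
Qed.

Lemma hat_row0 : (delta_mx 0 0 : 'rV_(1 + n)) *m HR = const_mx 1.
Proof.
rewrite -rowE; apply/rowP => k; rewrite !mxE.
by case: splitP => [j _|j e]; [rewrite mxE | case: j e].
Qed.

Lemma torus_smooth q : binomial_locus H q -> (forall k, q 0 k != 0) ->
  enorm q = 1 -> smooth_pt pts q.
Proof.
move=> hq q0 q1; split => //; exists (HR *m diag_mx q); split.
  rewrite /row_free mxrankMfree; first by rewrite (HF_full oddN HQ).
  rewrite row_free_unit unitmxE det_diag unitfE.
  by apply/prodf_neq0 => k _; apply: q0.
move=> v; split=> [hv|/submxP[x ->]].
  by rewrite (torus_tangent hq q0 hv) -mulmxA submxMl.
have := @torus_tangent_mul q _ x 0 hq q0.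
by rewrite -mulmxA (_ : row 0 _ = x *m (HR *m diag_mx q)) //; apply/rowP => k; rewrite mxE.
Qed.

Definition tau q (M : 'M[R]_(n, ell)) : R :=
  zmon q (orient_exp Q ct) * \det (col_mx q M *m dinv q *m QR : 'M[R]_(1 + n)).
Definition detJ (g : 'I_(1 + n) -> 'I_ell) q (M : 'M[R]_(n, ell)) : R :=
  \det (colsub g (col_mx q M : 'M[R]_(1 + n, ell))).

Lemma torus_radial q : (forall k, q 0 k != 0) ->
  q = (delta_mx 0 0 : 'rV_(1 + n)) *m HR *m diag_mx q.
Proof.
by move=> q0; apply/rowP => k; rewrite hat_row0 mul_mx_diag !mxE mul1r.
Qed.

Lemma detJ_torus q M g : binomial_locus H q -> (forall k, q 0 k != 0) ->
  (forall i, tangent_cone H q (row i M)) ->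
  detJ g q M = (N%:R^-1) ^+ (1 + n) *
    \det (col_mx q M *m dinv q *m QR : 'M[R]_(1 + n)) * \det (colsub g HR) *
    \prod_i q 0 (g i).
Proof.
move=> hq q0 hM.
have hqM i : tangent_cone H q (row i (col_mx q M : 'M[R]_(1 + n, ell))).
  rewrite -(fintype.splitK i); case: (fintype.split i) => j /=; last by rewrite rowKd.
  rewrite rowKu (_ : row j q = row 0 ((delta_mx 0 0 : 'rV_(1 + n)) *m HR *m diag_mx q)).
    exact: torus_tangent_mul.
  by rewrite -torus_radial // ord1.
rewrite /detJ {1}(torus_tangent_rows hq q0 hqM).
set X := _ *: _; have -> : colsub g (X *m HR *m diag_mx q) =
    X *m colsub g HR *m diag_mx (\row_i q 0 (g i)).
  apply/matrixP => i j; rewrite mxE !mul_mx_diag !mxE; congr (_ * _).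
  by apply: eq_bigr => l _; rewrite !mxE.
rewrite !det_mulmx det_diag detZ; congr (_ * _ * _).
by apply: eq_bigr => i _; rewrite mxE.
Qed.

Lemma zmon_chart q (d : 'cV[int]_ell) (g : 'I_(1 + n) -> 'I_ell) :
  (forall k, q 0 k != 0) ->
  zmon q (d + \sum_i dcol (g i)) = zmon q d * \prod_i q 0 (g i).
Proof.
move=> q0; have supp c : supported q c by move=> k qk; have := q0 k; rewrite qk eqxx.
rewrite zmonD //; congr (_ * _).
elim/big_rec2: _ => [|i x y _ <-]; first by rewrite zmon0.
by rewrite zmonD // zmon_dcol.
Qed.

(** By [detJ_torus], the product of tau, [detJ] and the constant determinant is a positive number
    times q^(Q ct) times the chart coordinates, that is, times q^e. The exponents e are even where p
    vanishes, and elsewhere q has the signs of p. *)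
Lemma tau_sign (p q : 'rV[R]_ell) (M : 'M[R]_(n, ell)) g (e : 'cV[int]_ell) :
  binomial_locus H q -> (forall k, q 0 k != 0) ->
  (forall i, tangent_cone H q (row i M)) -> detJ g q M != 0 ->
  colsub g HR \in unitmx ->
  H *m e = H *m (orient_exp Q ct + \sum_i dcol (g i)) ->
  (forall k, p 0 k = 0 -> (2 %| e k ord0)%Z) ->
  (forall k, p 0 k != 0 -> 0 < q 0 k * p 0 k) ->
  0 < tau q M * detJ g q M *
    (\prod_(k | p 0 k != 0) p 0 k ^ e k 0 * \det (colsub g HR)).
Proof.
move=> hq q0 hM dJ gu He e2 qp.
have supp c : supported q c by move=> k qk; have := q0 k; rewrite qk eqxx.
set D := \det (col_mx q M *m dinv q *m QR : 'M[R]_(1 + n)).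
have dJE := detJ_torus g hq q0 hM; rewrite -/D in dJE.
have D0 : D != 0 by apply: contraNneq dJ => D0; rewrite dJE D0 mulr0 !mul0r.
have h0 : \det (colsub g HR) != 0 by rewrite -unitfE -unitmxE.
have -> : tau q M * detJ g q M *
    (\prod_(k | p 0 k != 0) p 0 k ^ e k 0 * \det (colsub g HR)) =
  N%:R^-1 ^+ (1 + n) * (D * \det (colsub g HR)) ^+ 2 *
    (zmon q (orient_exp Q ct + \sum_i dcol (g i)) *
     \prod_(k | p 0 k != 0) p 0 k ^ e k 0).
  by rewrite dJE zmon_chart // /tau -/D; ring.
have -> : zmon q (orient_exp Q ct + \sum_i dcol (g i)) = zmon q e.
  have := zmon_ker hq (_ : H *m (e - (orient_exp Q ct + \sum_i dcol (g i))) = 0) (supp _).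
  rewrite zmonB // => h; rewrite -[RHS](divfK (zmon_neq0 (supp (orient_exp Q ct + \sum_i dcol (g i))))).
  by rewrite h ?mul1r // mulmxBr He subrr.
rewrite mulr_gt0 //.
  apply: mulr_gt0; first by apply: exprn_gt0; rewrite invr_gt0 N_gt0.
  by rewrite exprn_even_gt0 //= mulf_neq0.
rewrite /zmon (bigID (fun k => p 0 k != 0)) /= mulrAC -big_split /=.
apply: mulr_gt0; apply: prodr_gt0 => k pk.
  by rewrite -expfzMl exprz_gt0 // qp.
have /dvdzP[h ->] := e2 k (eqP (negbNE pk)).
by rewrite -exprz_exp -exprnP exprn_even_gt0 //= expfz_neq0.
Qed.

End Torus.

Lemma gram_unit (R : realFieldType) m k (L : 'M[R]_(m, k)) :
  row_free L -> \det (L *m L^T) != 0.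
Proof.
move=> Lf; rewrite -unitfE -unitmxE -row_free_unit; apply: inj_row_free => v hv.
have : (v *m L) *m (v *m L)^T = 0 by rewrite trmx_mul mulmxA -(mulmxA v) hv mul0mx.
apply: contra_eq => v0; set u := v *m L.
have u0 : u != 0 by apply: contra_neq v0 => u0; apply: (row_free_inj Lf); rewrite mul0mx.
have [i ui] : exists i, u 0 i != 0.
  apply: contrapT => h; move/negP: u0; apply; apply/eqP/rowP => i; rewrite [RHS]mxE.
  by apply: contrapT => ui; apply: h; exists i; apply/eqP.
apply/eqP => /matrixP/(_ 0 0); rewrite mxE [RHS]mxE => /eqP.
have sq j : u 0 j * u^T j 0 = u 0 j ^+ 2 by rewrite [X in _ * X]mxE.
under eq_bigr do rewrite sq.
rewrite psumr_eq0 => [/allP/(_ i (mem_index_enum _))|j _]; last exact: sqr_ge0.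
by rewrite /= sqrf_eq0 (negbTE ui).
Qed.

(** The product of the square matrices [L; W] and [L0^T, A] is block triangular because L A = 0. Its
    determinant compares det [L; W] with det (W A). *)
Lemma frame_det (R : realFieldType) s n (A : 'M[R]_(s + n, n))
    (L0 L : 'M[R]_(s, s + n)) (W : 'M[R]_(n, s + n)) (G : 'M[R]_s) :
  row_free L0 -> L0 *m A = 0 -> L = G *m L0 -> G \in unitmx -> \det (W *m A) != 0 ->
  0 < \det (col_mx L W) * \det (W *m A) * \det G *
      (\det (L0 *m L0^T) * \det (row_mx L0^T A)).
Proof.
move=> L0f L0A LG Gu WA.
have e : \det (col_mx L W) * \det (row_mx L0^T A) =
    \det G * \det (L0 *m L0^T) * \det (W *m A).
  rewrite -det_mulmx mul_col_row LG -(mulmxA G L0 A) L0A mulmx0 det_lblock.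
  by rewrite -mulmxA det_mulmx.
rewrite (_ : _ * _ = (\det (col_mx L W) * \det (row_mx L0^T A)) *
   (\det G * \det (L0 *m L0^T) * \det (W *m A))); last by ring.
rewrite e -expr2 exprn_even_gt0 //=.
by rewrite !mulf_neq0 ?gram_unit // -unitfE -unitmxE.
Qed.

Lemma delta_row0 (R : nzRingType) n :
  delta_mx 0 0 = row_mx 1%:M 0 :> 'rV[R]_(1 + n).
Proof.
apply/rowP => i; rewrite !mxE eqxx /=; case: splitP => j e; rewrite mxE.
  by rewrite (_ : i == 0) ?(ord1 j) //; apply/eqP/val_inj; rewrite /= e ord1.
by rewrite (_ : i == 0 = false) //; apply/eqP => i0; rewrite i0 in e.
Qed.

Section TorusParam.
Variables (R : realType) (n r ell : nat) (A : 'M[int]_(r, n)) (b : 'cV[int]_r)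
  (pts : 'I_ell -> 'cV[int]_n).
Hypothesis ell_gt0 : (0 < ell)%N.
Local Notation H := (hat_mx pts).
Local Notation HR := (map_mx intr H : 'M[R]_(1 + n, ell)).
Variables (N : nat) (Q : 'M[int]_(ell, 1 + n)) (ct : 'cV[int]_(1 + n)).
Hypothesis oddN : odd N.
Hypothesis HQ : H *m Q = (N%:Z)%:M.
Local Notation Bh := (row_mx b A).
Hypothesis ct_odd : forall i, ~~ (2 %| (Bh *m ct) i ord0)%Z.
Local Notation AR := (map_mx intr A : 'M[R]_(r, n)).
Local Notation BR := (map_mx intr Bh : 'M[R]_(r, 1 + n)).
Implicit Types z : 'rV[R]_r.

Lemma facet_exponent i k : (A *m pts k + b) i 0 = (Bh *m H) i k.
Proof.
rewrite -mulmx_col; have -> : col k H = col_mx 1%:M (pts k).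
  apply/colP => l; rewrite mxE mxE [in RHS]mxE.
  by case: splitP => j _; rewrite !mxE // (ord1 j) eqxx.
by rewrite mul_row_col mulmx1 addrC.
Qed.

Lemma gmap_neq0 z k : (forall i, z 0 i != 0) -> gmap A b pts z 0 k != 0.
Proof.
by move=> z0; rewrite mxE; apply/prodf_neq0 => i _; rewrite expfz_neq0.
Qed.

Lemma zmon_gmap z (c : 'cV[int]_ell) : (forall i, z 0 i != 0) ->
  zmon (gmap A b pts z) c = \prod_i z 0 i ^ (Bh *m (H *m c)) i 0.
Proof.
move=> z0; rewrite /zmon.
transitivity (\prod_k \prod_i z 0 i ^ ((Bh *m H) i k * c k 0)).
  apply: eq_bigr => k _; rewrite mxE.
  rewrite (big_morph (fun x : R => x ^ c k 0) (fun x y => expfzMl x y _) (exp1rz _ _)).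
  by apply: eq_bigr => i _; rewrite exprz_exp facet_exponent.
rewrite exchange_big; apply: eq_bigr => i _ /=.
rewrite mulmxA [in RHS]mxE (big_morph (fun x : int => z 0 i ^ x) (fun x y => expfzDr x y (z0 i)) (expr0z _)).
by [].
Qed.

Lemma zmon_scale (s : R) (q : 'rV[R]_ell) (c : 'cV[int]_ell) : s != 0 ->
  zmon (s *: q) c = s ^ (\sum_k c k 0) * zmon q c.
Proof.
move=> s0; rewrite (big_morph (fun x : int => s ^ x) (fun x y => expfzDr x y s0) (expr0z _)).
by rewrite -big_split; apply: eq_bigr => k _; rewrite mxE expfzMl.
Qed.

Lemma hat_ker_sum (c : 'cV[int]_ell) : H *m c = 0 -> \sum_k c k 0 = 0.
Proof.
rewrite hat_mx_mul => /(congr1 (@usubmx _ 1 n 1)); rewrite col_mxKu.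
by rewrite linear0 => /matrixP/(_ 0 0); rewrite !mxE.
Qed.

Lemma gmap_locus (s : R) z : s != 0 -> (forall i, z 0 i != 0) ->
  binomial_locus H (s *: gmap A b pts z).
Proof.
move=> s0 z0; apply: torus_locus => // [k|c Hc].
  by rewrite mxE mulf_neq0 // gmap_neq0.
rewrite zmon_scale // hat_ker_sum // expr0z mul1r zmon_gmap // Hc mulmx0.
by rewrite big1 // => i _; rewrite mxE.
Qed.

Lemma sum_orient_exp : \sum_k orient_exp Q ct k 0 = N%:Z * ct (lshift n ord0) 0.
Proof.
have := H_orient_exp ct HQ; rewrite hat_mx_mul => /(congr1 (@usubmx _ 1 n 1)).
by rewrite col_mxKu => /matrixP/(_ 0 0); rewrite !mxE.
Qed.

(** The term [t *m q] accounts for the normalization to the sphere. In the coordinates of [H] the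
    row q is (1, 0), so the matrix is block triangular and t does not enter the determinant. *)
Lemma tau_gmap (s : R) z (W : 'M[R]_(n, r)) (t : 'cV[R]_n) :
  s != 0 -> (forall i, z 0 i != 0) -> let q := s *: gmap A b pts z in
  let M := W *m dinv z *m BR *m HR *m diag_mx q + t *m q in
  tau Q ct q M = s ^ (N%:Z * ct (lshift n ord0) 0) *
    (\prod_i z 0 i ^ (Bh *m ct) i 0) ^+ N *
    (N%:R ^+ (1 + n) * \det (W *m dinv z *m AR)).
Proof.
move=> s0 z0 q M; have q0 k : q 0 k != 0 by rewrite mxE mulf_neq0 // gmap_neq0.
rewrite /tau zmon_scale // sum_orient_exp zmon_gmap // (H_orient_exp ct HQ).
congr (_ * _ * _).
  rewrite (big_morph (fun x : R => x ^+ N) (fun x y => exprMn _ x y) (expr1n _ _)).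
  apply: eq_bigr => i _; rewrite -scalemxAr mxE mulrC.
  by rewrite -exprz_exp -exprnP.
have -> : col_mx q M = col_mx (row_mx 1%:M 0)
    (row_mx (W *m dinv z *m map_mx intr b + t) (W *m dinv z *m AR)) *m HR *m diag_mx q.
  rewrite !mul_col_mx; congr col_mx.
    by rewrite {1}(torus_radial pts q0) delta_row0.
  have -> : row_mx (W *m dinv z *m map_mx intr b + t) (W *m dinv z *m AR) =
      W *m dinv z *m BR + t *m row_mx 1%:M 0.
    by rewrite map_row_mx !mul_mx_row mulmx1 mulmx0 add_row_mx addr0.
  rewrite !mulmxDl /M; congr (_ + _); rewrite -!mulmxA; congr (t *m _).
  by rewrite {1}(torus_radial pts q0) delta_row0 !mulmxA.
rewrite -!mulmxA (mulmxA (diag_mx q)) diag_dinv // mul1mx.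
rewrite -map_mxM HQ map_scalar_mx mul_mx_scalar detZ.
by congr (_ * _); rewrite det_lblock det1 mul1r.
Qed.

(** As N and the entries of [b : A] ct are odd, the monomial in z has the sign of the product of the
    z_i. A negative [s] is harmless when its exponent N ct_0 is even. *)
Lemma tau_gmap_sign (s : R) z (W : 'M[R]_(n, r)) (t : 'cV[R]_n) :
  s != 0 -> (0 < s \/ (2 %| ct (lshift n ord0) ord0)%Z) ->
  (forall i, z 0 i != 0) -> \det (W *m dinv z *m AR) != 0 ->
  let q := s *: gmap A b pts z in
  let M := W *m dinv z *m BR *m HR *m diag_mx q + t *m q in
  0 < tau Q ct q M * \prod_i z 0 i * \det (W *m dinv z *m AR).
Proof.
move=> s0 hs z0 D0; rewrite /= tau_gmap //.
set x := \prod_i z 0 i ^ _; set y := \prod_i z 0 i; set D := \det _ in D0 *.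
have xy : 0 < x * y.
  rewrite /x /y -big_split; apply: prodr_gt0 => i _ /=.
  rewrite -[z 0 i in X in _ * X]expr1z -expfzDr //.
  have /dvdzP[h ->] : (2 %| ((Bh *m ct) i ord0 + 1)%R)%Z.
    by have := ct_odd i; lia.
  by rewrite -exprz_exp -exprnP exprn_even_gt0 //= expfz_neq0.
have x0 : x != 0 by apply: contraTneq xy => ->; rewrite mul0r ltxx.
have xN : 0 < x ^+ N * y.
  have : 0 < (x * y) * x ^+ N.+1.
    by rewrite mulr_gt0 // exprn_even_gt0 //= oddN.
  have -> : (x * y) * x ^+ N.+1 = x ^+ 2 * (x ^+ N * y) by rewrite exprS; ring.
  by rewrite pmulr_rgt0 // exprn_even_gt0.
have sN : 0 < s ^ (N%:Z * ct (lshift n ord0) 0).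
  case: hs => [s_gt0|/dvdzP[h ->]]; first by rewrite exprz_gt0.
  by rewrite mulrA -exprz_exp -exprnP exprn_even_gt0 //= expfz_neq0.
rewrite (_ : _ * y * D = s ^ (N%:Z * ct (lshift n ord0) 0) * N%:R ^+ (1 + n) * (x ^+ N * y) * D ^+ 2).
  apply: mulr_gt0; last by rewrite exprn_even_gt0.
  by do 2![apply: mulr_gt0 => //]; apply: exprn_gt0; apply: N_gt0 oddN.
by ring.
Qed.

End TorusParam.

(** * Tangent spaces of the sphere *)

Section Sphere.
Variables (R : realType) (n ell : nat) (pts : 'I_ell -> 'cV[int]_n).
Hypothesis ell_gt0 : (0 < ell)%N.
Local Notation H := (hat_mx pts).
Implicit Types q v : 'rV[R]_ell.

(** Euler's identity: [H] has a row of ones, so its binomials are homogeneous. *)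
Lemma euler_tangent q : binomial_locus H q -> tangent_cone H q q.
Proof.
move=> [_ hq] a b sw; have dE c : dmon q q c = (\sum_k c k)%N%:R * mon q c.
  rewrite /dmon natr_sum mulr_suml; apply: eq_bigr => k _.
  rewrite -mulrA; case: (posnP (c k)) => [->|ck]; first by rewrite !mul0r.
  congr (_ * _); rewrite [RHS](bigD1 k) //= (bigD1 k) //= eqxx mulrA -exprS.
  rewrite subn1 prednK //; congr (_ * _); apply: eq_bigr => i /negbTE ->.
  by rewrite subn0.
by rewrite !dE (hq _ _ sw) (proj1 (proj1 (same_weight_hat pts a b) sw)).
Qed.

Lemma enorm_dot q : enorm q = 1 -> q *m q^T = 1%:M.
Proof.
move=> q1; apply/matrixP => i j; rewrite !ord1 mxE [RHS]mxE eqxx.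
rewrite -[RHS](expr1n _ 2) -q1 /enorm sqr_sqrtr ?sumr_ge0 // => [|k _]; last exact: sqr_ge0.
by apply: eq_bigr => k _; rewrite mxE expr2.
Qed.

Lemma sphere_tangentE q v : Yplus_tangent pts q v <->
  tangent_cone H q v /\ v *m q^T = 0.
Proof.
rewrite (Yplus_tangentE pts ell_gt0); split=> -[hv e]; split => //.
  apply/matrixP => i j; rewrite !ord1 [RHS]mxE -[RHS]e mxE.
  by apply: eq_bigr => k _; rewrite mxE mulrC.
have /matrixP/(_ 0 0) := e; rewrite [RHS]mxE => e'; rewrite -[RHS]e' mxE.
by apply: eq_bigr => k _; rewrite mxE mulrC.
Qed.

Lemma tangent_comb q m (M : 'M[R]_(m, ell)) (x : 'rV[R]_m) :
  (forall i, tangent_cone H q (row i M)) -> tangent_cone H q (x *m M).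
Proof.
move=> hM.
move=> a b sw; move: a b sw; change (tangent_cone H q (x *m M)).
move: (submxMl x M); move: (x *m M).
apply: row_comb => //; first exact: tangent_cone0.
by move=> *; apply: tangent_cone_linear.
Qed.

Definition chart_at (g : 'I_(1 + n) -> 'I_ell) q : Prop :=
  forall v, tangent_cone H q v -> (forall i, v 0 (g i) = 0) -> v = 0.

Lemma frame_rows q m (M : 'M[R]_(m, ell)) i :
  is_frame (Yplus_tangent pts q) M -> Yplus_tangent pts q (row i M).
Proof. by move=> [_ h]; apply/h/row_sub. Qed.

Lemma frame_detJ g q (M : 'M[R]_(n, ell)) : smooth_pt pts q -> chart_at g q ->
  is_frame (Yplus_tangent pts q) M -> detJ g q M != 0.
Proof.
move=> [hq q1 _] hg MF; rewrite -unitfE -unitmxE -row_free_unit.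
apply: inj_row_free => y hy.
have Mq : M *m q^T = 0.
  apply/row_matrixP => i; rewrite row_mul row0.
  by have /sphere_tangentE[] := frame_rows i MF.
have w0 : y *m col_mx q M = 0.
  apply: hg.
    apply: tangent_comb => i; rewrite -(fintype.splitK i); case: (fintype.split i) => j /=.
      rewrite rowKu (_ : row j q = q); first exact: euler_tangent.
      by apply/rowP => k; rewrite mxE ord1.
    by rewrite rowKd; have /sphere_tangentE[] := frame_rows j MF.
  move=> i; have /rowP/(_ i) := hy; rewrite [RHS]mxE => <-.
  by rewrite !mxE; apply: eq_bigr => k _; rewrite !mxE.
move: w0; rewrite -[y]hsubmxK mul_row_col => e.
have y0 : lsubmx y = 0.
  have := congr1 (mulmxr q^T) e; rewrite /= mulmxDl -!mulmxA Mq mulmx0 addr0.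
  by rewrite enorm_dot // mulmx1 mul0mx.
move: e; rewrite y0 mul0mx add0r => e.
suff -> : rsubmx y = 0 by rewrite row_mx0.
by case: MF => Mf _; apply: (row_free_inj Mf); rewrite mul0mx.
Qed.

(** With q, the rows of M are n + 1 independent vectors in a tangent cone of dimension n + 1, hence
    a basis; orthogonality to q then isolates M. *)
Lemma detJ_frame g q (M : 'M[R]_(n, ell)) : smooth_pt pts q ->
  detJ g q M != 0 -> (forall i, Yplus_tangent pts q (row i M)) ->
  is_frame (Yplus_tangent pts q) M.
Proof.
move=> [hq q1 [T [Tf hT]]] dJ MT.
have CMf : row_free (col_mx q M : 'M[R]_(1 + n, ell)).
  by apply: (@colsub_unit_free _ _ _ g); rewrite unitmxE unitfE.
have Mq : M *m q^T = 0.
  apply/row_matrixP => i; rewrite row_mul row0.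
  by have /sphere_tangentE[] := MT i.
have CMT : (col_mx q M :=: T)%MS.
  have sub : (col_mx q M <= T)%MS.
    rewrite col_mx_sub; apply/andP; split; first by apply/hT/euler_tangent.
    by apply/row_subP => i; apply/hT; have /sphere_tangentE[] := MT i.
  apply/eqmxP; rewrite sub /=.
  have := mxrank_leqif_sup sub; rewrite (eqP Tf) (eqP CMf).
  by move=> /leqifP; case: ifP => // _; rewrite ltnn.
split.
  apply: inj_row_free => x hx; have : row_mx 0 x *m col_mx q M = 0.
    by rewrite mul_row_col mul0mx add0r.
  rewrite -[RHS](mul0mx _ (col_mx q M)) => /(row_free_inj CMf) e.
  by rewrite -[x](@row_mxKr _ _ 1 n 0) e linear0.
move=> v; split=> [/sphere_tangentE[/hT vT vq]|/submxP[x ->]].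
  have /submxP[y vE] : (v <= col_mx q M)%MS by rewrite CMT.
  rewrite -[y]hsubmxK mul_row_col in vE.
  have y0 : lsubmx y = 0.
    move: vq; rewrite vE mulmxDl -!mulmxA Mq mulmx0 addr0.
    by rewrite enorm_dot // mulmx1.
  by rewrite vE y0 mul0mx add0r submxMl.
apply/sphere_tangentE; split; last by rewrite -mulmxA Mq mulmx0.
by apply: tangent_comb => i; have /sphere_tangentE[] := MT i.
Qed.

End Sphere.

(** * Continuity of matrix expressions *)

Section Continuity.
Variables (T : topologicalType) (R : realType) (x : T).

Lemma cts_cst (V : topologicalType) (c : V) : {for x, continuous (fun _ : T => c)}.
Proof. exact: cvg_cst. Qed.

Lemma cts_eq (f g : T -> R) : f =1 g ->
  {for x, continuous f} -> {for x, continuous g}.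
Proof. by move/funext ->. Qed.

Lemma cts_sum I (r : seq I) (P : pred I) (F : I -> T -> R) :
  (forall i, {for x, continuous (F i)}) ->
  {for x, continuous (fun y => \sum_(i <- r | P i) F i y)}.
Proof. by move=> hF; apply: cvg_big => [|i _]; [exact: add_continuous | exact: hF]. Qed.

Lemma cts_prod I (r : seq I) (P : pred I) (F : I -> T -> R) :
  (forall i, {for x, continuous (F i)}) ->
  {for x, continuous (fun y => \prod_(i <- r | P i) F i y)}.
Proof. by move=> hF; apply: cvg_big => [|i _]; [exact: mul_continuous | exact: hF]. Qed.

Lemma cts_add (f g : T -> R) : {for x, continuous f} -> {for x, continuous g} ->
  {for x, continuous (fun y => f y + g y)}.
Proof. by move=> hf hg; apply: cvgD. Qed.

Lemma cts_sub (f g : T -> R) : {for x, continuous f} -> {for x, continuous g} ->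
  {for x, continuous (fun y => f y - g y)}.
Proof. by move=> hf hg; apply: cvgB. Qed.

Lemma cts_mul (f g : T -> R) : {for x, continuous f} -> {for x, continuous g} ->
  {for x, continuous (fun y => f y * g y)}.
Proof. by move=> hf hg; apply: cvgM. Qed.

Lemma cts_exp (f : T -> R) k : {for x, continuous f} ->
  {for x, continuous (fun y => f y ^+ k)}.
Proof.
move=> hf; elim: k => [|k IH].
  by apply: (cts_eq (f := fun=> 1)) => [y|]; [rewrite expr0 | apply: cts_cst].
by apply: (cts_eq (f := fun y => f y * f y ^+ k)) => [y|]; [rewrite exprS | apply: cts_mul].
Qed.

Lemma cts_inv (f : T -> R) : {for x, continuous f} -> f x != 0 ->
  {for x, continuous (fun y => (f y)^-1)}.
Proof. by move=> hf f0; apply: cvgV. Qed.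

Lemma cts_mx m n (f : T -> 'M[R]_(m, n)) :
  (forall i j, {for x, continuous (fun y => f y i j)}) -> {for x, continuous f}.
Proof.
move=> hf A [P hP sPA]; have h : \forall y \near x, forall i j, P i j (f y i j).
  apply: filter_forall => i; apply: filter_forall => j.
  exact: (hf i j _ (hP i j)).
by apply: filterS h => y hy; apply: sPA.
Qed.

Lemma cts_entry m n (f : T -> 'M[R]_(m, n)) i j : {for x, continuous f} ->
  {for x, continuous (fun y => f y i j)}.
Proof.
move=> hf.
exact: (@continuous_comp _ _ _ f (fun M : 'M[R]_(m, n) => M i j) x hf (@coord_continuous _ _ _ i j (f x))).
Qed.

Lemma cts_mulmx m n p (f : T -> 'M[R]_(m, n)) (g : T -> 'M[R]_(n, p)) :
  {for x, continuous f} -> {for x, continuous g} ->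
  {for x, continuous (fun y => f y *m g y)}.
Proof.
move=> hf hg; apply: cts_mx => i j.
apply: (cts_eq (f := fun y => \sum_k f y i k * g y k j)) => [y|]; first by rewrite mxE.
by apply: cts_sum => k; apply: cts_mul; apply: cts_entry.
Qed.

Lemma cts_det n (f : T -> 'M[R]_n) : {for x, continuous f} ->
  {for x, continuous (fun y => \det (f y))}.
Proof.
move=> hf; apply: cts_sum => s; apply: cts_mul; first exact: cts_cst.
by apply: cts_prod => i; apply: cts_entry.
Qed.

Lemma cts_adj n (f : T -> 'M[R]_n) : {for x, continuous f} ->
  {for x, continuous (fun y => \adj (f y))}.
Proof.
move=> hf; apply: cts_mx => i j.
apply: (cts_eq (f := fun y => cofactor (f y) j i)) => [y|]; first by rewrite mxE.
apply: cts_mul; first exact: cts_cst; apply: cts_det.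
apply: cts_mx => k l; apply: (cts_eq (f := fun y => f y (lift j k) (lift i l))).
  by move=> y; rewrite !mxE.
exact: cts_entry.
Qed.

Lemma cts_gt0 (f : T -> R) : {for x, continuous f} -> 0 < f x ->
  \forall y \near x, 0 < f y.
Proof. move=> hf f0; exact: (hf _ (lt_nbhsr f0)). Qed.

Lemma cts_neq0 (f : T -> R) : {for x, continuous f} -> f x != 0 ->
  \forall y \near x, f y != 0.
Proof.
move=> hf f0; have : \forall y \near x, 0 < f y ^+ 2.
  by apply: cts_gt0; [exact: cts_exp | rewrite exprn_even_gt0].
by apply: filterS => y; apply: contraTneq => ->; rewrite expr0n ltxx.
Qed.

End Continuity.

(** * Continuous frames near a smooth point *)

Section Neighborhood.
Variables (R : realType) (n ell : nat) (pts : 'I_ell -> 'cV[int]_n).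
Hypothesis ell_gt0 : (0 < ell)%N.
Local Notation H := (hat_mx pts).
Implicit Types q v : 'rV[R]_ell.

Lemma dmon_rows q v a : dmon q v a = \sum_k v 0 k * dmon q (delta_mx 0 k) a.
Proof.
have {1}-> : v = \sum_k v 0 k *: delta_mx 0 k by exact: row_sum_delta.
have dD u w : dmon q (u + w) a = dmon q u a + dmon q w a.
  by rewrite -[u]scale1r dmon_linear mul1r scale1r.
have d0 : dmon q 0 a = 0.
  by rewrite /dmon big1 // => k _; rewrite mxE mulr0 mul0r.
elim/big_rec2: _ => [//|k x y _ <-].
by rewrite dmon_linear.
Qed.

Lemma cts_dmon v a q : {for q, continuous (fun q : 'rV[R]_ell => dmon q v a)}.
Proof.
apply: cts_sum => k; apply: cts_mul; first exact: cts_cst.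
by apply: cts_prod => i; apply: cts_exp; apply: cts_entry; apply: cvg_id.
Qed.

Lemma cts_detJ g (E : 'rV[R]_ell -> 'M[R]_(n, ell)) q : {for q, continuous E} ->
  {for q, continuous (fun q => detJ g q (E q))}.
Proof.
move=> hE; apply: cts_det; apply: cts_mx => i j.
rewrite -(fintype.splitK i); case: (fintype.split i) => k /=.
  apply: (cts_eq (f := fun y : 'rV[R]_ell => y k (g j))) => [y|].
    by rewrite mxE col_mxEu.
  by apply: cts_entry; apply: cvg_id.
apply: (cts_eq (f := fun y : 'rV[R]_ell => E y k (g j))) => [y|].
  by rewrite mxE col_mxEd.
exact: cts_entry.
Qed.

(** The tangent cone is the orthogonal sum of the line of q and the tangent space of the sphere
    part. *)
Lemma sphere_has_dim q : smooth_pt pts q -> has_dim (Yplus_tangent pts q) n.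
Proof.
move=> [hq q1 hd]; have [d [M [Mf HM]]] : exists d, has_dim (Yplus_tangent pts q) d.
  apply: subspace_has_dim.
    by apply/(sphere_tangentE pts ell_gt0); split; [exact: tangent_cone0 | rewrite mul0mx].
  move=> a u v /(sphere_tangentE pts ell_gt0)[hu uq] /(sphere_tangentE pts ell_gt0)[hv vq].
  apply/(sphere_tangentE pts ell_gt0); split; first exact: tangent_cone_linear.
  by rewrite mulmxDl -scalemxAl uq vq scaler0 addr0.
have MT i : tangent_cone H q (row i M) /\ row i M *m q^T = 0.
  by apply/(sphere_tangentE pts ell_gt0)/HM/row_sub.
have Mq : M *m q^T = 0.
  by apply/row_matrixP => i; rewrite row_mul row0; case: (MT i).
suff : has_dim (tangent_cone H q) (1 + d).
  move/(has_dim_uniq hd) => -[nd].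
  have : has_dim (Yplus_tangent pts q) d by exists M.
  have {}nd : d = n by rewrite nd.
  by rewrite nd.
exists (col_mx q M); split.
  apply: inj_row_free => y; rewrite -[y]hsubmxK mul_row_col => e.
  have y0 : lsubmx y = 0.
    have := congr1 (mulmxr q^T) e; rewrite /= mulmxDl -!mulmxA Mq mulmx0 addr0.
    by rewrite enorm_dot // mulmx1 mul0mx.
  move: e; rewrite y0 mul0mx add0r => e.
  suff -> : rsubmx y = 0 by rewrite row_mx0.
  by apply: (row_free_inj Mf); rewrite mul0mx.
move=> v; split=> [hv|].
  have /HM/submxP[x xE] : Yplus_tangent pts q (- (v *m q^T) 0 0 *: q + v).
    apply/(sphere_tangentE pts ell_gt0); split.
      by apply: tangent_cone_linear => //; apply: euler_tangent.
    rewrite mulmxDl -scalemxAl enorm_dot // scaleNr scalemx1 addrC.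
    by apply/eqP; rewrite subr_eq0; apply/eqP/mx11_scalar.
  have -> : v = row_mx ((v *m q^T) 0 0)%:M x *m col_mx q M.
    by rewrite mul_row_col mul_scalar_mx -xE scaleNr addrA subrr add0r.
  exact: submxMl.
move=> /submxP[x ->]; apply: tangent_comb => i.
rewrite -(fintype.splitK i); case: (fintype.split i) => k /=.
  rewrite rowKu (_ : row k q = q); first exact: euler_tangent.
  by apply/rowP => l; rewrite mxE ord1.
by rewrite rowKd; case: (MT k).
Qed.

(** Only the tangent spaces are parametrized, not the points. Chart coordinates and gradients of
    finitely many binomials form an invertible matrix [C p], so [C q] is invertible nearby, and a
    tangent vector at q is recovered continuously from its chart coordinates. *)
Theorem chart_neighborhood p (g : 'I_(1 + n) -> 'I_ell) :
  smooth_pt pts p -> injective g -> chart_at pts g p ->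
  exists (U : set 'rV[R]_ell) (E : 'rV[R]_ell -> 'M[R]_(n, ell)),
    [/\ nbhs p U, forall q, U q -> {for q, continuous E}
      & forall q, U q -> smooth_pt pts q ->
        [/\ chart_at pts g q, is_frame (Yplus_tangent pts q) (E q)
          & 0 < detJ g q (E q) * detJ g p (E p)]].
Proof.
move=> sp ginj gp.
pose grad (ab : ('I_ell -> nat) * ('I_ell -> nat)) q : 'rV[R]_ell :=
  \row_k (dmon q (delta_mx 0 k) ab.1 - dmon q (delta_mx 0 k) ab.2).
have gradE ab q v : (v *m (grad ab q)^T) 0 0 = dmon q v ab.1 - dmon q v ab.2.
  rewrite mxE (dmon_rows q v ab.1) (dmon_rows q v ab.2) -sumrB.
  by apply: eq_bigr => k _; rewrite !mxE mulrBr.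
(* The columns are coordinates of the chart, or gradients of binomial
   equations. *)
pose S (s : 'rV[R]_ell) := (exists i, s = delta_mx 0 (g i)) \/
  exists ab, same_weight H ab.1 ab.2 /\ s = grad ab p.
have [r [Mx [Mf MS hS]]] := max_free_rows S.
have rE : r = ell.
  rewrite -(eqP Mf) -mxrank_tr; apply/eqP/inj_row_free => v hv.
  have vs s : S s -> (v *m s^T) 0 0 = 0.
    move=> /hS/submxP[x ->]; rewrite trmx_mul mulmxA hv mul0mx mxE; by [].
  apply: gp => [a b sw|j].
    have := vs (grad (a, b) p) (or_intror (ex_intro _ (a, b) (conj sw erefl))).
    by rewrite gradE => /eqP; rewrite subr_eq0 => /eqP.
  have := vs _ (or_introl (ex_intro _ j erefl)).
  rewrite mxE (bigD1 (g j)) //= big1 ?addr0 => [|k kj].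
    by rewrite !mxE !eqxx mulr1.
  by rewrite !mxE (negbTE kj) andbF mulr0.
subst r.
have [lab hlab] : exists lab : 'I_ell -> 'I_(1 + n) + (('I_ell -> nat) * ('I_ell -> nat)),
    forall i, match lab i with inl j => row i Mx = delta_mx 0 (g j)
      | inr ab => same_weight H ab.1 ab.2 /\ row i Mx = grad ab p end.
  have hlab i : exists l : 'I_(1 + n) + (('I_ell -> nat) * ('I_ell -> nat)),
      match l with inl j => row i Mx = delta_mx 0 (g j)
      | inr ab => same_weight H ab.1 ab.2 /\ row i Mx = grad ab p end.
    by case: (MS i) => [[j e]|[ab e]]; [exists (inl j)|exists (inr ab)].
  by have [lab ?] := choice hlab; exists lab.
pose C q : 'M[R]_ell := \matrix_(k, i)
  match lab i with inl j => (k == g j)%:R | inr ab => grad ab q 0 k end.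
pose D : 'M[R]_ell := \matrix_(k, i)
  match lab i with inl j => (k == g j)%:R | inr _ => 0 end.
have Cp : C p = Mx^T.
  apply/matrixP => k i; rewrite !mxE; have := hlab i.
  case: (lab i) => [j|ab] => [/rowP/(_ k)|[_ /rowP/(_ k)]]; rewrite !mxE => -> //.
have Cp0 : \det (C p) != 0.
  by rewrite Cp det_tr -unitfE -unitmxE -row_free_unit.
(* On a tangent vector the gradient columns give 0, and the remaining columns read chart
   coordinates. *)
have tC q v : tangent_cone H q v -> v *m C q = v *m D.
  move=> hv; apply/rowP => i; have := hlab i.
  case e : (lab i) => [j|ab] => [_|[sw _]].
    rewrite !mxE; apply: eq_bigr => k _; by rewrite !mxE e.
  rewrite [RHS]mxE [RHS]big1 => [|k _]; last by rewrite mxE e mulr0.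
  rewrite -[RHS](subrr (dmon q v ab.2)) -{1}(hv _ _ sw) -gradE !mxE.
  by apply: eq_bigr => k _; rewrite !mxE e mxE.
have vD (v w : 'rV[R]_ell) : (forall i, v 0 (g i) = w 0 (g i)) -> v *m D = w *m D.
  move=> vw; apply/rowP => i; rewrite !mxE.
  case e : (lab i) => [j|ab]; last first.
    by rewrite !big1 // => k _; rewrite mxE e mulr0.
  rewrite (bigD1 (g j)) //= [in RHS](bigD1 (g j)) //= vw; congr (_ + _).
  by rewrite !big1 // => k /negbTE kj; rewrite mxE e kj mulr0.
pose Ci q := (\det (C q))^-1 *: \adj (C q).
have CCi q : \det (C q) != 0 -> C q *m Ci q = 1%:M.
  by move=> d0; rewrite -scalemxAr mul_mx_adj scale_scalar_mx mulVf.
have chart q : \det (C q) != 0 -> chart_at pts g q.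
  move=> d0 v hv v0; have : v *m C q = 0.
    by rewrite tC // (vD v 0) ?mul0mx // => i; rewrite v0 mxE.
  by move/(congr1 (mulmxr (Ci q))); rewrite /= -mulmxA CCi // mulmx1 mul0mx.
pose G : 'M[R]_(1 + n, ell) := \matrix_(i, k) (k == g i)%:R.
(* The vector [y *m Th q] is the candidate for the tangent vector at q with chart coordinates y. *)
pose Th q := G *m D *m Ci q.
have GE (y : 'rV[R]_(1 + n)) i : (y *m G) 0 (g i) = y 0 i.
  rewrite mxE (bigD1 i) //= mxE eqxx mulr1 big1 ?addr0 // => l li.
  by rewrite mxE (inj_eq ginj) eq_sym (negbTE li) mulr0.
have ThE q v : \det (C q) != 0 -> tangent_cone H q v ->
    v = (\row_i v 0 (g i)) *m Th q.
  move=> d0 hv; rewrite !mulmxA -(vD v) => [|i]; last by rewrite GE mxE.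
  by rewrite -(tC q v hv) -mulmxA CCi // mulmx1.
(* At a smooth q the tangent cone has dimension n + 1, so every y is realized by a tangent
   vector. *)
have Tht q y : smooth_pt pts q -> \det (C q) != 0 -> tangent_cone H q (y *m Th q).
  move=> [hq q1 [T [Tf hT]]] d0.
  have Tt i : tangent_cone H q (row i T) by apply/hT/row_sub.
  have Tu : colsub g T \in unitmx.
    rewrite -row_free_unit; apply: inj_row_free => x hx.
    apply: (row_free_inj Tf); rewrite mul0mx; apply: (chart q d0).
      exact: tangent_comb.
    move=> i; have /rowP/(_ i) := hx; rewrite [RHS]mxE => <-.
    by rewrite !mxE; apply: eq_bigr => k _; rewrite mxE.
  pose v := (y *m invmx (colsub g T)) *m T.
  have hv : tangent_cone H q v by apply: tangent_comb.
  suff -> : y *m Th q = v by [].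
  rewrite [RHS](ThE _ _ d0 hv); congr (_ *m _); apply/rowP => i.
  have : v *m (\matrix_(k, i) (k == g i)%:R) = y.
    rewrite /v -mulmxA (_ : T *m _ = colsub g T) ?mulmxKV //.
    apply/matrixP => k l; rewrite !mxE (bigD1 (g l)) //= mxE eqxx mulr1 big1 ?addr0 //.
    by move=> m /negbTE ml; rewrite mxE ml mulr0.
  move/rowP/(_ i) => <-; rewrite [RHS]mxE mxE (bigD1 (g i)) //= mxE eqxx mulr1 big1 ?addr0 //.
  by move=> m /negbTE ml; rewrite mxE ml mulr0.
have [M0 M0F] := sphere_has_dim sp.
(* The frame at p is carried to q with fixed chart coordinates, then projected orthogonally to q. *)
pose Z q := colsub g M0 *m Th q; pose E q := Z q - Z q *m q^T *m q.
have Ep : E p = M0.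
  have Zp : Z p = M0.
    apply/row_matrixP => i; rewrite row_mul.
    have /(sphere_tangentE pts ell_gt0)[hi _] := frame_rows i M0F.
    rewrite [RHS](ThE _ _ Cp0 hi); congr (_ *m _).
    by apply/rowP => l; rewrite !mxE.
  have M0p : M0 *m p^T = 0.
    apply/row_matrixP => i; rewrite row_mul row0.
    by have /(sphere_tangentE pts ell_gt0)[] := frame_rows i M0F.
  by rewrite /E Zp M0p mul0mx subr0.
have ctsC q : {for q, continuous C}.
  apply: cts_mx => k i; case e : (lab i) => [j|ab].
    by apply: (cts_eq (f := fun=> (k == g j)%:R)) => [y|]; [rewrite mxE e | apply: cts_cst].
  apply: (cts_eq (f := fun y : 'rV[R]_ell => dmon y (delta_mx 0 k) ab.1 - dmon y (delta_mx 0 k) ab.2)).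
    by move=> y; rewrite !mxE e mxE.
  by apply: cts_sub; apply: cts_dmon.
have ctsTh q : \det (C q) != 0 -> {for q, continuous Th}.
  move=> d0; apply: cts_mulmx; first exact: cts_cst.
  apply: cts_mx => i j.
  apply: (cts_eq (f := fun y => (\det (C y))^-1 * (\adj (C y)) i j)) => [y|].
    by rewrite [RHS]mxE.
  apply: cts_mul; first by apply: cts_inv => //; apply: cts_det.
  by apply: cts_entry; apply: cts_adj.
have ctsE q : \det (C q) != 0 -> {for q, continuous E}.
  move=> d0; have ctsZ : {for q, continuous Z} by apply: cts_mulmx; [exact: cts_cst | exact: ctsTh].
  apply: cts_mx => i j.
  apply: (cts_eq (f := fun y => Z y i j - (Z y *m y^T *m y) i j)) => [y|]; first by rewrite !mxE.
  apply: cts_sub; first exact: cts_entry.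
  apply: cts_entry; apply: cts_mulmx; last exact: cvg_id.
  apply: cts_mulmx; first exact: ctsZ.
  apply: cts_mx => k l.
  apply: (cts_eq (f := fun y : 'rV[R]_ell => y l k)) => [y|]; first by rewrite mxE.
  by apply: cts_entry; apply: cvg_id.
have Jp : detJ g p (E p) != 0 by rewrite Ep; apply: (frame_detJ ell_gt0 sp gp M0F).
exists [set q | \det (C q) != 0 /\ 0 < detJ g q (E q) * detJ g p (E p)], E; split.
- apply: filterI.
    by apply: (cts_neq0 (f := fun q => \det (C q))) Cp0; apply: cts_det; apply: ctsC.
  apply: (@cts_gt0 _ _ p (fun q => detJ g q (E q) * detJ g p (E p))).
    by apply: cts_mul; [apply: cts_detJ; apply: ctsE | apply: cts_cst].
  by rewrite -expr2 exprn_even_gt0.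
- by move=> q [d0 _]; apply: ctsE.
- move=> q [d0 hJ] sq; split => //; first exact: chart.
  apply: (detJ_frame ell_gt0 sq (g := g)).
    by apply: contraTneq hJ => ->; rewrite mul0r ltxx.
  move=> i; apply/(sphere_tangentE pts ell_gt0).
  case: (sq) => hq q1 _; have rE : row i (E q) =
      - (row i (Z q) *m q^T) 0 0 *: q + row i (Z q).
    rewrite linearB /= (row_mul i (Z q *m q^T) q) (row_mul i (Z q) q^T) addrC; congr (_ + _).
    by rewrite {1}[row i (Z q) *m q^T]mx11_scalar mul_scalar_mx scaleNr.
  split.
    rewrite rE; apply: tangent_cone_linear; first exact: euler_tangent.
    by rewrite row_mul; apply: Tht.
  rewrite rE mulmxDl -scalemxAl enorm_dot // scaleNr scalemx1 addrC.
  by apply/eqP; rewrite subr_eq0; apply/eqP/mx11_scalar.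
Qed.

End Neighborhood.

(** * The differential of psi *)

Section Differentials.
Variables (R : realType) (r : nat).
Local Notation V := ('rV[R]_r).
Implicit Types (f g df dg : V -> R) (x : V).

Definition diff_at f x df : Prop :=
  differentiable f x /\ forall w, 'd f x w = df w.

Lemma diff_at_eq f g df dg x : f =1 g -> df =1 dg -> diff_at f x df -> diff_at g x dg.
Proof. by move=> /funext <- e [h1 h2]; split => // w; rewrite h2 e. Qed.

Lemma diff_at_cst (c : R) x : diff_at (fun=> c) x (fun=> 0).
Proof.
split; first exact: differentiable_cst.
by move=> w; exact: (congr1 (@^~ w) (diff_cst c x)).
Qed.

Lemma diff_at_add f g df dg x : diff_at f x df -> diff_at g x dg ->
  diff_at (fun y => f y + g y) x (fun w => df w + dg w).
Proof.
move=> [hf ef] [hg eg]; split; first exact: differentiableD.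
by move=> w; rewrite (diffD hf hg) /= ef eg.
Qed.

Lemma diff_at_mul f g df dg x : diff_at f x df -> diff_at g x dg ->
  diff_at (fun y => f y * g y) x (fun w => f x * dg w + g x * df w).
Proof.
move=> [hf ef] [hg eg]; split; first exact: differentiableM.
by move=> w; rewrite -ef -eg; exact: (congr1 (fun F : V -> R => F w) (diffM hf hg)).
Qed.

Lemma diff_at_exp f df x k : diff_at f x df ->
  diff_at (fun y => f y ^+ k) x (fun w => k%:R * f x ^+ k.-1 * df w).
Proof.
move=> h; elim: k => [|k IH].
  apply: diff_at_eq (diff_at_cst 1 x) => w; first by rewrite expr0.
  by rewrite !mul0r.
apply: diff_at_eq (diff_at_mul h IH) => w; first by rewrite exprS.
case: k IH => [|k] _; first by rewrite !mul0r mulr0 add0r expr0 !mul1r.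
by rewrite /= [f x ^+ k.+1]exprS -[in RHS]natr1; ring.
Qed.

Lemma diff_coord m k (x w : 'rV[R]_m) :
  'd (fun y : 'rV[R]_m => y 0 k : R) x w = w 0 k.
Proof.
have @f : {linear 'rV[R]_m -> R}.
  by exists (fun N : 'rV[R]_m => N 0 k); do 2![eexists]; do ?[constructor];
     rewrite ?mxE// => ? *; rewrite ?mxE//; move=> ?; rewrite !mxE.
have -> : (fun y : 'rV[R]_m => y 0 k) = f by [].
by rewrite diff_lin //; apply: coord_continuous.
Qed.

Lemma diff_at_coord i x : diff_at (fun y => y 0 i) x (fun w => w 0 i).
Proof. by split=> [|w]; [exact: differentiable_coord | exact: diff_coord]. Qed.

Lemma diff_at_inv f df x : f x != 0 -> diff_at f x df ->
  diff_at (fun y => (f y)^-1) x (fun w => - (f x) ^- 2 * df w).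
Proof.
move=> f0 [hf ef]; split; first exact: differentiableV.
by move=> w; rewrite -ef; exact: (congr1 (@^~ w) (diffV hf f0)).
Qed.

Lemma diff_at_sqrt f df x : 0 < f x -> diff_at f x df ->
  diff_at (fun y => Num.sqrt (f y)) x (fun w => (2 * Num.sqrt (f x))^-1 * df w).
Proof.
move=> f0 [hf ef]; have [dS eS] := is_derive1_sqrt f0.
have dsq : differentiable (@Num.sqrt R) (f x) by apply/derivable1_diffP.
split; first exact: differentiable_comp.
move=> w; have -> : (fun y => Num.sqrt (f y)) = Num.sqrt \o f by [].
rewrite (diff_comp hf dsq) /= ef diff1E // derive1E eS.
exact: mulrC.
Qed.

Lemma diff_at_sum I (s : seq I) (F dF : I -> V -> R) x :
  (forall i, diff_at (F i) x (dF i)) ->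
  diff_at (fun y => \sum_(i <- s) F i y) x (fun w => \sum_(i <- s) dF i w).
Proof.
move=> h; elim: s => [|i s IH].
  by apply: diff_at_eq (diff_at_cst 0 x) => w; rewrite big_nil.
by apply: diff_at_eq (diff_at_add (h i) IH) => w; rewrite big_cons.
Qed.

Lemma diff_at_prod (I : eqType) (s : seq I) (F dF : I -> V -> R) x : uniq s ->
  (forall i, diff_at (F i) x (dF i)) ->
  diff_at (fun y => \prod_(i <- s) F i y) x
    (fun w => \sum_(i <- s) dF i w * \prod_(j <- s | j != i) F j x).
Proof.
move=> us h; elim: s us => [_|i s IH /= /andP[is_ us]].
  by apply: diff_at_eq (diff_at_cst 1 x) => w; rewrite big_nil.
apply: diff_at_eq (diff_at_mul (h i) (IH us)) => w; first by rewrite big_cons.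
rewrite big_cons big_cons eqxx /= addrC; congr (_ + _).
  rewrite mulrC; congr (_ * _); rewrite big_seq [RHS]big_seq_cond.
  apply: eq_bigl => j; case: (boolP (j \in s)) => //= js.
  by apply/esym; apply: contraNneq is_ => <-.
rewrite mulr_sumr; apply: eq_big_seq => j js.
rewrite big_cons; have -> : i != j by apply: contraNneq is_ => ->.
by rewrite mulrCA.
Qed.

Lemma diff_at_mon (a : 'I_r -> nat) x :
  diff_at (fun y => mon y a) x (fun w => dmon x w a).
Proof.
have h i := diff_at_exp (a i) (diff_at_coord i x).
apply: diff_at_eq (diff_at_prod (index_enum_uniq _) h) => // w.
apply: eq_bigr => i _; rewrite [in RHS](bigD1 i) //= eqxx subn1.
have -> : \prod_(j | j != i) x 0 j ^+ (a j - (j == i)) = \prod_(j | j != i) x 0 j ^+ a j.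
  by apply: eq_bigr => j /negbTE ->; rewrite subn0.
by move: (\prod_(j | _) _) (x 0 i ^+ _) => y z; ring.
Qed.

Lemma diff_row m (f : V -> 'rV[R]_m) (df : 'I_m -> V -> R) x :
  (forall k, diff_at (fun y => f y 0 k) x (df k)) ->
  differentiable f x /\ forall w, 'd f x w = \row_k df k w.
Proof.
move=> h; have fE : f = \sum_k (fun y => f y 0 k *: delta_mx 0 k).
  by apply/funext => y; rewrite fct_sumE; exact: row_sum_delta.
have hf : differentiable f x.
  rewrite fE; apply: differentiable_sum => k; apply: differentiableZl.
  exact: (proj1 (h k)).
split => // w; apply/rowP => k; rewrite [RHS]mxE -(proj2 (h k)).
have hc := differentiable_coord (f x) 0 k.
have := congr1 (fun F : V -> R => F w) (diff_comp hf hc).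
by rewrite /= [RHS]diff_coord => ->.
Qed.

End Differentials.

Section PsiDifferential.
Variables (R : realType) (n r ell : nat) (A : 'M[int]_(r, n)) (b : 'cV[int]_r)
  (pts : 'I_ell -> 'cV[int]_n).
Hypothesis exponent_ge0 : forall i k, 0 <= (A *m pts k + b) i 0.
Local Notation H := (hat_mx pts).
Local Notation HR := (map_mx intr H : 'M[R]_(1 + n, ell)).
Local Notation BR := (map_mx intr (row_mx b A) : 'M[R]_(r, 1 + n)).
Local Notation g := (gmap A b pts).
Implicit Types z w : 'rV[R]_r.

(** The exponents are nonnegative at lattice points of Delta, so g is polynomial and differentiable
    also where coordinates of z vanish. *)
Definition expo (k : 'I_ell) (i : 'I_r) : nat := absz ((A *m pts k + b) i 0).

Lemma gmapE z k : g z 0 k = mon z (expo k).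
Proof.
rewrite mxE; apply: eq_bigr => i _.
by rewrite -[in LHS](gez0_abs (exponent_ge0 i k)).
Qed.

Definition norm2 z : R := \sum_k mon z (expo k) ^+ 2.

Lemma enormE z : enorm (g z) = Num.sqrt (norm2 z).
Proof. by rewrite /enorm; congr Num.sqrt; apply: eq_bigr => k _; rewrite gmapE. Qed.

Lemma norm2_gt0 z : ~ B_Delta A b pts z -> 0 < norm2 z.
Proof.
move=> hB; rewrite lt_def sumr_ge0 ?andbT => [|k _]; last exact: sqr_ge0.
apply/eqP => e; apply: hB => k; rewrite gmapE; apply/eqP; rewrite -sqrf_eq0.
move/eqP: e; rewrite psumr_eq0 => [/allP/(_ k (mem_index_enum _))//|l _].
exact: sqr_ge0.
Qed.

Definition dnorm z w : R := (2 * Num.sqrt (norm2 z))^-1 *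
  \sum_k (2%:R * mon z (expo k) ^+ 1 * dmon z w (expo k)).

(** The differential of c psi, in the shape that the product rule produces, including the zero term
    of the constant c. The factor c treats psi and - psi together. *)
Definition dpsi (c : R) z w : 'rV[R]_ell := \row_k
  (c * ((Num.sqrt (norm2 z))^-1 * dmon z w (expo k) +
        mon z (expo k) * (- (Num.sqrt (norm2 z)) ^- 2 * dnorm z w)) +
   (Num.sqrt (norm2 z))^-1 * mon z (expo k) * 0).

Lemma psi_diff (c : R) z : ~ B_Delta A b pts z ->
  differentiable (fun y => c *: psi A b pts y) z /\
  forall w, 'd (fun y => c *: psi A b pts y) z w = dpsi c z w.
Proof.
move=> /norm2_gt0 h; apply: diff_row => k.
have hn : diff_at (fun y => Num.sqrt (norm2 y)) z (dnorm z).
  apply: diff_at_sqrt h _; apply: diff_at_sum => l.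
  exact: (diff_at_exp 2 (diff_at_mon (expo l) z)).
have s0 : Num.sqrt (norm2 z) != 0 by rewrite gt_eqF // sqrtr_gt0.
apply: diff_at_eq (diff_at_mul (diff_at_cst c z)
  (diff_at_mul (diff_at_inv s0 hn) (diff_at_mon (expo k) z))) => // y.
by rewrite mxE mxE -gmapE -enormE.
Qed.

Lemma cts_mon (a : 'I_r -> nat) z : {for z, continuous (fun y : 'rV[R]_r => mon y a)}.
Proof. by apply: cts_prod => i; apply: cts_exp; apply: cts_entry; apply: cvg_id. Qed.

Lemma cts_norm2 z : {for z, continuous norm2}.
Proof. by apply: cts_sum => k; apply: cts_exp; apply: cts_mon. Qed.

Lemma cts_sqrt_norm2 z : {for z, continuous (fun y => Num.sqrt (norm2 y))}.
Proof.
exact: (@continuous_comp _ _ _ norm2 Num.sqrt z (@cts_norm2 z) (@sqrt_continuous R (norm2 z))).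
Qed.

Lemma cts_psi (c : R) z : ~ B_Delta A b pts z ->
  {for z, continuous (fun y => c *: psi A b pts y)}.
Proof. by move=> /(psi_diff c)[h _]; apply: differentiable_continuous. Qed.

Lemma cts_dpsi (c : R) w z : ~ B_Delta A b pts z ->
  {for z, continuous (fun y => dpsi c y w)}.
Proof.
move=> /norm2_gt0 h; have s0 : Num.sqrt (norm2 z) != 0 by rewrite gt_eqF // sqrtr_gt0.
have cI : {for z, continuous (fun y => (Num.sqrt (norm2 y))^-1)}.
  by apply: cts_inv => //; apply: cts_sqrt_norm2.
have cd k : {for z, continuous (fun y : 'rV[R]_r => dmon y w (expo k))} by apply: cts_dmon.
have cm k : {for z, continuous (fun y : 'rV[R]_r => mon y (expo k))} by apply: cts_mon.
have c2 : {for z, continuous (fun y => 2 * Num.sqrt (norm2 y))}.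
  by apply: cts_mul; [apply: cts_cst | apply: cts_sqrt_norm2].
have cdn : {for z, continuous (fun y => dnorm y w)}.
  apply: cts_mul; first by apply: cts_inv => //; rewrite mulf_neq0 // pnatr_eq0.
  apply: cts_sum => k; apply: cts_mul; last exact: cd.
  by apply: cts_mul; [apply: cts_cst | apply: cts_exp; apply: cm].
apply: cts_mx => i k.
apply: (cts_eq (f := fun z => c * ((Num.sqrt (norm2 z))^-1 * dmon z w (expo k) +
   mon z (expo k) * (0 - (Num.sqrt (norm2 z))^-1 ^+ 2 * dnorm z w)))) => [y|].
  by rewrite mxE mulr0 addr0 exprVn mulNr sub0r.
apply: cts_mul; first exact: cts_cst; apply: cts_add; first by apply: cts_mul.
apply: cts_mul; first exact: cm; apply: cts_sub; first exact: cts_cst.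
by apply: cts_mul => //; apply: cts_exp.
Qed.

Lemma torus_notB z : (0 < ell)%N -> (forall i, z 0 i != 0) -> ~ B_Delta A b pts z.
Proof.
move=> ell0 z0 /(_ (Ordinal ell0))/eqP; apply/negP; exact: gmap_neq0.
Qed.

(** The first term is the logarithmic derivative of g. Differentiating the norm only adds a multiple
    of the point itself, collected in [t]. *)
Lemma torus_dpsi (c : R) z (W : 'M[R]_(n, r)) : (0 < ell)%N -> (forall i, z 0 i != 0) ->
  exists t : 'cV[R]_n, \matrix_i dpsi c z (row i W) =
    W *m dinv z *m BR *m HR *m diag_mx (c *: psi A b pts z) + t *m (c *: psi A b pts z).
Proof.
move=> ell0 z0; have h := norm2_gt0 (torus_notB ell0 z0).
set I := (Num.sqrt (norm2 z))^-1.
have I0 : I != 0 by rewrite invr_eq0 gt_eqF // sqrtr_gt0.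
have psiE k : (c *: psi A b pts z) 0 k = c * (I * mon z (expo k)).
  by rewrite mxE mxE gmapE enormE.
exists (\col_i (I^-1 * (- (Num.sqrt (norm2 z)) ^- 2 * dnorm z (row i W)))).
apply/matrixP => i k; rewrite [LHS]mxE [LHS]mxE mulr0 addr0.
rewrite [RHS]mxE mul_mx_diag [X in _ = X + _]mxE [X in _ = _ + X]mxE big_ord1.
rewrite !psiE [X in _ = _ + X * _]mxE -/I.
have zs : supported z (natcol (expo k)) by move=> l zl; have := z0 l; rewrite zl eqxx.
have -> : (W *m dinv z *m BR *m HR) i k = \sum_l (expo k l)%:R * ((row i W) 0 l / z 0 l).
  rewrite -!mulmxA -map_mxM mulmxA mxE; apply: eq_bigr => l _.
  rewrite /dinv mul_mx_diag mxE [(\row__ _) 0 l]mxE [(map_mx _ _) l k]mxE -facet_exponent.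
  rewrite -{1}(gez0_abs (exponent_ge0 l k)) [row i W 0 l]mxE. exact: mulrC.
rewrite dmon_supported //; move: (\sum_l _) (_ * dnorm _ _) (mon z _) => x y m.
by clearbody I; field.
Qed.

End PsiDifferential.

(** * The orientation of the smooth points *)

Lemma frame_coord (F : fieldType) N d (V : set 'rV[F]_N) (M M' : 'M[F]_(d, N)) :
  is_frame V M -> is_frame V M' -> exists2 G, G \in unitmx & M' = G *m M.
Proof.
move=> [Mf hM] [Mf' hM']; have /submxP[G GE] : (M' <= M)%MS.
  by apply/row_subP => i; apply/hM/hM'/row_sub.
exists G => //; rewrite -row_free_unit; apply: inj_row_free => v hv.
by apply: (row_free_inj Mf'); rewrite mul0mx GE mulmxA hv mul0mx.
Qed.

Section Orientation.
Variables (R : realType) (n r ell : nat) (Delta : set 'cV[R]_n)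
  (A : 'M[int]_(r, n)) (b : 'cV[int]_r) (pts : 'I_ell -> 'cV[int]_n).
Hypothesis hpoly : lattice_polytope Delta.
Hypothesis hfacets : facet_description Delta A b.
Hypothesis hpts : enum_lattice_points Delta pts.
Hypothesis ell_gt0 : (0 < ell)%N.
Local Notation H := (hat_mx pts).
Local Notation HR := (map_mx intr H : 'M[R]_(1 + n, ell)).
Variables (N : nat) (Q : 'M[int]_(ell, 1 + n)) (ct : 'cV[int]_(1 + n)).
Hypothesis oddN : odd N.
Hypothesis HQ : H *m Q = (N%:Z)%:M.
Hypothesis ct_odd : forall i, ~~ (2 %| (row_mx b A *m ct) i ord0)%Z.
Implicit Types p q : 'rV[R]_ell.

Definition torus q : Prop := forall k, q 0 k != 0.

Lemma torus_locus_scale s q : s != 0 -> torus q -> binomial_locus H q ->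
  binomial_locus H (s *: q).
Proof.
move=> s0 q0 hq; apply: torus_locus => // [k|c Hc]; first by rewrite mxE mulf_neq0.
rewrite zmon_scale // (hat_ker_sum Hc) expr0z mul1r (zmon_ker hq Hc) //.
by move=> k qk; have := q0 k; rewrite qk eqxx.
Qed.

Lemma enorm_normalize q : enorm q != 0 -> enorm ((enorm q)^-1 *: q) = 1.
Proof.
move=> q0; rewrite {1}/enorm.
have -> : \sum_k ((enorm q)^-1 *: q) 0 k ^+ 2 = (enorm q)^-1 ^+ 2 * \sum_k q 0 k ^+ 2.
  by rewrite mulr_sumr; apply: eq_bigr => k _; rewrite mxE exprMn.
rewrite sqrtrM ?sqr_ge0 // sqrtr_sqr ger0_norm ?invr_ge0 ?sqrtr_ge0 //.
by rewrite mulVf.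
Qed.

Lemma enorm_neq0 q k : q 0 k != 0 -> enorm q != 0.
Proof.
move=> qk; rewrite /enorm gt_eqF // sqrtr_gt0 lt_def sumr_ge0 ?andbT => [|l _]; last exact: sqr_ge0.
apply/eqP => /eqP; rewrite psumr_eq0 => [/allP/(_ k (mem_index_enum _))|l _]; last exact: sqr_ge0.
by rewrite /= sqrf_eq0 (negbTE qk).
Qed.

(** The arc of [toric_chart], scaled to the unit sphere, is continuous at s = 0 and lies in the
    torus for other s. *)
Lemma torus_dense p U : smooth_pt pts p -> nbhs p U ->
  exists q, [/\ U q, torus q & smooth_pt pts q].
Proof.
move=> sp hU.
have [g [_ _ _ [P [nu [hP hloc]]]]] := toric_chart hpoly hfacets hpts ell_gt0 oddN HQ ct_odd sp.
pose c (s : R) : 'rV[R]_ell := \row_k (s ^+ nu k * P 0 k).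
have c0 : c 0 = p.
  apply/rowP => k; rewrite mxE; case: (hP k) => _ h1 h2.
  case: (eqVneq (p 0 k) 0) => pk; first by rewrite expr0n gtn_eqF ?h1 //= mul0r pk.
  by case: (h2 pk) => -> ->; rewrite expr0 mul1r.
have p1 : enorm p = 1 by case: sp.
have ctsc : {for 0, continuous c}.
  apply: cts_mx => i k.
  apply: (cts_eq (f := fun s : R => s ^+ nu k * P 0 k)) => [s|]; first by rewrite mxE.
  by apply: cts_mul; [apply: cts_exp; apply: cvg_id | apply: cts_cst].
have ctse : {for 0, continuous (fun s => enorm (c s))}.
  have h : {for 0, continuous (fun s => \sum_k c s 0 k ^+ 2)}.
    by apply: cts_sum => k; apply: cts_exp; apply: cts_entry.
  exact: (@continuous_comp _ _ _ _ Num.sqrt (0 : R) h (@sqrt_continuous R _)).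
have ctsq : {for 0, continuous (fun s => (enorm (c s))^-1 *: c s)}.
  apply: cts_mx => i k.
  apply: (cts_eq (f := fun s : R => (enorm (c s))^-1 * c s i k)) => [s|]; first by rewrite [RHS]mxE.
  apply: cts_mul; last exact: cts_entry.
  by apply: cts_inv => //; rewrite c0 p1 oner_eq0.
have : nbhs (0 : R) [set s | U ((enorm (c s))^-1 *: c s)].
  by apply: ctsq; rewrite c0 p1 invr1 scale1r.
move=> /nbhs_ballP[e /= e0 he].
have s0 : e / 2 != 0 :> R by rewrite gt_eqF // divr_gt0.
have Us : U ((enorm (c (e / 2)))^-1 *: c (e / 2)).
  apply: he; rewrite /ball /= sub0r normrN gtr0_norm ?divr_gt0 //.
  by rewrite ltr_pdivrMr // ltr_pMr // ltr1n.
have ct0 : torus (c (e / 2)).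
  by move=> k; rewrite mxE mulf_neq0 ?expf_neq0 //; case: (hP k).
have en : enorm (c (e / 2)) != 0 by exact: enorm_neq0 (ct0 (Ordinal ell_gt0)).
exists ((enorm (c (e / 2)))^-1 *: c (e / 2)); split => //.
  by move=> k; rewrite mxE mulf_neq0 // invr_eq0.
apply: (torus_smooth oddN HQ).
- by apply: torus_locus_scale; rewrite ?invr_eq0 //; apply: hloc.
- by move=> k; rewrite mxE mulf_neq0 // invr_eq0.
- exact: enorm_normalize.
Qed.

(* A chart at p, with the sign kappa that it has with respect to the
   orientation tau of the torus. *)
Definition oriented_chart p (g : 'I_(1 + n) -> 'I_ell) (kappa : R) : Prop :=
  [/\ kappa != 0, chart_at pts g p,
    (exists (U : set 'rV[R]_ell) (E : 'rV[R]_ell -> 'M[R]_(n, ell)),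
    [/\ nbhs p U, forall q, U q -> {for q, continuous E}
      & forall q, U q -> smooth_pt pts q ->
        [/\ chart_at pts g q, is_frame (Yplus_tangent pts q) (E q)
          & 0 < detJ g q (E q) * detJ g p (E p)]])
  & \forall q \near p, binomial_locus H q -> torus q ->
      forall M, (forall i, tangent_cone H q (row i M)) -> detJ g q M != 0 ->
      0 < tau Q ct q M * detJ g q M * kappa].

Lemma oriented_chart_exists p : smooth_pt pts p ->
  exists gk, oriented_chart p gk.1 gk.2.
Proof.
move=> sp.
have [g [gp gu [e [He e2]] _]] := toric_chart hpoly hfacets hpts ell_gt0 oddN HQ ct_odd sp.
exists (g, \prod_(k | p 0 k != 0) p 0 k ^ e k 0 * \det (colsub g HR)); split => /=.
- rewrite mulf_neq0 //; last by rewrite -unitfE -unitmxE.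
  by apply/prodf_neq0 => k pk; rewrite expfz_neq0.
- exact: gp.
- apply: chart_neighborhood => //.
  move=> i j gij; apply/eqP; apply: contraTT gu => ij.
  rewrite unitmxE unitfE -det_tr (determinant_alternate ij) ?eqxx // => k.
  by rewrite !mxE gij.
- have : nbhs p [set q : 'rV[R]_ell | forall k, p 0 k != 0 -> 0 < q 0 k * p 0 k].
    have hk k : nbhs p [set q : 'rV[R]_ell | p 0 k != 0 -> 0 < q 0 k * p 0 k]; last first.
      exact: (@filter_forall _ _ (fun k => [set q : 'rV[R]_ell | p 0 k != 0 -> 0 < q 0 k * p 0 k])
        (nbhs p) _ hk).
    case: (eqVneq (p 0 k) 0) => pk.
      exact: filterE.
    have : nbhs p [set q : 'rV[R]_ell | 0 < q 0 k * p 0 k].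
      apply: (cts_gt0 (f := fun q : 'rV[R]_ell => q 0 k * p 0 k)).
        by apply: cts_mul; [apply: cts_entry; apply: cvg_id | apply: cts_cst].
      by rewrite -expr2 exprn_even_gt0.
    by apply: filterS => q /=.
  apply: filterS => q qp hq q0 M hM dJ.
  exact: (tau_sign (ct := ct) oddN HQ hq q0 hM dJ gu He e2 qp).
Qed.

Lemma detJ_comb g q (G : 'M[R]_n) M : detJ g q (G *m M) = \det G * detJ g q M.
Proof.
rewrite /detJ; have -> : colsub g (col_mx q (G *m M) : 'M[R]_(1 + n, ell)) =
    (block_mx 1%:M 0 0 G : 'M[R]_(1 + n)) *m colsub g (col_mx q M : 'M[R]_(1 + n, ell)).
  have -> : (col_mx q (G *m M) : 'M[R]_(1 + n, ell)) = (block_mx 1%:M 0 0 G : 'M[R]_(1 + n)) *m col_mx q M.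
    by rewrite mul_block_col mul1mx !mul0mx addr0 add0r.
  apply/matrixP => i j; rewrite mxE [LHS]mxE [RHS]mxE; apply: eq_bigr => k _.
  by rewrite [colsub _ _ k j]mxE.
by rewrite det_mulmx det_ublock det1 mul1r.
Qed.

Lemma same_sign (a c d : R) : 0 < a * c -> 0 < a * d -> (0 < c) = (0 < d).
Proof.
move=> h1 h2; case: (ltrgt0P a) => ha.
- by rewrite -(pmulr_rgt0 c ha) -(pmulr_rgt0 d ha) h1 h2.
- have : c < 0 by rewrite -(nmulr_rgt0 c ha).
  have : d < 0 by rewrite -(nmulr_rgt0 d ha).
  by move=> /ltW d0 /ltW c0; rewrite !ltNge c0 d0.
- by move: h1; rewrite ha mul0r ltxx.
Qed.

Lemma frame_tangent q (M : 'M[R]_(n, ell)) i :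
  is_frame (Yplus_tangent pts q) M -> tangent_cone H q (row i M).
Proof. by move=> hM; have /(sphere_tangentE pts ell_gt0)[] := frame_rows i hM. Qed.

Lemma frame_mul (V : set 'rV[R]_ell) (M : 'M[R]_(n, ell)) (G : 'M[R]_n) :
  is_frame V M -> G \in unitmx -> is_frame V (G *m M).
Proof.
move=> [Mf hM] Gu; split; first by rewrite /row_free mxrankMfree // mxrank_unit.
move=> v; rewrite hM (eqmxMfull M) // row_full_unit //.
Qed.

(* Two charts define the same orientation near each other: both agree with tau
   at the points of the torus, which are dense. *)
Lemma oriented_chart_compat p g kappa : oriented_chart p g kappa ->
  \forall q \near p, smooth_pt pts q -> forall g' kappa', oriented_chart q g' kappa' ->
    forall M, is_frame (Yplus_tangent pts q) M ->
      (0 < detJ g' q M * kappa') = (0 < detJ g q M * kappa).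
Proof.
move=> [k0 gp [U [E [hU cE hE]]] hT].
have hW := @filterI _ _ (nbhs_filter p) _ _ (nbhs_interior hU) (nbhs_interior hT).
move: hW; apply: filterS => q [qU qT] sq g' k' [k0' gq' _ hT'] M MF.
have [gq EF _] := hE q (interior_subset qU) sq.
have [G Gu ME] := frame_coord EF MF.
have cGE : {for q, continuous (fun q => G *m E q)}.
  by apply: cts_mulmx; [apply: cts_cst | apply: cE; apply: interior_subset].
have near_sign h c : detJ h q M != 0 -> c != 0 ->
    nbhs q [set q' | 0 < detJ h q M * c * (detJ h q' (G *m E q') * c)].
  move=> hM0 c0.
  apply: (cts_gt0 (f := fun q' => detJ h q M * c * (detJ h q' (G *m E q') * c))).
    apply: cts_mul; first exact: cts_cst.
    by apply: cts_mul; [apply: cts_detJ cGE | apply: cts_cst].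
  by rewrite -ME -expr2 exprn_even_gt0 //= mulf_neq0.
have J1 := near_sign _ _ (frame_detJ ell_gt0 sq gq MF) k0.
have J2 := near_sign _ _ (frame_detJ ell_gt0 sq gq' MF) k0'.
have qF := nbhs_filter q.
have hV := @filterI _ _ qF _ _ (@filterI _ _ qF _ _ J1 J2) (@filterI _ _ qF _ _ hT' (@filterI _ _ qF _ _ qU qT)).
have [q' [[[S1 S2] [T2 [q'U T1]]] tq' sq']] := torus_dense sq hV.
have [gq1 EF' _] := hE q' q'U sq'.
have M'F := frame_mul EF' Gu.
have hq' : binomial_locus H q' by case: sq'.
have hM' i := frame_tangent i M'F.
have d1 : detJ g q' (G *m E q') != 0 by exact: frame_detJ M'F.
have d2 : detJ g' q' (G *m E q') != 0.
  by apply: contraTneq S2 => /= ->; rewrite mul0r mulr0 ltxx.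
have R1 := T1 hq' tq' _ hM' d1; have R2 := T2 hq' tq' _ hM' d2.
rewrite -mulrA in R1; rewrite -mulrA in R2.
rewrite (same_sign (c := detJ g q M * kappa) (d := detJ g q' (G *m E q') * kappa)
  (a := detJ g q' (G *m E q') * kappa)); last 2 first.
- by rewrite mulrC.
- by rewrite -expr2 exprn_even_gt0 //= mulf_neq0.
rewrite (same_sign (c := detJ g' q M * k') (d := detJ g' q' (G *m E q') * k')
  (a := detJ g' q' (G *m E q') * k')); last 2 first.
- by rewrite mulrC.
- by rewrite -expr2 exprn_even_gt0 //= mulf_neq0.
exact: same_sign R2 R1.
Qed.

(** An arbitrary choice of chart at each smooth point, with a default elsewhere;
    [oriented_chart_compat] makes the resulting signs independent of the choice. *)
Definition chart_data p : ('I_(1 + n) -> 'I_ell) * R :=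
  match pselect (smooth_pt pts p) with
  | left sp => projT1 (cid (oriented_chart_exists sp))
  | right _ => (fun=> Ordinal ell_gt0, 0)
  end.

Lemma chart_dataP p : smooth_pt pts p ->
  oriented_chart p (chart_data p).1 (chart_data p).2.
Proof.
move=> sp; rewrite /chart_data; case: pselect => // sp'.
by case: cid.
Qed.

(** The sign [c] selects one of the two orientations defined by tau. *)
Definition orientation (c : bool) p (M : 'M[R]_(n, ell)) : bool :=
  (0 < detJ (chart_data p).1 p M * (chart_data p).2) == c.

(** Near p the charts chosen at other points agree with the one at p, in which the continuous frame
    [E] has constant sign. *)
Lemma orientation_manifold c :
  is_manifold_orientation [set p | smooth_pt pts p] (Yplus_tangent pts) (orientation c).
Proof.
split=> p sp.
  move=> M G MF Gu; have [k0 gp _ _] := chart_dataP sp.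
  rewrite /orientation detJ_comb -mulrA.
  have x0 : detJ (chart_data p).1 p M * (chart_data p).2 != 0.
    by rewrite mulf_neq0 // (frame_detJ ell_gt0 sp gp MF).
  have G0 : \det G != 0 by rewrite -unitfE -unitmxE.
  have -> : (0 < \det G * (detJ (chart_data p).1 p M * (chart_data p).2)) =
      ((0 < detJ (chart_data p).1 p M * (chart_data p).2) == (0 < \det G)).
    case: (ltrgt0P (\det G)) G0 => // hG _.
      by rewrite pmulr_rgt0 // eqb_id.
    rewrite nmulr_rgt0 // eqbF_neg -leNgt lt_neqAle x0 //.
  by case: c; case: (0 < _ * _); case: (0 < _).
have cp := chart_dataP sp; case: (cp) => k0 gp [U [E [hU cE hE]]] _.
have hW := @filterI _ _ (nbhs_filter p) _ _ hU (oriented_chart_compat cp).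
exists (U `&` [set q | smooth_pt pts q -> forall g' kappa', oriented_chart q g' kappa' ->
    forall M, is_frame (Yplus_tangent pts q) M ->
      (0 < detJ g' q M * kappa') = (0 < detJ (chart_data p).1 q M * (chart_data p).2)]), E.
split => //.
  by apply: continuous_in_subspaceT => q /set_mem[[qU _] _]; apply: cE.
move=> q [[qU hq] sq]; have [gq EF hJ] := hE q qU sq.
split => //; rewrite /orientation (hq sq _ _ (chart_dataP sq) _ EF).
congr (_ == _); apply: (same_sign (a := detJ (chart_data p).1 q (E q) * (chart_data p).2)).
  rewrite -expr2 exprn_even_gt0 //= mulf_neq0 //.
  by apply: contraTneq hJ => ->; rewrite mul0r ltxx.
rewrite mulrACA; apply: mulr_gt0 => //.
by rewrite -expr2 exprn_even_gt0.
Qed.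

End Orientation.

(** * The induced orientation *)

Lemma expR_exprz (R : realType) (x : R) (z : int) : expR x ^ z = expR (z%:~R * x).
Proof.
case: z => k; first by rewrite expRM_natl.
by rewrite NegzE mulrNz mulNr expRN expRM_natl.
Qed.

Section LieAlgebra.
Variables (R : realType) (n r : nat) (A : 'M[int]_(r, n)) (b : 'cV[int]_r).
Local Notation AR := (map_mx intr A : 'M[R]_(r, n)).

(** Injectivity of the exponential linearizes the equations of K. Signs and the inequality for b are
    automatic, as exponentials are positive. *)
Lemma LieKE (l : 'rV[R]_r) : LieK A b l <-> l *m AR = 0.
Proof.
have E t j : \prod_i (\row_i expR (t * l 0 i)) 0 i ^ (A i j) = expR (t * (l *m AR) 0 j).
  rewrite [in RHS]mxE mulr_sumr expR_sum; apply: eq_bigr => i _.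
  by rewrite mxE expR_exprz [X in _ * (_ * X)]mxE; congr expR; ring.
split=> [hl|hl t].
  apply/rowP => j; rewrite [RHS]mxE; have [_ /(_ j) + _] := hl 1.
  by rewrite E mul1r -[RHS]expR0 => /expR_inj.
split=> [i|j|]; first by rewrite mxE gt_eqF // expR_gt0.
  by rewrite E hl mxE mulr0 expR0.
by apply: prodr_gt0 => i _; rewrite mxE exprz_gt0 // expR_gt0.
Qed.

Lemma inf_actionE (z l : 'rV[R]_r) : inf_action z l = l *m diag_mx z.
Proof. by apply/rowP => i; rewrite mul_mx_diag !mxE. Qed.

Lemma inf_action_frame (z : 'rV[R]_r) m (L : 'M[R]_(m, r)) :
  \matrix_i inf_action z (row i L) = L *m diag_mx z.
Proof. by apply/row_matrixP => i; rewrite rowK inf_actionE row_mul. Qed.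

End LieAlgebra.

Section Induced.
Variables (R : realType) (n s ell : nat).
Local Notation r := (s + n)%N.
Variables (A : 'M[int]_(r, n)) (b : 'cV[int]_r) (pts : 'I_ell -> 'cV[int]_n).
Hypothesis ell_gt0 : (0 < ell)%N.
Hypothesis exponent_ge0 : forall i k, 0 <= (A *m pts k + b) i 0.
Local Notation H := (hat_mx pts).
Local Notation AR := (map_mx intr A : 'M[R]_(r, n)).
Variables (N : nat) (Q : 'M[int]_(ell, 1 + n)) (ct : 'cV[int]_(1 + n)).
Hypothesis oddN : odd N.
Hypothesis HQ : H *m Q = (N%:Z)%:M.
Hypothesis ct_odd : forall i, ~~ (2 %| (row_mx b A *m ct) i ord0)%Z.
Variable sg : R.
Hypothesis sg0 : sg != 0.
Hypothesis sg_pos : 0 < sg \/ (2 %| ct (lshift n ord0) ord0)%Z.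
Local Notation phi := (fun y : 'rV[R]_r => sg *: psi A b pts y).
Local Notation dphi z W := (\matrix_i dpsi A b pts sg z (row i W)).
Implicit Types (z : 'rV[R]_r) (L : 'M[R]_(s, r)) (W : 'M[R]_(n, r)).

(** Three comparisons are multiplied: chart with tau, tau with the signs of z, and det (W diag(z)^-1
    A) with det [L; W diag(z)^-1] through [frame_det]. *)
Lemma torus_sign z L0 L W (G : 'M[R]_s) g kappa :
  torus z -> row_free L0 -> L0 *m AR = 0 -> L = G *m L0 -> G \in unitmx ->
  (binomial_locus H (phi z) -> torus (phi z) -> forall M,
    (forall i, tangent_cone H (phi z) (row i M)) -> detJ g (phi z) M != 0 ->
    0 < tau Q ct (phi z) M * detJ g (phi z) M * kappa) ->
  detJ g (phi z) (dphi z W) != 0 ->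
  0 < detJ g (phi z) (dphi z W) * kappa * \det (col_mx (L *m diag_mx z) W) * \det G
    * (\det (L0 *m L0^T) * \det (row_mx L0^T AR)).
Proof.
move=> z0 L0f L0A LG Gu hchart hJ.
have [t Et] := torus_dpsi exponent_ge0 sg W ell_gt0 z0.
pose s' := sg / enorm (gmap A b pts z).
have en0 : enorm (gmap A b pts z) != 0.
  by apply: enorm_neq0 (gmap_neq0 A b pts (Ordinal ell_gt0) z0).
have s0 : s' != 0 by rewrite mulf_neq0 // invr_eq0.
have hs' : 0 < s' \/ (2 %| ct (lshift n ord0) ord0)%Z.
  case: sg_pos; [left|by right].
  by rewrite /s' divr_gt0 // lt_def en0 sqrtr_ge0.
have phiE : phi z = s' *: gmap A b pts z by rewrite /psi scalerA.
rewrite /= in phiE hchart hJ *.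
have hq : binomial_locus H (sg *: psi A b pts z) by rewrite phiE; apply: gmap_locus.
have q0 : torus (sg *: psi A b pts z).
  by rewrite phiE => k; rewrite mxE mulf_neq0 // gmap_neq0.
have MT i : tangent_cone H (sg *: psi A b pts z) (row i (dphi z W)).
  rewrite Et linearD /= (row_mul i t) addrC (_ : row i t = (t i 0)%:M); last first.
    by apply/rowP => j; rewrite !mxE !ord1.
  rewrite mul_scalar_mx; apply: tangent_cone_linear; first exact: euler_tangent.
  exact: torus_tangent_mul.
have T := hchart hq q0 _ MT hJ.
have D0 : \det (W *m dinv z *m AR) != 0.
  apply: contraTneq T => D0; rewrite Et phiE (tau_gmap A b ct HQ W t s0 z0) D0 !mulr0 !mul0r.
  by rewrite ltxx.
have S := tau_gmap_sign ell_gt0 oddN HQ ct_odd t s0 hs' z0 D0.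
rewrite /= -phiE -Et in S.
have FD := frame_det (W := W *m dinv z) L0f L0A LG Gu D0.
have CE : col_mx (L *m diag_mx z) W = col_mx L (W *m dinv z) *m diag_mx z.
  by rewrite mul_col_mx -!mulmxA dinv_diag // mulmx1.
rewrite CE det_mulmx det_diag.
move: T S FD; set K0 := \det (L0 *m L0^T) * _.
set J := detJ _ _ _; set T := tau _ _ _ _; set D := \det _; set X := \det (col_mx L _).
set P := \prod_i z 0 i => h1 h2 h3.
(* This product is the square of T D times the required quantity. *)
have h : 0 < (T * J * kappa) * (T * P * D) * (X * D * \det G * K0).
  by apply: mulr_gt0 => //; apply: mulr_gt0.
have TD : 0 < (T * D) ^+ 2.
  rewrite exprn_even_gt0 //= mulf_neq0 //.
  by apply: contraTneq h1 => ->; rewrite !mul0r ltxx.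
rewrite -(pmulr_rgt0 _ TD); congr (0 < _): h; ring.
Qed.


(** The differential has rank n, so its kernel, spanned by the s rows of L diag(z), has dimension s
    and these rows are independent. The rows of W map to a frame, hence complete them to a basis,
    even if coordinates of z vanish. *)
Lemma lift_det_neq0 z L W (E : 'M[R]_(n, ell)) :
  orienting_point A b pts phi z -> is_frame (LieK A b) L ->
  is_frame (Yplus_tangent pts (phi z)) E ->
  (forall i, 'd phi z (row i W) = row i E) -> \det (col_mx (L *m diag_mx z) W) != 0.
Proof.
move=> [_ _ im ke] [Lf hL] [Ef hE] WE.
pose P := lin1_mx ('d phi z : 'rV[R]_r -> 'rV[R]_ell).
have PE w : w *m P = 'd phi z w by exact: mul_rV_lin1.
have rP : \rank P = n.
  rewrite -[RHS](eqP Ef); apply/eqP; rewrite eqn_leq; apply/andP; split; apply: mxrankS.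
    apply/row_subP => i; apply/hE; rewrite -im; exists (delta_mx 0 i) => //.
    by rewrite -PE -rowE.
  by apply/row_subP => i; rewrite -WE -PE submxMl.
have kerE (w : 'rV[R]_r) : w *m P = 0 <-> (w <= L *m diag_mx z)%MS.
  rewrite PE; change ([set w | 'd phi z w = 0] w <-> (w <= L *m diag_mx z)%MS).
  rewrite ke; split=> [[l /hL/submxP[y ->] <-]|/submxP[y ->]].
    by rewrite inf_actionE -mulmxA submxMl.
  by exists (y *m L); [apply/hL/submxMl | rewrite inf_actionE mulmxA].
have Lzf : row_free (L *m diag_mx z).
  rewrite /row_free eqn_leq rank_leq_row /= -{1}(addnK n s) -{2}rP -mxrank_ker.
  by apply: mxrankS; apply/row_subP => i; apply/kerE; apply/sub_kermxP/row_sub.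
rewrite -unitfE -unitmxE -row_free_unit; apply: inj_row_free => x.
rewrite -[x]hsubmxK mul_row_col => hx.
have x2 : rsubmx x = 0.
  apply: (row_free_inj Ef); rewrite mul0mx.
  have <- : W *m P = E by apply/row_matrixP => i; rewrite row_mul PE WE.
  have := congr1 (mulmxr P) hx; rewrite /= mul0mx mulmxDl -[X in _ + X]mulmxA.
  by rewrite (_ : lsubmx x *m (L *m diag_mx z) *m P = 0) ?add0r //; apply/kerE/submxMl.
move: hx; rewrite x2 mul0mx addr0 => hx.
suff -> : lsubmx x = 0 by rewrite row_mx0.
by apply: (row_free_inj Lzf); rewrite mul0mx.
Qed.

Lemma torus_near z U : nbhs z U -> exists2 z', U z' & torus z'.
Proof.
move=> hU; pose c (t : R) : 'rV[R]_r := \row_i (z 0 i + (z 0 i == 0)%:R * t).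
have c0 : c 0 = z by apply/rowP => i; rewrite mxE mulr0 addr0.
have ctsc : {for 0, continuous c}.
  apply: cts_mx => i k.
  apply: (cts_eq (f := fun t : R => z 0 k + (z 0 k == 0)%:R * t)) => [t|]; first by rewrite mxE.
  by apply: cts_add; [|apply: cts_mul; [|apply: cvg_id]]; apply: cts_cst.
have : nbhs (0 : R) [set t | U (c t)] by apply: ctsc; rewrite c0.
move=> /nbhs_ballP[e /= e0 he].
have s0 : e / 2 != 0 :> R by rewrite gt_eqF // divr_gt0.
exists (c (e / 2)).
  apply: he; rewrite /ball /= sub0r normrN gtr0_norm ?divr_gt0 //.
  by rewrite ltr_pdivrMr // ltr_pMr // ltr1n.
move=> i; rewrite mxE; case: (eqVneq (z 0 i) 0) => [->|zi]; last by rewrite mul0r addr0.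
by rewrite add0r mul1r.
Qed.

(** Both determinants are nonzero at z and continuous, so they keep their signs at a nearby torus
    point, where [torus_sign] applies to the image of the same lift W. *)
Lemma induced_sign z L0 L W (G : 'M[R]_s) (E : 'M[R]_(n, ell)) g kappa :
  orienting_point A b pts phi z -> is_frame (LieK A b) L0 -> is_frame (LieK A b) L ->
  L = G *m L0 -> G \in unitmx -> smooth_pt pts (phi z) ->
  is_frame (Yplus_tangent pts (phi z)) E ->
  (forall i, 'd phi z (row i W) = row i E) -> oriented_chart pts Q ct (phi z) g kappa ->
  0 < detJ g (phi z) E * kappa * \det (col_mx (L *m diag_mx z) W) * \det G
    * (\det (L0 *m L0^T) * \det (row_mx L0^T AR)).
Proof.
move=> oz L0F LF LG Gu sz EF WE [k0 gz _ hT].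
have D0 := lift_det_neq0 oz LF EF WE.
have J0 := frame_detJ ell_gt0 sz gz EF.
have [zB _ _ _] := oz.
have [_ dE] := psi_diff exponent_ge0 sg zB.
have EE : E = dphi z W by apply/row_matrixP => i; rewrite rowK -WE dE.
pose D z' := \det (col_mx (L *m diag_mx z') W : 'M[R]_r).
pose J z' := detJ g (phi z') (dphi z' W).
have cD : {for z, continuous D}.
  apply: cts_det; apply: cts_mx => i j.
  rewrite -(fintype.splitK i); case: (fintype.split i) => k /=.
    apply: (cts_eq (f := fun y : 'rV[R]_r => L k j * y 0 j)) => [y|].
      by rewrite col_mxEu mul_mx_diag mxE.
    by apply: cts_mul; [apply: cts_cst | apply: cts_entry; apply: cvg_id].
  by apply: (cts_eq (f := fun=> W k j)) => [y|]; [rewrite col_mxEd | apply: cts_cst].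
have cphi : {for z, continuous phi} by exact: cts_psi.
have cJ : {for z, continuous J}.
  apply: cts_det; apply: cts_mx => i j.
  rewrite -(fintype.splitK i); case: (fintype.split i) => k /=.
    apply: (cts_eq (f := fun y : 'rV[R]_r => phi y k (g j))) => [y|].
      by rewrite [RHS]mxE col_mxEu.
    by apply: cts_entry.
  apply: (cts_eq (f := fun y : 'rV[R]_r => dpsi A b pts sg y (row k W) 0 (g j))) => [y|].
    by rewrite [RHS]mxE col_mxEd [RHS]mxE.
  by apply: cts_entry; apply: cts_dpsi.
have nD : nbhs z [set z' | 0 < D z * D z'].
  apply: (cts_gt0 (f := fun z' => D z * D z')).
    by apply: cts_mul => //; apply: cts_cst.
  by rewrite -expr2 exprn_even_gt0.
have nJ : nbhs z [set z' | 0 < J z * J z'].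
  apply: (cts_gt0 (f := fun z' => J z * J z')).
    by apply: cts_mul => //; apply: cts_cst.
  by rewrite -expr2 exprn_even_gt0 //= /J -EE.
have nF := nbhs_filter z.
have [z' [hD [hJ hT']] tz'] := torus_near (@filterI _ _ nF _ _ nD (@filterI _ _ nF _ _ nJ (cphi _ hT))).
have [L0f hL0] := L0F.
have L0A : L0 *m AR = 0.
  by apply/row_matrixP => i; rewrite row_mul row0; apply/(LieKE A b)/hL0/row_sub.
have J'0 : J z' != 0 by apply: contraTneq hJ => /= ->; rewrite mulr0 ltxx.
have := torus_sign tz' L0f L0A LG Gu hT' J'0.
rewrite EE -/(J z) -/(J z') -/(D z) -/(D z').
move: (_ * \det (row_mx _ _)) => K0 h.
have h2 : 0 < (J z * J z') * (D z * D z') * (J z' * kappa * D z' * \det G * K0).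
  by apply: mulr_gt0 => //; apply: mulr_gt0.
have x2 : 0 < (J z' * D z') ^+ 2.
  rewrite exprn_even_gt0 //= mulf_neq0 //.
  by apply: contraTneq hD => /= ->; rewrite mulr0 ltxx.
by rewrite -(pmulr_rgt0 _ x2); congr (0 < _): h2; ring.
Qed.

End Induced.

(** * Consequences of the facet description, and parity modulo 2 *)

Section Main.
Variables (R : realType) (n r ell : nat) (Delta : set 'cV[R]_n)
  (A : 'M[int]_(r, n)) (b : 'cV[int]_r) (pts : 'I_ell -> 'cV[int]_n).
Hypothesis hpoly : lattice_polytope Delta.
Hypothesis hfacets : facet_description Delta A b.
Hypothesis hpts : enum_lattice_points Delta pts.
Local Notation AR := (map_mx intr A : 'M[R]_(r, n)).

Lemma points_exist : (0 < ell)%N.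
Proof.
case: hpoly => k [v DE]; have [_ /(_ (v ord0))[+ _]] := hpts.
case=> [|j _]; last exact: leq_ltn_trans (ltn_ord j).
rewrite DE; exists (fun i => (i == ord0)%:R); split=> [i||].
- by rewrite ler0n.
- by rewrite (bigD1 ord0) //= big1 ?addr0 // => i /negbTE ->.
- by rewrite (bigD1 ord0) //= scale1r big1 ?addr0 // => i /negbTE ->; rewrite scale0r.
Qed.

Lemma exponent_ge0 i k : 0 <= (A *m pts k + b) i 0.
Proof.
have := pts_in hpts k; case: hfacets => -> _ _ _ /(_ i).
rewrite -map_mxM mxE -subr_ge0 opprK -intrD ler0z.
by rewrite [(A *m pts k + b) i 0]mxE.
Qed.

(* A polytope contains no line. *)
Lemma facets_rank : (n <= r)%N.
Proof.
suff AI (y : 'cV[R]_n) : AR *m y = 0 -> y = 0.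
  have : row_free AR^T.
    apply: inj_row_free => v hv; apply: trmx_inj; rewrite trmx0; apply: AI.
    by rewrite -[AR]trmxK -trmx_mul hv trmx0.
  by rewrite /row_free mxrank_tr => /eqP <-; apply: rank_leq_row.
move=> Ay; have x0 := pts_in hpts (Ordinal points_exist).
move: x0; set x := toR R _ => x0.
have xD (t : R) : Delta (x + t *: y).
  move: x0; case: hfacets => -> _ _ _ h i.
  by rewrite mulmxDr -scalemxAr Ay scaler0 addr0.
case: hpoly => k [v DE]; apply/colP => j; rewrite [RHS]mxE; apply/eqP.
apply: contrapT => /negP yj.
pose B := \sum_i `|toR R (v i) j 0|.
have bd (t : R) : `|x j 0 + t * y j 0| <= B.
  have := xD t; rewrite DE => -[w [w0 w1 e]].
  have -> : x j 0 + t * y j 0 = (x + t *: y) j 0 by rewrite !mxE.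
  rewrite e summxE; apply: le_trans (ler_norm_sum _ _ _) _; apply: ler_sum => i _.
  rewrite mxE normrM ler_piMl // ger0_norm // -w1 (bigD1 i) //= lerDl.
  exact: sumr_ge0.
(* At this parameter the j-th coordinate on the line would be B + 1. *)
have := bd ((B + 1 - x j 0) / y j 0).
rewrite divfK // addrC subrK => h.
have := le_trans (ler_norm _) h.
by rewrite gerDl ler10.
Qed.

Lemma oppr1_odd (x : int) : ~~ (2 %| x)%Z -> (-1) ^ x = -1 :> R.
Proof.
move=> hx; have /dvdzP[h] : (2 %| (x - 1)%R)%Z by lia.
move=> /(canRL (subrK 1)) ->; rewrite expfzDr ?oppr_eq0 ?oner_eq0 // expr1z.
by rewrite [h * 2]mulrC -exprz_exp -exprnP sqrrN expr1n exp1rz mul1r.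
Qed.

(** Multiplying z_i by (-1)^(e_i) multiplies the coordinate of m by -1 to the power e.(A m + b),
    whose parity is that of e.b, hence odd, for every m. *)
Lemma psi_flip (e : 'I_r -> int) :
  (forall j, (2 %| \sum_i e i * A i j)%Z) -> ~~ (2 %| \sum_i e i * b i ord0)%Z ->
  forall z : 'rV[R]_r, ~ B_Delta A b pts z -> exists2 z', ~ B_Delta A b pts z' &
    psi A b pts z' = - psi A b pts z.
Proof.
move=> eA eb z zB; pose z' := \row_i ((-1) ^ e i * z 0 i).
have m1 : (-1 : R) != 0 by rewrite oppr_eq0 oner_eq0.
have gE : gmap A b pts z' = - gmap A b pts z.
  apply/rowP => k; rewrite [LHS]mxE mxE [in RHS]mxE -mulN1r.
  under eq_bigr => i _ do rewrite [z' 0 i]mxE expfzMl exprz_exp.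
  rewrite big_split /=; congr (_ * _).
  rewrite -(big_morph (fun x : int => (-1) ^ x) (fun x y => expfzDr x y m1) (expr0z _)).
  apply: oppr1_odd; apply: contra eb.
  have -> : \sum_i e i * (A *m pts k + b) i 0 =
      \sum_j (\sum_i e i * A i j) * pts k j 0 + \sum_i e i * b i ord0.
    under eq_bigr => i _ do rewrite mxE mulrDr.
    rewrite big_split /=; congr (_ + _).
    under [RHS]eq_bigr => j _ do rewrite mulr_suml.
    rewrite exchange_big; apply: eq_bigr => i _ /=.
    by rewrite mxE mulr_sumr; apply: eq_bigr => j _; rewrite mulrA.
  rewrite rpredDl //; apply: rpred_sum => j _; exact: dvdz_mulr.
exists z'.
  move=> h; apply: zB => k; apply/eqP; rewrite -oppr_eq0; apply/eqP.
  by rewrite -(h k) gE [RHS]mxE.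
rewrite /psi gE scalerN; congr (- (_^-1 *: _)).
by congr Num.sqrt; apply: eq_bigr => k _; rewrite mxE sqrrN.
Qed.

End Main.

Section Parity.
Variables (n r : nat) (A : 'M[int]_(r, n)) (b : 'cV[int]_r).

(* Linear algebra over the field with two elements. *)
Lemma parity_alternative :
  (exists c : 'cV[int]_n, forall i, (2 %| (A *m c - b) i ord0)%Z) \/
  (exists e : 'I_r -> int, (forall j, (2 %| \sum_i e i * A i j)%Z) /\
     ~~ (2 %| \sum_i e i * b i ord0)%Z).
Proof.
have h2 : 2%N \in [pchar 'F_2] by exact: pchar_Fp.
have lift (x : 'F_2) : exists m : int, m%:~R == x.
  by exists (nat_of_ord x)%:Z; rewrite -pmulrn natr_Zp eqxx.
pose A2 : 'M['F_2]_(r, n) := map_mx intr A.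
pose b2 : 'cV['F_2]_r := map_mx intr b.
case: (boolP (b2^T <= A2^T)%MS) => [/submxP[y yE]|].
  left; pose c := \matrix_(i, j) xchoose (lift (y j i)) : 'cV[int]_n.
  have cE : map_mx intr c = y^T.
    by apply/matrixP => i j; rewrite 3!mxE; exact/eqP/(xchooseP (lift (y j i))).
  exists c => i; rewrite (dvdz_pcharf h2).
  have /matrixP/(_ i 0) : map_mx intr (A *m c - b) = 0 :> 'cV['F_2]_r.
    by rewrite map_mxB map_mxM cE -[map_mx intr A]trmxK -trmx_mul -yE trmxK subrr.
  by rewrite mxE [RHS]mxE => ->.
rewrite submxE => hb; right.
(* A column of the cokernel matrix is a linear form modulo 2 that vanishes on the columns of A; for
   a suitable j it does not vanish on b. *)
have [j hj] : exists j, (b2^T *m cokermx A2^T) 0 j != 0.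
  apply: contrapT => h; move/negP: hb; apply; apply/eqP/rowP => j; rewrite [RHS]mxE.
  by apply: contrapT => /eqP hj; apply: h; exists j.
pose e i := xchoose (lift (cokermx A2^T i j)).
have eE i : (e i)%:~R = cokermx A2^T i j by exact/eqP/(xchooseP (lift (cokermx A2^T i j))).
exists e; split=> [k|].
  have /matrixP/(_ k j) := mulmx_coker A2^T; rewrite mxE [RHS]mxE => h.
  rewrite (dvdz_pcharf h2) rmorph_sum; apply/eqP; apply: etrans h; apply: eq_bigr => i _ /=.
  by rewrite intrM eE mulrC !mxE.
rewrite (dvdz_pcharf h2) rmorph_sum /=; apply: contra hj => /eqP h.
rewrite mxE; apply/eqP; apply: etrans h; apply: eq_bigr => i _ /=.
by rewrite intrM eE mulrC !mxE.
Qed.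

End Parity.

(** Transport of [induced_sign] along s + n = r. Once the equation is eliminated, [conform_mx] is
    the identity. *)
Lemma induced_sign_cast (R : realType) (n r ell s : nat) (A : 'M[int]_(r, n)) (b : 'cV[int]_r)
    (pts : 'I_ell -> 'cV[int]_n) (N : nat) (Q : 'M[int]_(ell, 1 + n)) (ct : 'cV[int]_(1 + n))
    (sg : R) z (L0 L : 'M[R]_(s, r)) (W : 'M[R]_(n, r)) (G : 'M[R]_s) (E : 'M[R]_(n, ell)) g kappa :
  (s + n)%N = r -> (0 < ell)%N -> (forall i k, 0 <= (A *m pts k + b) i 0) ->
  odd N -> hat_mx pts *m Q = (N%:Z)%:M ->
  (forall i, ~~ (2 %| (row_mx b A *m ct) i ord0)%Z) ->
  sg != 0 -> (0 < sg \/ (2 %| ct (lshift n ord0) ord0)%Z) ->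
  let phi y := sg *: psi A b pts y in
  orienting_point A b pts phi z -> is_frame (LieK A b) L0 -> is_frame (LieK A b) L ->
  L = G *m L0 -> G \in unitmx -> smooth_pt pts (phi z) ->
  is_frame (Yplus_tangent pts (phi z)) E ->
  (forall i, 'd phi z (row i W) = row i E) -> oriented_chart pts Q ct (phi z) g kappa ->
  0 < detJ g (phi z) E * kappa
    * \det (conform_mx (0 : 'M[R]_r) (col_mx (\matrix_i inf_action z (row i L)) W)) * \det G
    * (\det (L0 *m L0^T) * \det (conform_mx (0 : 'M[R]_r) (row_mx L0^T (map_mx intr A)))).
Proof.
move=> e; case: _ / e in A b z L0 L W *.
move=> ell0 ge0 oN HQ co s0 sp phi oz F0 F LG Gu sz EF WE oc.
rewrite !conform_mx_id inf_action_frame.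
exact: (induced_sign ell0 ge0 oN HQ co s0 sp oz F0 F LG Gu sz EF WE oc).
Qed.

Lemma sign_eq (R : realType) (x y u v : R) :
  0 < x * y * u * v -> (0 < x) = ((0 < y) == ((0 < u) == (0 < v))).
Proof.
move=> h; have hn : [&& x != 0, y != 0, u != 0 & v != 0].
  have := lt0r_neq0 h; rewrite !mulf_eq0 !negb_or.
  by case/andP=> /andP[/andP[-> ->] ->] ->.
move: h; case/and4P: hn => x0 y0 u0 v0.
have E (a c : R) : a != 0 -> (0 < a * c) = if 0 < a then 0 < c else c < 0.
  case: (ltrgt0P a) => // ha _; [exact: pmulr_rgt0 | exact: nmulr_rgt0].
have E' (a c : R) : a != 0 -> (a * c < 0) = if 0 < a then c < 0 else 0 < c.
  case: (ltrgt0P a) => // ha _; [exact: pmulr_rlt0 | exact: nmulr_rlt0].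
rewrite -!mulrA !(E, E') //.
by case: (ltrgt0P x) x0; case: (ltrgt0P y) y0; case: (ltrgt0P u) u0; case: (ltrgt0P v) v0.
Qed.

Section Choice.
Variables (n r : nat) (A : 'M[int]_(r, n)) (b : 'cV[int]_r).

(** The first entry of ct decides how tau behaves under q -> - q. It can be made even when b is a
    combination of the columns of A modulo 2; otherwise the dual vector [e] provides the sign change
    for [psi_flip]. *)
Lemma odd_combination :
  (exists2 v : 'cV[int]_r, col_span (row_mx A b) v & forall i, ~~ (2 %| v i ord0)%Z) ->
  exists ct : 'cV[int]_(1 + n), (forall i, ~~ (2 %| (row_mx b A *m ct) i ord0)%Z) /\
    ((2 %| ct (lshift n ord0) ord0)%Z \/
     exists e : 'I_r -> int, (forall j, (2 %| \sum_i e i * A i j)%Z) /\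
       ~~ (2 %| \sum_i e i * b i ord0)%Z).
Proof.
move=> [_ [w _ <-] hv].
have hw i : (row_mx A b *m w) i ord0 = (A *m usubmx w) i ord0 + b i ord0 * dsubmx w ord0 ord0.
  by rewrite -{1}[w]vsubmxK mul_row_col mxE [X in _ + X]mxE big_ord1.
case: (parity_alternative A b) => [[c hc]|he].
  (* The multiple of b is replaced by the same multiple of A c, which is congruent to it modulo 2,
     so that the coefficient of b becomes 0. *)
  exists (col_mx 0 (usubmx w + dsubmx w ord0 ord0 *: c)); split=> [i|].
    apply: contra (hv i); rewrite mul_row_col mulmx0 add0r mulmxDr -scalemxAr hw.
    rewrite mxE [X in _ + X]mxE => h.
    have := hc i; rewrite mxE [X in _ + X]mxE => /dvdzP[h1 /(canRL (subrK _)) E].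
    move/dvdzP: h => [h2 h]; apply/dvdzP; exists (h2 - h1 * dsubmx w ord0 ord0).
    rewrite E in h; rewrite mulrBl -h; ring.
  by left; rewrite col_mxEu mxE dvdz0.
exists (col_mx (dsubmx w) (usubmx w)); split; last by right.
move=> i; apply: contra (hv i).
by rewrite hw mul_row_col mxE [X in X + _]mxE big_ord1 addrC.
Qed.

End Choice.

Theorem theorem2p6 (R : realType) (n r ell : nat)
    (Delta : set 'cV[R]_n) (A : 'M[int]_(r, n)) (b : 'cV[int]_r)
    (pts : 'I_ell -> 'cV[int]_n)
    (hpoly : lattice_polytope Delta)
    (hfull : full_dimensional Delta)
    (hfacets : facet_description Delta A b)
    (hpts : enum_lattice_points Delta pts)
    (hindex : odd_index (affine_lattice_dir pts) [set: 'cV[int]_n])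
    (hsat : odd_index (col_span A) (saturation A))
    (hodd : exists2 v : 'cV[int]_r, col_span (row_mx A b) v
              & forall i, ~~ (2 %| v i ord0)%Z)
    (oK : 'M[R]_(r - n, r) -> bool)
    (hoK : is_orientation (LieK A b) oK) :
  psi_induces_orientation A b pts oK.
Proof.
have ell_gt0 := points_exist hpoly hpts.
have exp_ge0 := exponent_ge0 hfacets hpts.
have [N oddN [Q HQ]] := odd_index_section ell_gt0 hindex.
have [ct [ct_odd ct_alt]] := odd_combination hodd.
have smoothE (p : 'rV[R]_ell) : Yplus_smooth pts p <-> smooth_pt pts p.
  exact: (Yplus_smoothE ell_gt0 (HF_full oddN HQ _)).
pose o := orientation hpoly hfacets hpts ell_gt0 oddN HQ ct_odd.
have o_manifold c : is_manifold_orientation (Yplus_smooth pts) (Yplus_tangent pts) (o c).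
  have -> : Yplus_smooth pts = [set p : 'rV[R]_ell | smooth_pt pts p].
    by apply/seteqP; split=> p /smoothE.
  exact: orientation_manifold.
have nr := subnK (facets_rank hpoly hfacets hpts).
(* Without a frame of the Lie algebra the conditions on the induced orientation are vacuous, and any
   orientation will do. *)
have [[L0 L0F]|noL] := pselect (exists L0 : 'M[R]_(r - n, r), is_frame (LieK A b) L0); last first.
  exists (o true); split=> // [z _ L W E LF|P N' im _ _ _ phi z _ L W E LF];
  by case: noL; exists L.
(* This collects the signs that do not depend on the point: that of the reference frame [L0] under
   [oK], and the constant factors of [frame_det]. *)
pose c0 := oK L0 == (0 < \det (L0 *m L0^T) *
  \det (conform_mx (0 : 'M[R]_r) (row_mx L0^T (map_mx intr A)))).
have main (sg : R) (phi : 'rV[R]_r -> 'rV[R]_ell) : sg != 0 ->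
    (0 < sg \/ (2 %| ct (lshift n ord0) ord0)%Z) ->
    phi = (fun y => sg *: psi A b pts y) ->
    forall z, orienting_point A b pts phi z ->
      induced_orientation A b pts phi z oK (o c0 (phi z)).
  move=> sg0 sgp -> z oz L W E LF EF WE Lz.
  have [_ /smoothE sz _ _] := oz.
  have [G Gu LG] := frame_coord L0F LF.
  have oc := chart_dataP hpoly hfacets hpts ell_gt0 oddN HQ ct_odd sz.
  have := induced_sign_cast nr ell_gt0 exp_ge0 oddN HQ ct_odd sg0 sgp oz L0F LF LG Gu sz EF WE oc.
  move=> /sign_eq; rewrite /o /orientation => ->.
  rewrite LG (hoK _ _ L0F Gu) -LG /c0 -/Lz.
  by do !case: (0 < _); case: (oK L0).
exists (o c0); split; first exact: o_manifold.
  apply: (main 1); [exact: oner_neq0 | by left; exact: ltr01 |].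
  by apply/funext => z; rewrite scale1r.
move=> P N' im _ imP imN phi.
apply: (main (-1)); first by rewrite oppr_eq0 oner_neq0.
(* If ct_0 is not known to be even, [psi_flip] writes each psi z as - psi z' with psi z' in P, so
   the image lies in - P, against the assumption. *)
- case: ct_alt => [|[e [eA eb]]]; first by right.
  case: imN => _ [z zB <-].
  have [z' zB' zE] := psi_flip eA eb zB.
  exists (psi A b pts z'); last by rewrite zE opprK.
  by apply: imP; exists z'.
- by apply/funext => z; rewrite scaleN1r.
Qed.
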